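(* Let $L>0$ and let $f_\xi\colon\mathcal H\to\mathbb R$, $\xi\sim\mathcal D$, be a family of convex, $L$-smooth functions, such that $\xi\mapsto f_\xi(x)$ is $\mathcal D$-measurable and $f(x)=\mathbb E_{\xi\sim\mathcal D}[f_\xi(x)]$ is finite for all $x\in\mathcal H$, $f_\xi$ is differentiable for $\mathcal D$-almost all $\xi$, $\nabla f(x)=\mathbb E_\xi[\nabla f_\xi(x)]$ for all $x\in\mathcal H$, and $f$ has a minimizer. Assume there exists $x_*\in\mathrm{argmin} f$ such that $\mathbb E[\|\nabla f_\xi(x_* )\|^2]\le\sigma_*^2<+\infty$. Let $\gamma\in(0,2/L)$, $x_0\in\mathcal H$, and let $(x_k)$ be generated by stochastic gradient descent $$x_{k+1}=x_k-\gamma\lambda_k\nabla f_{\xi_k}(x_k),\qquad\xi_k\overset{\text{iid}}{\sim}\mathcal D,\quad k\ge0.$$ Then, for any constant $\bar\lambda\in(0,1)$, $$\mathbb E[\|\nabla f(x_{N_K})\|]\le\begin{cases}\mathcal O(K^{-\frac14})&\text{if }\lambda_k\equiv\bar\lambda K^{-\frac12},\\ \mathcal O(\ln(K)^{\frac12}K^{-\frac14})&\text{if }\lambda_k=\bar\lambda(k+1)^{-\frac12}\ln(k+e)^{-1},\end{cases}$$ where $N_K$ is the random index defined in the context, and $$\mathbb E[\|\nabla f(x_K)\|]\le\begin{cases}\mathcal O(K^{-\frac16})&\text{if }\lambda_k\equiv\bar\lambda K^{-\frac23},\\ \mathcal O(\ln(K)^{\frac12}K^{-\frac16})&\text{if }\lambda_k=\bar\lambda(k+1)^{-\frac23}.\end{cases}$$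 Moreover, for each of the two schedules that do not depend on the horizon, namely $\lambda_k=\bar\lambda(k+1)^{-\frac12}\ln(k+e)^{-1}$ and $\lambda_k=\bar\lambda(k+1)^{-\frac23}$, $(x_k)$ converges weakly almost surely to a minimizer of $f$, and $\|\nabla f(x_k)\|\to0$ almost surely.
   Context: $\mathcal H$ is a real separable Hilbert space with norm $\|\cdot\|$, and $\mathcal D$ is a probability distribution. $L$-smooth means differentiable with $L$-Lipschitz gradient. Define $\Lambda_k=\prod_{i=0}^{k-1}(1+2\lambda_i^2)^{-1}$. The random index $N_K\in\{0,\dots,K-1\}$ is independent of the algorithmic randomness $(\xi_k)$ and satisfies $$\mathbb P(N_K=k)=\frac{\Lambda_{k+1}\lambda_k(1-\lambda_k)}{\sum_{k'=0}^{K-1}\Lambda_{k'+1}\lambda_{k'}(1-\lambda_{k'})},\quad k=0,\dots,K-1.$$ $\mathbb E$ is over all sources of randomness. For the schedules $\lambda_k\equiv\bar\lambda K^{-1/2}$ and $\lambda_k\equiv\bar\lambda K^{-2/3}$, for each horizon $K$ the algorithm is run afresh for $K$ iterations with that constant parameter. $\mathcal O(\cdot)$ is understood as $K\to\infty$ with constants not depending on $K$. The starting point $x_0$ is deterministic, and the weak limit may be random. *)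

(* Defs.v *)
From HB Require Import structures.
From mathcomp Require Import all_boot all_order all_algebra finmap.
From mathcomp Require Import all_classical all_reals all_analysis.

Set Implicit Arguments.
Unset Strict Implicit.
Unset Printing Implicit Defensive.

Import Order.TTheory GRing.Theory Num.Theory.
Import numFieldNormedType.Exports.

Local Open Scope classical_set_scope.
Local Open Scope ring_scope.

Definition separable (T : topologicalType) : Prop :=
  exists2 S : set T, countable S & dense S.

Definition minimizer (T : Type) (R : realType) (f : T -> R) (x : T) : Prop :=
  forall y, f x <= f y.

Section hilbert.
Context {R : realType} {H : completeNormedModType R}.
Variable ip : {dot H for @idfun R}.

(* The Riesz representative of the Frechet derivative; 0 by convention where f
   is not differentiable. *)
Definition grad (f : H -> R) (x : H) : H :=
  xget 0 [set g | differentiable f x /\ 'd f x = ip g :> (H -> R)].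

Definition smooth (L : R) (f : H -> R) : Prop :=
  (forall x, differentiable f x) /\
  (forall x y, `|grad f x - grad f y| <= L * `|x - y|).

Definition weakly_cvg (u : nat -> H) (x : H) : Prop :=
  forall v, ip (u k) v @[k --> \oo] --> ip x v.

End hilbert.

(* m is the Bochner integral of g: g is an a.e. limit of simple functions s n
   with \int |g - s n| --> 0, and m is the limit of the integrals of the s n. *)
Definition is_bochner_integral {R : realType} {H : completeNormedModType R}
    {d : measure_display} {T : measurableType d} (mu : probability T R)
    (g : T -> H) (m : H) : Prop :=
  exists (N : nat -> nat) (A : nat -> nat -> set T) (v : nat -> nat -> H),
    let s n t := \sum_(i < N n) (\1_(A n i) t : R) *: v n i in
    [/\ forall n i, measurable (A n i),
        {ae mu, forall t, s n t @[n --> \oo] --> g t},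
        (\int[mu]_t `|g t - s n t|%R%:E)%E @[n --> \oo] --> 0%E &
        \sum_(i < N n) fine (mu (A n i)) *: v n i @[n --> \oo] --> m].

Section random_sequences.
Context {R : realType} {d : measure_display} {Xi : measurableType d}
  {d' : measure_display} {Omega : measurableType d'} {P : probability Omega R}.

Definition iid (D : probability Xi R) (xi : nat -> {RV P >-> Xi}) : Prop :=
  (forall k A, measurable A -> distribution P (xi k) A = D A) /\
  (forall (J : {fset nat}) (A : nat -> set Xi), (forall j, measurable (A j)) ->
    P (\bigcap_(j in [set` J]) xi j @^-1` A j) =
    (\prod_(j <- J) P (xi j @^-1` A j))%E).

Definition independent_of_sequence (N : {RV P >-> nat})
    (xi : nat -> {RV P >-> Xi}) : Prop :=
  forall (B : set nat) (E : set Omega),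
    <<s \bigcup_k preimage_set_system setT (xi k) measurable >> E ->
    P (N @^-1` B `&` E) = (P (N @^-1` B) * P E)%E.

Definition Lambda (lam : nat -> R) (k : nat) : R :=
  \prod_(i < k) (1 + 2 * lam i ^+ 2)^-1.

Definition index_weight (lam : nat -> R) (k : nat) : R :=
  Lambda lam k.+1 * lam k * (1 - lam k).

Definition random_index (lam : nat -> R) (K : nat)
    (xi : nat -> {RV P >-> Xi}) (N : {RV P >-> nat}) : Prop :=
  [/\ forall w, (N w < K)%N,
      forall k, (k < K)%N -> P (N @^-1` [set k]) =
        (index_weight lam k / \sum_(k' < K) index_weight lam k')%:E &
      independent_of_sequence N xi].

End random_sequences.

Section sgd.
Context {R : realType} {H : completeNormedModType R}.
Variable ip : {dot H for @idfun R}.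
Context {d : measure_display} {Xi : measurableType d}.
Variables (D : probability Xi R) (F : Xi -> H -> R) (f : H -> R).
Variables (gamma : R) (x0 : H).

Fixpoint sgd (lam : nat -> R) (xi : nat -> Xi) (k : nat) : H :=
  if k is k'.+1 then
    let x := sgd lam xi k' in x - (gamma * lam k') *: grad ip (F (xi k')) x
  else x0.

(* lam K is the schedule used with horizon K. Each horizon may be run on its own
   probability space; the constant C does not depend on that space. *)
Definition random_iterate_rate (lam : nat -> nat -> R) (rate : nat -> R) : Prop :=
  exists C : R, \forall K \near \oo,
    forall (d' : measure_display) (Omega : measurableType d')
      (P : probability Omega R) (xi : nat -> {RV P >-> Xi}) (N : {RV P >-> nat}),
    iid D xi -> random_index (lam K) K xi N ->
    ('E_P[fun w => `|grad ip f (sgd (lam K) (fun k => xi k w) (N w))|%R]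
      <= (C * rate K)%R%:E)%E.

Definition last_iterate_rate (lam : nat -> nat -> R) (rate : nat -> R) : Prop :=
  exists C : R, \forall K \near \oo,
    forall (d' : measure_display) (Omega : measurableType d')
      (P : probability Omega R) (xi : nat -> {RV P >-> Xi}),
    iid D xi ->
    ('E_P[fun w => `|grad ip f (sgd (lam K) (fun k => xi k w) K)|%R]
      <= (C * rate K)%R%:E)%E.

Definition almost_sure_convergence (lam : nat -> R) : Prop :=
  forall (d' : measure_display) (Omega : measurableType d')
    (P : probability Omega R) (xi : nat -> {RV P >-> Xi}),
  iid D xi ->
  {ae P, forall w, exists2 x, minimizer f x &
     weakly_cvg ip (sgd lam (fun k => xi k w)) x} /\
  {ae P, forall w,
     `|grad ip f (sgd lam (fun k => xi k w) k)| @[k --> \oo] --> 0}.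

End sgd.

(* Main.v *)
Require Import Defs.
From HB Require Import structures.
From mathcomp Require Import all_boot all_order all_algebra finmap.
From mathcomp Require Import all_classical all_reals all_analysis.
From mathcomp Require Import measurable_realfun ring lra.

Set Implicit Arguments.
Unset Strict Implicit.
Unset Printing Implicit Defensive.

Import Order.TTheory GRing.Theory Num.Theory.
Import numFieldNormedType.Exports.

Local Open Scope classical_set_scope.
Local Open Scope ring_scope.

(** The variance is controlled only at a minimizer z, so the step itself has to pay for |grad F_xi
    x|^2. Young's inequality with weights 1/lbar and 1/(1 - lbar) splits it: as lam <= lbar, the
    part in |grad F_xi x - grad F_xi z|^2 costs a term linear in lam, which cocoercivity absorbs for
    gamma < 2/L; the other part is the noise, of order lam^2. The noise in the value recursion is
    itself proportional to the gap. In the mean this is harmless, since the gap is at most L/2 times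
    a squared distance of bounded mean; almost surely it is absorbed by adding a multiple of |x -
    z|^2 to f x - f z. The law of N_K is comparable to lam_k / sum lam, because the sums of lam_k^2
    stay bounded uniformly in the horizon. The space H carries no sigma-algebra: an H-valued map is
    measurable when its distances to fixed points are, and stochastic gradients are averaged only
    through inner products with fixed vectors. *)

(* A convex L-smooth function satisfies
   0 <= F y - F x - <grad F x, y - x> <= L/2 |y - x|^2, and this two-sided
   (Bregman) bound is inherited by f. Conditionally on the past, one step x -> x+
   of the method has, for every minimizer z,
     E |x+ - z|^2 + c lam (f x - f z) <= |x - z|^2 + C lam^2,
     E f(x+) <= f x + C lam^2 (1 + f x - f z).
   Summing the first inequality bounds sum lam_k E (f x_k - f z), hence the gap at
   the random index; the second one transfers the bound from an average over a
   window of indices to the last iterate. Both become rates for the gradient through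
   |grad f x|^2 <= 2 L (f x - f z). Almost surely, |x_k - z|^2 and f x_k - f z
   converge: y_k plus a deterministic tail is a nonnegative supermartingale Z_k, and
   1 / (1 + Z_k) is a bounded submartingale, which converges by the maximal
   inequality applied to its square. Summability of lam_k (f x_k - f z) forces
   f x_k -> f z, and Opial's lemma gives the weak limit. Conditional expectations are
   replaced by Fubini for the product of the past sigma-algebra and the next sample. *)

(** * Hilbert space preliminaries *)

Section inner_product.
Context {R : realType} {H : completeNormedModType R}.
Variable ip : {dot H for @idfun R}.
Hypothesis ip_norm : forall x : H, ip x x = `|x| ^+ 2.

Lemma ipC x y : ip x y = ip y x.
Proof. by rewrite hermC /= mul1r. Qed.

Lemma ipDl x y z : ip (x + y) z = ip x z + ip y z.
Proof. by rewrite linearDl. Qed.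

Lemma ipDr z x y : ip z (x + y) = ip z x + ip z y.
Proof. by rewrite linearDr. Qed.

Lemma ipNl x z : ip (- x) z = - ip x z.
Proof. by rewrite linearNl. Qed.

Lemma ipNr x z : ip z (- x) = - ip z x.
Proof. by rewrite linearNr. Qed.

Lemma ipZl a x z : ip (a *: x) z = a * ip x z.
Proof. by rewrite linearZl_LR. Qed.

Lemma ipZr a x z : ip z (a *: x) = a * ip z x.
Proof. by rewrite linearZr_LR. Qed.

Lemma ip0l x : ip 0 x = 0.
Proof. by rewrite -(scale0r x) ipZl mul0r. Qed.

Lemma normDsq x y : `|x + y| ^+ 2 = `|x| ^+ 2 + 2 * ip x y + `|y| ^+ 2.
Proof. by rewrite -!ip_norm ipDl !ipDr (ipC y x); ring. Qed.

Lemma normBsq x y : `|x - y| ^+ 2 = `|x| ^+ 2 - 2 * ip x y + `|y| ^+ 2.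
Proof. by rewrite normDsq ipNr normrN; ring. Qed.

Lemma ip_le x y : ip x y <= `|x| * `|y|.
Proof.
have h : `|x + y| ^+ 2 <= (`|x| + `|y|) ^+ 2.
  by rewrite lerXn2r ?nnegrE ?addr_ge0// ler_normD.
by move: h; rewrite normDsq; nra.
Qed.

Lemma norm_ip_le x y : `|ip x y| <= `|x| * `|y|.
Proof. by rewrite ler_norml ip_le andbT lerNl -ipNl -(normrN x) ip_le. Qed.

(** First-order condition at a minimum. At t = -a/(b+1) the quadratic equals -a^2/(b+1)^2; dividing
    by b+1 covers b = 0. *)
Lemma ip_ge_quadratic_eq0 (a b : R) :
  0 <= b -> (forall t, 0 <= t * a + t ^+ 2 * b) -> a = 0.
Proof.
move=> b0 /(_ (- a / (b + 1))) h.
have b1 : 0 < b + 1 by lra.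
have : 0 <= - (a ^+ 2).
  have -> : - a ^+ 2 = (b + 1) ^+ 2 * (- a / (b + 1) * a + (- a / (b + 1)) ^+ 2 * b).
    by field; rewrite gt_eqF.
  by rewrite mulr_ge0// sqr_ge0.
by rewrite oppr_ge0 => h2; apply/eqP; rewrite -sqrf_eq0 eq_le h2 sqr_ge0.
Qed.

Lemma cvg_ipl (T : Type) (U : set_system T) {FU : Filter U} (u : T -> H) (x v : H) :
  u t @[t --> U] --> x -> ip (u t) v @[t --> U] --> ip x v.
Proof.
move=> ux; apply/cvgrPdist_lt => e e0.
have v1 : 0 < `|v| + 1 by rewrite ltr_wpDl.
have e1 : 0 < e / (`|v| + 1) by rewrite divr_gt0.
have /cvgrPdist_lt/(_ _ e1) := ux; apply: filterS => t.
rewrite ltr_pdivlMr// => h; rewrite -ipNl -ipDl.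
apply: le_lt_trans (norm_ip_le _ _) _; apply: le_lt_trans h.
by rewrite ler_wpM2l// lerDl.
Qed.

Lemma sqr_cauchy_cvg (u : nat -> H) (e : nat -> R) :
  e n @[n --> \oo] --> 0 ->
  (forall n m, (n <= m)%N -> `|u n - u m| ^+ 2 <= e n) -> cvgn u.
Proof.
move=> e0 ue; apply/cauchy_cvgP/cauchy_exP => eps eps0.
have eps2 : 0 < eps ^+ 2 by rewrite exprn_gt0.
have /cvgr0Pnorm_lt/(_ _ eps2) [N _ /(_ N (leqnn _)) /= eN] := e0.
exists (u N); exists N => // m /= Nm; rewrite -ball_normE /=.
rewrite -(@ltr_pXn2r _ 2) ?nnegrE ?(ltW eps0)//.
apply: le_lt_trans eN; apply: le_trans (ue _ _ Nm) _; exact: ler_norm.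
Qed.

(** The representative is the minimizer of J x = |x|^2/2 - l x. The parallelogram identity makes
    minimizing sequences Cauchy, and the first variation of J at the limit vanishes. *)
Theorem riesz (l : H -> R) (M : R) :
  (forall a x y, l (a *: x + y) = a * l x + l y) ->
  (forall x, `|l x| <= M * `|x|) -> exists g, forall x, l x = ip g x.
Proof.
move=> lin bnd.
have lD x y : l (x + y) = l x + l y by rewrite -(scale1r x) lin mul1r scale1r.
have l0 : l 0 = 0 by have := lin 1 0 0; rewrite scale1r addr0; lra.
have lZ a x : l (a *: x) = a * l x by rewrite -(addr0 (a *: x)) lin l0 addr0.
pose J x := `|x| ^+ 2 / 2 - l x.
have Jge x : - (M ^+ 2) / 2 <= J x.
  have := le_trans (ler_norm _) (bnd x).
  have := sqr_ge0 (`|x| - M); rewrite /J; nra.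
have hJ : has_inf (range J).
  by split; [exists (J 0), 0 | exists (- (M ^+ 2) / 2) => _ [x _ <-]].
have Jinf x : inf (range J) <= J x by apply: ge_inf; [apply hJ.2 | exists x].
have /choice [u uP] (n : nat) : exists x, J x < inf (range J) + n.+1%:R^-1.
  have n0 : 0 < n.+1%:R^-1 :> R by rewrite invr_gt0.
  by have [_ [x _ <-] ?] := inf_adherent n0 hJ; exists x.
have para x y : `|x - y| ^+ 2 = 4 * (J x + J y - 2 * J (2^-1 *: (x + y))).
  by rewrite /J lZ lD -!ip_norm ipZl ipZr !ipDl !ipDr !ipNl !ipNr (ipC y x); field.
have cu : cvgn u.
  (* J (u n) + J (u m) exceeds twice the infimum by at most 2/(n+1) when n <= m, and [para]
     multiplies this by 4. *)
  apply: (@sqr_cauchy_cvg u (fun n => 8 * n.+1%:R^-1)).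
    by rewrite -(mulr0 8); apply: cvgMl_tmp; exact: cvg_harmonic.
  move=> n m nm; rewrite para.
  have := uP n; have := uP m; have := Jinf (2^-1 *: (u n + u m)).
  have : m.+1%:R^-1 <= n.+1%:R^-1 :> R by rewrite lef_pV2 ?posrE// ler_nat.
  move: (m.+1%:R^-1) (n.+1%:R^-1) (J (u n)) (J (u m)) (J _) => a b c d' e; lra.
exists (limn u) => v.
suff : ip (limn u) v - l v = 0 by lra.
apply: (@ip_ge_quadratic_eq0 _ (`|v| ^+ 2 / 2)); first by rewrite divr_ge0.
move=> t.
(* Compares J at u n + t v with J at u n, which is minimal up to 1/(n+1); this error vanishes in the
   limit. *)
have key n : 0 <= t * (ip (u n) v - l v) + t ^+ 2 * (`|v| ^+ 2 / 2) + n.+1%:R^-1.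
  have := Jinf (u n + t *: v); have := uP n; move: (n.+1%:R^-1) => k.
  by rewrite /J lD lZ normDsq normrZ exprMn real_normK ?num_real// ipZr; lra.
have : t * (ip (u n) v - l v) + t ^+ 2 * (`|v| ^+ 2 / 2) + n.+1%:R^-1 @[n --> \oo]
   --> t * (ip (limn u) v - l v) + t ^+ 2 * (`|v| ^+ 2 / 2) + 0.
  apply: cvgD; last exact: cvg_harmonic.
  apply: cvgD; last exact: cvg_cst.
  apply: cvgMl_tmp; apply: cvgB; last exact: cvg_cst.
  exact: cvg_ipl.
rewrite addr0 => h.
by rewrite -(cvg_lim _ h)//; apply: limr_ge; [apply/cvg_ex; eexists; exact: h | exact: nearW].
Qed.
End inner_product.

(** * Gradients and two-sided Bregman bounds *)

Section gradient.
Context {R : realType} {H : completeNormedModType R}.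
Variable ip : {dot H for @idfun R}.
Hypothesis ip_norm : forall x : H, ip x x = `|x| ^+ 2.

(** By Riesz the default value 0 of [grad] is never taken for lack of a representative at a point of
    differentiability. *)
Lemma diff_grad (f : H -> R) x v :
  differentiable f x -> 'd f x v = ip (grad ip f x) v.
Proof.
move=> df; rewrite /grad; case: xgetP => [g _ [_ ->]//|nex].
have [k k0 kb] := linear_lipschitz (diff_continuous df).
have [g gE] : exists g, forall y, 'd f x y = ip g y.
  by apply: (riesz ip_norm (M := k)) => // a y z; rewrite linearP.
by exfalso; apply: (nex g); split => //; apply/funext.
Qed.

Lemma cvg_harmonic_dnbhs : n.+1%:R^-1 @[n --> \oo] --> (0 : R)^'.
Proof.
move=> A [e /= e0 eA].
have /cvgrPdist_lt/(_ _ e0) := @cvg_harmonic R; apply: filterS => n /= h.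
by apply: eA => //=; rewrite gt_eqF// invr_gt0.
Qed.

(** Steps 1/(n+1) give a countable limit. For the objective this becomes the hypothesis [f_quotient]
    of the later sections. *)
Lemma cvg_grad_quotient (f : H -> R) x v : differentiable f x ->
  n.+1%:R * (f (x + n.+1%:R^-1 *: v) - f x) @[n --> \oo] --> ip (grad ip f x) v.
Proof.
move=> df; rewrite -diff_grad// -deriveE//.
have /cvg_ex[l lP] := diff_derivable (v := v) df.
rewrite (_ : 'D_v f x = l); last exact: cvg_lim.
have := cvg_comp _ _ cvg_harmonic_dnbhs lP.
apply: cvg_trans; apply: near_eq_cvg; apply: nearW => n /=.
by rewrite invrK [_ *: v + x]addrC.
Qed.

Lemma line_is_derive (f : H -> R) x v t : differentiable f (x + t *: v) ->
  is_derive t 1 (fun s => f (x + s *: v)) (ip (grad ip f (x + t *: v)) v).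
Proof.
move=> df.
have E : (fun h : R => h^-1 *: (((fun s => f (x + s *: v)) \o shift t) (h *: 1)
            - f (x + t *: v)))
       = (fun h : R => h^-1 *: ((f \o shift (x + t *: v)) (h *: v) - f (x + t *: v))).
  by apply/funext => h /=; rewrite [h *: 1]mulr1 scalerDl addrCA.
have := diff_derivable (v := v) df; rewrite /derivable -E => d.
split; first exact: d.
rewrite -(diff_grad v df) -(deriveE v df).
by rewrite /derive -E.
Qed.

(** Stated for a pair (F, G) so that it can be averaged over samples before the averaged G is
    identified; the bounds force G to be the gradient of F. *)
Definition bregman_bounds (L : R) (F : H -> R) (G : H -> H) : Prop :=
  forall x y, 0 <= F y - F x - ip (G x) (y - x) <= L / 2 * `|y - x| ^+ 2.

Lemma descent_lemma (L : R) (f : H -> R) : 0 < L -> smooth ip L f ->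
  forall x v, f (x + v) - f x - ip (grad ip f x) v <= L / 2 * `|v| ^+ 2.
Proof.
move=> L0 [df lip] x v.
(* f along the segment minus the claimed quadratic upper bound; the Lipschitz gradient makes its
   derivative nonpositive, so the mean value theorem replaces integration along the segment. *)
pose psi := (fun s => f (x + s *: v)) -
  (fun s : R => s * (ip (grad ip f x) v) + L / 2 * `|v| ^+ 2 * (s * s)).
pose dpsi s := ip (grad ip f (x + s *: v)) v -
  (ip (grad ip f x) v + L * `|v| ^+ 2 * s).
have dp t : is_derive t (1 : R) psi (dpsi t).
  apply: is_deriveB; first exact: line_is_derive.
  apply: is_derive_eq; rewrite /GRing.scale /= /cst; lra.
have cpsi : {within `[0, 1], continuous psi}.
  by apply: derivable_within_continuous => t _; exact: ex_derive.
have [c] := @MVT_segment R psi dpsi 0 1 ler01 (fun t _ => dp t) cpsi.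
rewrite in_itv /= => /andP[c0 c1].
rewrite subr0 mulr1.
have -> : psi 1 - psi 0 = f (x + v) - f x - ip (grad ip f x) v - L / 2 * `|v| ^+ 2.
  by rewrite /psi !fctE scale1r scale0r addr0; lra.
suff : dpsi c <= 0 by lra.
rewrite /dpsi opprD addrA subr_le0.
rewrite -ipNl -ipDl; apply: le_trans (ip_le ip_norm _ _) _.
apply: (@le_trans _ _ (L * `|x + c *: v - x| * `|v|)).
  by apply: ler_wpM2r.
by rewrite addrC addKr normrZ ger0_norm//; lra.
Qed.

Lemma convex_smooth_bregman (L : R) (f : H -> R) : 0 < L -> smooth ip L f ->
  convex_function [set: convex_lmodType H] f -> bregman_bounds L f (grad ip f).
Proof.
move=> L0 sf cf x y; apply/andP; split; last first.
  by have := descent_lemma L0 sf x (y - x); rewrite (addrC x) subrK.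
rewrite subr_ge0; have := cvg_grad_quotient (v := y - x) (sf.1 x).
(* Convexity bounds the slopes from x towards y by the slope of the whole chord; their limit is the
   lower Bregman bound. *)
have bnd (n : nat) : n.+1%:R * (f (x + n.+1%:R^-1 *: (y - x)) - f x) <= f y - f x.
  have n0 : (0 : R) < n.+1%:R by [].
  have i01 : Itv.spec (@Itv.num_sem R) (Itv.Real `[0%Z, 1%Z]) (n.+1%:R^-1).
    rewrite /= /Itv.num_sem /= in_itv /= num_real /= invr_ge0 ler0n /=.
    by rewrite invf_le1// ler1n.
  have := cf (Itv.Def i01) y x; rewrite !inE => /(_ I I) /=.
  have -> : conv (Itv.Def i01) (y : convex_lmodType H) x = x + n.+1%:R^-1 *: (y - x) :> H.
    by rewrite /conv /= /unstable.onem scalerBl scale1r scalerBr addrCA.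
  move=> h; have {}h : f (x + n.+1%:R^-1 *: (y - x)) <=
    n.+1%:R^-1 * f y + (1 - n.+1%:R^-1) * f x := h.
  by rewrite -ler_pdivlMl//; move: (n.+1%:R^-1) h => k; lra.
move=> h; rewrite -(cvg_lim _ h)//;
apply: limr_le; [by apply/cvg_ex; eexists; exact: h | exact: nearW].
Qed.

Lemma bregman_grad_le (L : R) F G : 0 < L -> bregman_bounds L F G ->
  forall x y, `|G y - G x| ^+ 2 <= 2 * L * (F y - F x - ip (G x) (y - x)).
Proof.
move=> L0 bF x y.
(* the function [F - ip (G x)] is minimal at [x] and drops by [|D|^2/(2 L)]
   along the gradient step from [y] *)
pose D := G y - G x.
pose w := y - L^-1 *: D.
have /andP[h1 _] := bF x w; have /andP[_ h2] := bF y w.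
have e1 : w - y = - (L^-1 *: D) by rewrite /w addrC addrA addNr sub0r.
have e2 : w - x = (y - x) - L^-1 *: D by rewrite /w addrAC.
move: h1 h2; rewrite e1 e2 normrN normrZ exprMn ger0_norm ?invr_ge0 ?(ltW L0)//.
rewrite [ip (G x) (_ - _ - _)]ipDr [ip _ (- (_ *: _))]ipNr ipZr.
rewrite [ip (G y) (- (_ *: _))]ipNr ipZr => h1 h2.
have e3 : ip (G y) D = ip (G x) D + `|D| ^+ 2.
  by rewrite -ip_norm -ipDl [G x + D]addrC /D subrK.
have h3 : L / 2 * (L^-1 ^+ 2 * `|D| ^+ 2) = L^-1 * `|D| ^+ 2 / 2.
  by field; rewrite gt_eqF.
move: h2; rewrite h3 e3.
have : L^-1 * `|D| ^+ 2 <= 2 * (F y - F x - ip (G x) (y - x)) ->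
  `|D| ^+ 2 <= 2 * L * (F y - F x - ip (G x) (y - x)).
  by rewrite ler_pdivrMl// mulrCA mulrA.
move=> h4 h2; apply: h4; lra.
Qed.

Lemma bregman_grad_lipschitz (L : R) F G : 0 < L -> bregman_bounds L F G ->
  forall x y, `|G y - G x| <= L * `|y - x|.
Proof.
move=> L0 bF x y; rewrite -(@ler_pXn2r _ 2) ?nnegrE ?mulr_ge0 ?(ltW L0)//.
apply: le_trans (bregman_grad_le L0 bF x y) _.
have /andP[_ h] := bF x y; rewrite exprMn.
have -> : L ^+ 2 * `|y - x| ^+ 2 = 2 * L * (L / 2 * `|y - x| ^+ 2) by field.
by rewrite ler_pM2l// mulr_gt0.
Qed.

End gradient.

(** * Measurability of maps into a separable Hilbert space *)

Section hilbert_measurability.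
Context {R : realType} {H : completeNormedModType R}.

Lemma separable_dense_seq : separable H ->
  exists q : nat -> H, forall x e, 0 < e -> exists n, `|x - q n| < e.
Proof.
move=> [S cS dS].
have near_S x e : 0 < e -> exists2 s, S s & `|x - s| < e.
  move=> e0; have [||s [bs Ss]] := dS (ball x e).
  - by exists x; exact: ballxx.
  - exact: ball_open.
  by exists s => //; move: bs; rewrite -ball_normE.
have [s0 Ss0 _] := near_S 0 1 ltr01.
have /pfcard_geP[S0|[q]] := cS; first by rewrite S0 in Ss0.
exists q => x e e0; have [s Ss xs] := near_S x e e0.
by have [n _ qn] := 'surj_q Ss; exists n; rewrite qn.
Qed.

(** Substitute for Borel measurability: in a separable space, balls generate the open sets through
    countable unions. *)
Definition norm_measurable d (T : measurableType d) (X : T -> H) : Prop :=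
  forall y, measurable_fun setT (fun t => `|X t - y|).

Variables (q : nat -> H).
Hypothesis q_dense : forall x e, 0 < e -> exists n, `|x - q n| < e.

Lemma measurable_fun_glue d (T : measurableType d) (N : T -> nat)
    (g : nat -> T -> R) :
  (forall n, measurable [set t | N t = n]) ->
  (forall n, measurable_fun setT (g n)) ->
  measurable_fun setT (fun t => g (N t) t).
Proof.
move=> mN mg _ B mB; rewrite setTI.
rewrite (_ : _ @^-1` B = \bigcup_n ([set t | N t = n] `&` g n @^-1` B)).
  apply: bigcupT_measurable => n; apply: measurableI => //.
  by rewrite -[X in measurable X]setTI; exact: mg.
apply/seteqP; split => t /=; first by move=> Bt; exists (N t).
by move=> [n _ [/= -> ]].
Qed.

(** X is approximated by countably valued maps: at level m, the first [q n] within 1/(m+1).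
    Composition with such a map is measurable by gluing, and continuity in the first argument allows
    the limit in m. *)
Lemma measurable_caratheodory d (T : measurableType d) (X : T -> H)
    (phi : H -> T -> R) :
  norm_measurable X -> (forall y, measurable_fun setT (phi y)) ->
  (forall t, continuous (phi ^~ t)) ->
  measurable_fun setT (fun t => phi (X t) t).
Proof.
move=> mX mphi cphi.
have P m t : exists n, `|X t - q n| < m.+1%:R^-1.
  by apply: q_dense; rewrite invr_gt0.
(* Taking the least index makes each level set a finite Boolean combination of measurable sets. *)
pose N m t := ex_minn (P m t).
have mN m n : measurable [set t | N m t = n].
  have mP k : measurable [set t | `|X t - q k| < m.+1%:R^-1].
    have := mX (q k) measurableT _ (measurable_itv `]-oo, m.+1%:R^-1[).
    by rewrite setTI; congr measurable; apply/seteqP; split => t /=; rewrite in_itv.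
  rewrite (_ : [set t | _] = [set t | `|X t - q n| < m.+1%:R^-1] `&`
    \bigcap_(k in `I_n) ~` [set t | `|X t - q k| < m.+1%:R^-1]).
    apply: measurableI => //; apply: bigcap_measurableType => k _.
    exact: measurableC.
  apply/seteqP; split => t /=; rewrite /N; case: ex_minnP => k kP kmin.
    move=> <-; split => // j /= jk; apply/negP; apply: contraL jk => /kmin.
    by rewrite -leqNgt.
  move=> [/kmin kn nP]; apply/eqP; rewrite eqn_leq kn leqNgt /=.
  by apply/negP => /nP; apply.
apply: (@measurable_fun_cvg _ _ _ _ (fun m t => phi (q (N m t)) t)).
  by move=> m; exact: (measurable_fun_glue (g := fun n => phi (q n))).

move=> t _; apply: (cvg_comp (fun m => q (N m t)) (phi ^~ t)); last exact: cphi.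
apply/cvgrPdist_lt => e e0.
have /cvgrPdist_lt/(_ _ e0) := @cvg_harmonic R; apply: filterS => m /=.
rewrite sub0r normrN gtr0_norm ?invr_gt0// => h; apply: lt_trans h.
by rewrite /N; case: ex_minnP.
Qed.

Lemma norm_measurable_comp d (T : measurableType d) (X : T -> H) (g : H -> R) :
  norm_measurable X -> continuous g -> measurable_fun setT (g \o X).
Proof.
by move=> mX cg; apply: (measurable_caratheodory (phi := fun y _ => g y)).
Qed.

Variable ip : {dot H for @idfun R}.
Hypothesis ip_norm : forall x : H, ip x x = `|x| ^+ 2.

(** A form of Pettis' theorem: |h|^2 is the supremum of 2 <h, q n> - |q n|^2 over the dense
    sequence, hence a countable supremum of measurable functions. *)
Lemma weak_norm_measurable d (T : measurableType d) (X : T -> H) :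
  (forall v, measurable_fun setT (fun t => ip (X t) v)) -> norm_measurable X.
Proof.
move=> mX y.
have gt_normsq h (a : R) :
    (a < `|h| ^+ 2) <-> exists n, a < 2 * ip h (q n) - `|q n| ^+ 2.
  have E z : 2 * ip h z - `|z| ^+ 2 = `|h| ^+ 2 - `|h - z| ^+ 2.
    by rewrite (normBsq ip_norm); ring.
  split=> [ah|[n]]; last by rewrite E; have := sqr_ge0 (`|h - q n|); lra.
  have d0 : 0 < `|h| ^+ 2 - a by lra.
  have s0 : 0 < Num.sqrt (`|h| ^+ 2 - a) by rewrite sqrtr_gt0.
  have [n hn] := q_dense h s0.
  exists n; rewrite E.
  have : `|h - q n| ^+ 2 < `|h| ^+ 2 - a.
    by rewrite -[ltRHS]sqr_sqrtr ?(ltW d0)// ltrXn2r// nnegrE ?sqrtr_ge0.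
  lra.
have msq : measurable_fun setT (fun t => `|X t - y| ^+ 2).
  move=> mT; apply: (measurability _ (RGenOInfty.measurableE R)) => //.
  move=> _ [_ [a ->] <-]; rewrite setTI.
  rewrite (_ : _ @^-1` _ = \bigcup_n
      [set t | a < 2 * (ip (X t) (q n) - ip y (q n)) - `|q n| ^+ 2]).
    apply: bigcupT_measurable => n.
    have mf : measurable_fun setT
        (fun t => 2 * (ip (X t) (q n) - ip y (q n)) - `|q n| ^+ 2).
      apply: measurable_funB => //; apply: measurable_funM => //.
      by apply: measurable_funB.
    have := mf measurableT _ (measurable_itv `]a, +oo[).
    rewrite setTI; congr measurable; apply/seteqP.
    by split => t /=; rewrite in_itv /= andbT.
  apply/seteqP; split => t /=; rewrite in_itv /= andbT.
    by move=> /gt_normsq[n]; rewrite ipDl ipNl => an; exists n.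
  by move=> [n _ /= an]; apply/gt_normsq; exists n; rewrite ipDl ipNl.
rewrite (_ : (fun t => _) = Num.sqrt \o (fun t => `|X t - y| ^+ 2)); last first.
  by apply/funext => t /=; rewrite sqrtr_sqr normr_id.
apply: measurableT_comp => //.
apply: continuous_measurable_fun; exact: sqrt_continuous.
Qed.

End hilbert_measurability.

(** * One step in the mean *)

Section real_integrals.
Context {R : realType} d (T : measurableType d) (P : probability T R).

Definition rintegrable (g : T -> R) : Prop := P.-integrable setT (EFin \o g).

Lemma rintegrable_cst r : rintegrable (fun=> r).
Proof. exact: finite_measure_integrable_cst. Qed.

Lemma rintegrableD g h : rintegrable g -> rintegrable h -> rintegrable (fun t => g t + h t).
Proof. by move=> ig ih; exact: (integrableD measurableT ig ih). Qed.

Lemma rintegrableB g h : rintegrable g -> rintegrable h -> rintegrable (fun t => g t - h t).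
Proof. by move=> ig ih; exact: (integrableB measurableT ig ih). Qed.

Lemma rintegrableZ r g : rintegrable g -> rintegrable (fun t => r * g t).
Proof. by move=> ig; exact: (integrableZl measurableT r ig). Qed.

Lemma le_rintegrable (g h : T -> R) : measurable_fun setT g -> (forall t, `|g t| <= h t) ->
  rintegrable h -> rintegrable g.
Proof.
move=> mg gh; apply: le_integrable => //; first exact/measurable_EFinP.
by move=> t _; rewrite /= lee_fin (le_trans (gh t))// ler_norm.
Qed.

Lemma Rintegral_const r : \int[P]_t r = r.
Proof. by rewrite Rintegral_cst//= [X in fine X](probability_setT P) mulr1. Qed.

Lemma EFin_Rintegral g : rintegrable g ->
  (\int[P]_t (g t)%:E)%E = (\int[P]_t g t)%:E.
Proof. by move=> ig; rewrite /Rintegral fineK//; exact: integrable_fin_num. Qed.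

Lemma ge0_rintegrable (g : T -> R) r : measurable_fun setT g -> (forall t, 0 <= g t) ->
  (\int[P]_t (g t)%:E <= r%:E)%E -> rintegrable g /\ \int[P]_t g t <= r.
Proof.
move=> mg g0 gr.
have ig : rintegrable g.
  apply/integrableP; split; first exact/measurable_EFinP.
  apply: le_lt_trans (ltry r); apply: le_trans gr.
  by rewrite le_eqVlt; apply/orP; left; apply/eqP; apply: eq_integral => t _ /=; rewrite ger0_norm.
by split => //; rewrite -lee_fin -EFin_Rintegral.
Qed.

Lemma ge0_integral_le_Rintegral (g h : T -> R) : measurable_fun setT g ->
  (forall t, 0 <= g t) -> (forall t, g t <= h t) -> rintegrable h ->
  (\int[P]_t (g t)%:E <= (\int[P]_t h t)%:E)%E.
Proof.
move=> mg g0 gh ih; rewrite -EFin_Rintegral//; apply: ge0_le_integral => //.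
- by move=> t _; rewrite lee_fin.
- exact/measurable_EFinP.
- exact: measurable_int ih.
- by move=> t _; rewrite lee_fin.
Qed.

End real_integrals.

Lemma sqrD_le (R : realDomainType) (a b : R) : (a + b) ^+ 2 <= 2 * a ^+ 2 + 2 * b ^+ 2.
Proof. by have := sqr_ge0 (a - b); lra. Qed.

(** * Inequalities for one step with a fixed sample *)

Section bregman_consequences.
Context {R : realType} {H : completeNormedModType R}.
Variable ip : {dot H for @idfun R}.
Hypothesis ip_norm : forall x : H, ip x x = `|x| ^+ 2.
Variable L : R.
Hypothesis L_gt0 : 0 < L.

(** The error is quadratic in the step, so it vanishes after division by the step. The slope [e] is
    left free: it serves for the averaged function before its gradient is known. *)
Lemma squeeze_quotient (phi : H -> R) (x v : H) (e : R) :
  (forall n : nat, 0 <= phi (x + n.+1%:R^-1 *: v) - phi x - n.+1%:R^-1 * e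
    <= L / 2 * `|n.+1%:R^-1 *: v| ^+ 2) ->
  n.+1%:R * (phi (x + n.+1%:R^-1 *: v) - phi x) @[n --> \oo] --> e.
Proof.
move=> hphi.
have bnd (n : nat) : e <= n.+1%:R * (phi (x + n.+1%:R^-1 *: v) - phi x) <=
    e + L / 2 * `|v| ^+ 2 * n.+1%:R^-1.
  have := hphi n; rewrite normrZ ger0_norm ?invr_ge0// exprMn.
  have n0 : (0 : R) < n.+1%:R by [].
  move: (phi _ - phi x) => a /andP[h1 h2].
  have -> : e = n.+1%:R * (n.+1%:R^-1 * e) by rewrite mulrA divff ?mul1r// gt_eqF.
  have -> : L / 2 * `|v| ^+ 2 * n.+1%:R^-1 =
      n.+1%:R * (L / 2 * (n.+1%:R^-1 ^+ 2 * `|v| ^+ 2)).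
    by field; rewrite gt_eqF.
  rewrite -mulrDr !ler_pM2l//; move: (n.+1%:R^-1) h1 h2 => k h1 h2.
  by apply/andP; split; lra.
apply: (squeeze_cvgr (f := fun=> e)
  (h := fun n : nat => e + L / 2 * `|v| ^+ 2 * n.+1%:R^-1)).
- exact: nearW.
- exact: cvg_cst.
- rewrite -[X in _ --> X]addr0; apply: cvgD; first exact: cvg_cst.
  by rewrite -(mulr0 (L / 2 * `|v| ^+ 2)); apply: cvgMl_tmp; exact: cvg_harmonic.
Qed.

Lemma bregman_cvg_quotient (phi : H -> R) (G : H -> H) x v :
  bregman_bounds ip L phi G ->
  n.+1%:R * (phi (x + n.+1%:R^-1 *: v) - phi x) @[n --> \oo] --> ip (G x) v.
Proof.
move=> hphi; apply: squeeze_quotient => n.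
have := hphi x (x + n.+1%:R^-1 *: v).
have -> : x + n.+1%:R^-1 *: v - x = n.+1%:R^-1 *: v by rewrite addrAC subrr add0r.
by rewrite ipZr.
Qed.

Variables (gamma lbar : R).
Hypothesis gamma_gt0 : 0 < gamma.
Hypothesis gamma_lt : gamma < 2 / L.
Hypothesis lbar_gt0 : 0 < lbar.
Hypothesis lbar_lt1 : lbar < 1.

(** The coefficient of lam (f x - f z) gained by one step; the minimum separates gamma L <= 1 from 1
    < gamma L < 2, and is positive for gamma < 2/L. *)
Definition decrease : R := 2 * gamma * Num.min 1 (2 - gamma * L).

Lemma decrease_gt0 : 0 < decrease.
Proof.
rewrite /decrease !mulr_gt0// lt_min ltr01 subr_gt0.
by rewrite -ltr_pdivlMr.
Qed.

Definition noise : R := gamma ^+ 2 / (1 - lbar).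

Lemma noise_ge0 : 0 <= noise.
Proof. by rewrite divr_ge0 ?sqr_ge0// subr_ge0 ltW. Qed.

(** Scalar core of the distance estimate, with a = |G x - G z|, s = |G z|, e = |G x|, and B, B' the
    Bregman distances between x and z in the two orders; B + B' is <G x - G z, x - z>. *)
Lemma noisy_step_real (a s e B B' lam : R) : 0 <= a -> 0 <= s -> 0 <= e ->
  0 <= lam <= lbar -> e <= a + s -> a ^+ 2 <= 2 * L * B -> a ^+ 2 <= 2 * L * B' ->
  (gamma * lam) ^+ 2 * e ^+ 2 <=
    2 * gamma * lam * (B + B') - decrease * lam * B + noise * lam ^+ 2 * s ^+ 2.
Proof.
move=> a0 s0 e0 /andP[lam0 lamb] tri hB hB'.
have lb1 : 0 < 1 - lbar by rewrite subr_gt0.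
(* Young's inequality with weights summing to 1; its defect is the explicit square below. *)
have esq : e ^+ 2 <= a ^+ 2 / lbar + s ^+ 2 / (1 - lbar).
  apply: (@le_trans _ _ ((a + s) ^+ 2)); first by rewrite lerXn2r// nnegrE// addr_ge0.
  have -> : a ^+ 2 / lbar + s ^+ 2 / (1 - lbar) =
      (a + s) ^+ 2 + ((1 - lbar) * a - lbar * s) ^+ 2 / (lbar * (1 - lbar)).
    by field; rewrite !gt_eqF.
  by rewrite lerDl divr_ge0 ?sqr_ge0// ltW// mulr_gt0.
(* The weight lbar is chosen for this: the gradient difference costs only a term linear in lam. *)
have lamsq : lam ^+ 2 / lbar <= lam by rewrite ler_pdivrMr// expr2 ler_wpM2l.
(* With w = a^2/L, w is at most both 2B and 2B'. If gamma L <= 1, 2B' alone pays for gamma L w;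
   otherwise 2B' pays for w and 2B for the excess (gamma L - 1) w. *)
have key : gamma * a ^+ 2 <= 2 * B + 2 * B' - 2 * Num.min 1 (2 - gamma * L) * B.
  have aB' : a ^+ 2 / L <= 2 * B' by rewrite ler_pdivrMr//; lra.
  have gE : gamma * a ^+ 2 = (gamma * L) * (a ^+ 2 / L).
    by field; rewrite gt_eqF.
  have aB : a ^+ 2 / L <= 2 * B by rewrite ler_pdivrMr//; lra.
  have aL0 : 0 <= a ^+ 2 / L by rewrite divr_ge0 ?sqr_ge0// ltW.
  rewrite gE; move: (a ^+ 2 / L) aB aB' aL0 => w aB aB' aL0.
  rewrite minEle; case: ifPn => [h|]; last rewrite -ltNge => h.
    have : (gamma * L) * w <= 1 * w by rewrite ler_wpM2r//; lra.
    lra.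
  have : (gamma * L - 1) * w <= (gamma * L - 1) * (2 * B) by rewrite ler_wpM2l//; lra.
  lra.
rewrite /noise /decrease.
have h1 : (gamma * lam) ^+ 2 * e ^+ 2 <=
    (gamma * lam) ^+ 2 * (a ^+ 2 / lbar + s ^+ 2 / (1 - lbar)).
  by rewrite ler_wpM2l ?sqr_ge0.
have h2 : gamma ^+ 2 * a ^+ 2 * (lam ^+ 2 / lbar) <= gamma ^+ 2 * a ^+ 2 * lam.
  by apply: ler_wpM2l => //; rewrite mulr_ge0 ?sqr_ge0.
have h3 : gamma * lam * (gamma * a ^+ 2) <=
   gamma * lam * (2 * B + 2 * B' - 2 * Num.min 1 (2 - gamma * L) * B).
  by rewrite ler_wpM2l// mulr_ge0// ltW.
move: (Num.min _ _) h3 => m h3.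
have e1 : gamma ^+ 2 / (1 - lbar) * lam ^+ 2 * s ^+ 2 =
  (gamma * lam) ^+ 2 * (s ^+ 2 / (1 - lbar)) by ring.
have e2 : gamma ^+ 2 * a ^+ 2 * (lam ^+ 2 / lbar) =
  (gamma * lam) ^+ 2 * (a ^+ 2 / lbar) by ring.
by rewrite e1; rewrite e2 in h2; rewrite mulrDr in h1; lra.
Qed.

(** The term in <G z, x - z> has no sign for a single sample; it is kept because its mean vanishes
    when z minimizes the average. *)
Lemma bregman_step_sqdist (phi : H -> R) (G : H -> H) x z lam :
  bregman_bounds ip L phi G -> 0 <= lam <= lbar ->
  `|x - (gamma * lam) *: G x - z| ^+ 2 <= `|x - z| ^+ 2
    - decrease * lam * (phi x - phi z - ip (G z) (x - z))
    - 2 * gamma * lam * ip (G z) (x - z) + noise * lam ^+ 2 * `|G z| ^+ 2.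
Proof.
move=> hphi lamb.
have -> : x - (gamma * lam) *: G x - z = (x - z) - (gamma * lam) *: G x by rewrite addrAC.
rewrite (normBsq ip_norm) ipZr normrZ exprMn (ipC ip (x - z)) real_normK ?num_real//.
have hB := bregman_grad_le ip_norm L_gt0 hphi z x.
have hB' := bregman_grad_le ip_norm L_gt0 hphi x z.
have zx : z - x = - (x - z) by rewrite opprB.
rewrite (distrC (G z)) zx ipNr opprK in hB'.
have tri : `|G x| <= `|G x - G z| + `|G z|.
  by rewrite -{1}(subrK (G z) (G x)) ler_normD.
have := noisy_step_real (normr_ge0 _) (normr_ge0 _) (normr_ge0 _) lamb tri hB hB'.
lra.
Qed.

(** Smoothness of f along the step, with |G x|^2 <= 2 |G x - G z|^2 + 2 |G z|^2 and cocoercivity for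
    the difference. The inner product with g x averages to |g x|^2. *)
Lemma bregman_step_value (f phi : H -> R) (g G : H -> H) x z lam :
  bregman_bounds ip L f g -> bregman_bounds ip L phi G -> 0 <= lam ->
  f (x - (gamma * lam) *: G x) - f z <= f x - f z - gamma * lam * ip (G x) (g x)
    + L * gamma ^+ 2 * lam ^+ 2 * (2 * L) * (phi x - phi z - ip (G z) (x - z))
    + L * gamma ^+ 2 * lam ^+ 2 * `|G z| ^+ 2.
Proof.
move=> hf hphi lam0.
have k0 : 0 <= L * gamma ^+ 2 * lam ^+ 2 by rewrite !mulr_ge0 ?sqr_ge0// ltW.
have /andP[_] := hf x (x - (gamma * lam) *: G x).
rewrite (_ : x - _ - x = - ((gamma * lam) *: G x)); last by rewrite addrAC subrr add0r.
rewrite ipNr ipZr (ipC ip (g x)) normrN normrZ exprMn real_normK ?num_real//.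
have hB := bregman_grad_le ip_norm L_gt0 hphi z x.
have tri : `|G x| <= `|G x - G z| + `|G z|.
  by rewrite -{1}(subrK (G z) (G x)) ler_normD.
have {}tri : `|G x| ^+ 2 <= (`|G x - G z| + `|G z|) ^+ 2.
  by rewrite lerXn2r// nnegrE// addr_ge0.
move: (phi x - _ - _) hB => B hB.
have h : `|G x| ^+ 2 <= 2 * (2 * L * B) + 2 * `|G z| ^+ 2.
  by apply: (le_trans tri); apply: (le_trans (sqrD_le _ _)); rewrite lerD2r ler_pM2l.
have := ler_wpM2l k0 h; lra.
Qed.

Lemma bregman_continuous (phi : H -> R) (G : H -> H) :
  bregman_bounds ip L phi G -> continuous phi.
Proof.
move=> hphi x; apply/cvgrPdist_le => e e0.
pose c := `|G x| + L + 1.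
have c0 : 0 < c by rewrite /c ltr_wpDl// addr_ge0// ltW.
near=> y.
have yx1 : `|y - x| <= 1.
  by rewrite distrC; near: y; apply: cvgr_dist_le => //; exact: cvg_id.
have yxe : `|y - x| <= e / c.
  by rewrite distrC; near: y; apply: cvgr_dist_le; [exact: cvg_id|rewrite divr_gt0].
have /andP[h1 h2] := hphi x y.
have := norm_ip_le ip_norm (G x) (y - x); rewrite ler_norml => /andP[h3 h4].
have aux (a w eps i b : R) : 0 <= w -> w <= 1 -> (a + L + 1) * w <= eps ->
    - (a * w) <= i -> i <= a * w -> 0 <= b - i -> b - i <= L / 2 * w ^+ 2 ->
    - eps <= b <= eps.
  move=> w0 w1 hc k1 k2 k3 k4; have L0 := L_gt0.
  have w2 : L * w ^+ 2 <= L * w by rewrite ler_wpM2l ?(ltW L0)// expr2 ler_piMr.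
  have Lw : 0 <= L * w by rewrite mulr_ge0// ltW.
  by apply/andP; split; lra.
rewrite distrC ler_norml; apply: (aux _ _ _ _ _ (normr_ge0 (y - x)) yx1 _ h3 h4 h1 h2).
by rewrite mulrC -ler_pdivlMr.
Unshelve. all: by end_near. Qed.

End bregman_consequences.

(** * Averaging one step over the sample *)

Section one_step.
Context {R : realType} {H : completeNormedModType R}.
Variable ip : {dot H for @idfun R}.
Hypothesis ip_norm : forall x : H, ip x x = `|x| ^+ 2.
Variable q : nat -> H.
Hypothesis q_dense : forall x e, 0 < e -> exists n, `|x - q n| < e.
Context d {Xi : measurableType d} (D : probability Xi R).
Variables (F : Xi -> H -> R) (G : Xi -> H -> H) (f : H -> R) (g : H -> H).
Variables (L gamma : R).
Hypothesis L_gt0 : 0 < L.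
Hypothesis F_bregman : forall xi, bregman_bounds ip L (F xi) (G xi).
Hypothesis F_measurable : forall x, measurable_fun [set: Xi] (fun xi => F xi x).
Hypothesis F_integrable : forall x, rintegrable D (fun xi => F xi x).
Hypothesis f_def : forall x, f x = \int[D]_xi F xi x.
Hypothesis f_quotient : forall x v,
  n.+1%:R * (f (x + n.+1%:R^-1 *: v) - f x) @[n --> \oo] --> ip (g x) v.

Lemma measurable_grad_ip x v : measurable_fun setT (fun xi => ip (G xi x) v).
Proof.
apply: (@measurable_fun_cvg _ _ _ _
  (fun n xi => n.+1%:R * (F xi (x + n.+1%:R^-1 *: v) - F xi x))).
  by move=> n; apply: measurable_funM => //; exact: measurable_funB.
by move=> xi _; apply: bregman_cvg_quotient; exact: F_bregman.
Qed.

Lemma norm_measurable_grad x : norm_measurable (fun xi => G xi x).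
Proof.
apply: (weak_norm_measurable q_dense ip_norm) => v; exact: measurable_grad_ip.
Qed.

(** The Bregman bounds at x and x + v place this inner product within L/2 |v|^2 of the integrable
    difference F (x + v) - F x. *)
Lemma integrable_grad_ip x v : rintegrable D (fun xi => ip (G xi x) v).
Proof.
apply: (@le_rintegrable _ _ _ D _
  (fun xi => `|F xi (x + v) - F xi x| + L / 2 * `|v| ^+ 2)).
- exact: measurable_grad_ip.
- move=> xi; have := F_bregman xi x (x + v);
  have -> : x + v - x = v by rewrite addrAC subrr add0r.
  move=> /andP[h1 h2]; have L2 : 0 <= L / 2 * `|v| ^+ 2.
    by rewrite mulr_ge0// divr_ge0// ltW.
  rewrite ler_norml; have := ler_norm (F xi (x + v) - F xi x).
  have := ler_norm (- (F xi (x + v) - F xi x)); rewrite normrN.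
  by move: h1 h2 L2 => /=; lra.
- apply: rintegrableD; last exact: rintegrable_cst.
  by apply: (integrable_norm (f := fun xi => F xi (x + v) - F xi x)); exact: rintegrableB.
Qed.

(** The mean of the inner product stands for the gradient term until [avg_grad] identifies it with
    g. *)
Lemma avg_bregman x y :
  0 <= f y - f x - \int[D]_xi ip (G xi x) (y - x) <= L / 2 * `|y - x| ^+ 2.
Proof.
have iF := rintegrableB (F_integrable y) (F_integrable x).
have iG := integrable_grad_ip x (y - x).
have E : f y - f x - \int[D]_xi ip (G xi x) (y - x) =
    \int[D]_xi (F xi y - F xi x - ip (G xi x) (y - x)).
  rewrite (RintegralB measurableT iF iG).
  by rewrite (RintegralB measurableT (F_integrable y) (F_integrable x)) -!f_def.
rewrite E; apply/andP; split.
  by apply: Rintegral_ge0 => xi _; have /andP[] := F_bregman xi x y.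
rewrite -(Rintegral_const D (L / 2 * `|y - x| ^+ 2)); apply: le_Rintegral => //.
- exact: rintegrableB.
- exact: rintegrable_cst.
- by move=> xi _; have /andP[] := F_bregman xi x y.
Qed.

(** Both sides are limits of the same difference quotients of f: the left one by the averaged
    Bregman bounds, the right one by [f_quotient]. *)
Lemma avg_grad x v : \int[D]_xi ip (G xi x) v = ip (g x) v.
Proof.
have lim : n.+1%:R * (f (x + n.+1%:R^-1 *: v) - f x) @[n --> \oo]
    --> \int[D]_xi ip (G xi x) v.
  apply: (@squeeze_quotient _ _ L) => n.
  have := avg_bregman x (x + n.+1%:R^-1 *: v).
  have -> : x + n.+1%:R^-1 *: v - x = n.+1%:R^-1 *: v by rewrite addrAC subrr add0r.
  under eq_Rintegral do rewrite ipZr.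
  by rewrite (RintegralZl _ measurableT (integrable_grad_ip x v)).
by rewrite -(cvg_lim (@norm_hausdorff _ _) lim) (cvg_lim (@norm_hausdorff _ _) (@f_quotient x v)).
Qed.

Lemma f_bregman : bregman_bounds ip L f g.
Proof. by move=> x y; rewrite -avg_grad; exact: avg_bregman. Qed.

(** A gradient step of length 1/L from x cannot go below f z. This argument does not presuppose g z
    = 0, which is its special case x = z. *)
Lemma grad_le_gap x z : minimizer f z ->
  `|g x| ^+ 2 <= 2 * L * (f x - f z).
Proof.
move=> zmin; have /andP[_] := f_bregman x (x - L^-1 *: g x).
have := zmin (x - L^-1 *: g x).
move: (f (_ - _)) => a za.
rewrite (_ : x - _ - x = - (L^-1 *: g x)); last by rewrite addrAC subrr add0r.
rewrite normrN normrZ exprMn ipNr ipZr ip_norm.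
rewrite ger0_norm ?invr_ge0 ?(ltW L_gt0)//.
have -> : L / 2 * (L^-1 ^+ 2 * `|g x| ^+ 2) = L^-1 * `|g x| ^+ 2 / 2.
  by field; rewrite gt_eqF.
move=> h.
have -> : 2 * L * (f x - f z) = L * (2 * (f x - f z)) by ring.
by rewrite -ler_pdivrMl//; lra.
Qed.

Lemma avg_grad_minimizer z v : minimizer f z -> \int[D]_xi ip (G xi z) v = 0.
Proof.
move=> zmin; rewrite avg_grad.
have := grad_le_gap z zmin; rewrite subrr mulr0 => h.
have /eqP : `|g z| ^+ 2 = 0 by apply/eqP; rewrite eq_le h sqr_ge0.
by rewrite sqrf_eq0 normr_eq0 => /eqP ->; rewrite ip0l.
Qed.

Lemma gap_le_dist x z : minimizer f z -> f x - f z <= L / 2 * `|x - z| ^+ 2.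
Proof. by move=> zmin; have /andP[_] := avg_bregman z x; rewrite avg_grad_minimizer// subr0. Qed.

Definition grad_moment_le (z : H) (S : R) : Prop :=
  (\int[D]_xi (`|G xi z| ^+ 2)%:E <= S%:E)%E.

Lemma measurable_grad_sq z : measurable_fun setT (fun xi => `|G xi z| ^+ 2).
Proof.
apply: measurable_funX; have := norm_measurable_grad z 0.
by under eq_fun do rewrite subr0.
Qed.

(** The second moment is assumed finite at one minimizer only, whereas Opial's lemma needs the
    distances to all minimizers; Lipschitz gradients transfer the bound. *)
Lemma grad_moment_shift z z' S : grad_moment_le z S ->
  grad_moment_le z' (2 * S + 2 * (L ^+ 2 * `|z' - z| ^+ 2)).
Proof.
move=> zS; have [iz Sz] := ge0_rintegrable (measurable_grad_sq z) (fun=> sqr_ge0 _) zS.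
apply: (@le_trans _ _ (\int[D]_xi (2 * `|G xi z| ^+ 2 + 2 * (L ^+ 2 * `|z' - z| ^+ 2)))%:E).
  apply: ge0_integral_le_Rintegral => //.
  - exact: measurable_grad_sq.
  - move=> xi; have h := bregman_grad_lipschitz ip_norm L_gt0 (F_bregman xi) z z'.
    have {}h : `|G xi z' - G xi z| ^+ 2 <= L ^+ 2 * `|z' - z| ^+ 2.
      by rewrite -exprMn lerXn2r// nnegrE// mulr_ge0// ltW.
    have t : `|G xi z'| <= `|G xi z| + `|G xi z' - G xi z|.
      by rewrite -{1}(subrK (G xi z) (G xi z')) addrC ler_normD.
    have {}t : `|G xi z'| ^+ 2 <= (`|G xi z| + `|G xi z' - G xi z|) ^+ 2.
      by rewrite lerXn2r// nnegrE// addr_ge0.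
    by apply: (le_trans t); apply: (le_trans (sqrD_le _ _)); rewrite lerD2l ler_pM2l.
  - by apply: rintegrableD; [exact: rintegrableZ|exact: rintegrable_cst].
rewrite lee_fin (RintegralD measurableT (rintegrableZ 2 iz) (rintegrable_cst D _)).
by rewrite (RintegralZl _ measurableT iz) Rintegral_const lerD2r ler_pM2l.
Qed.

Definition step (lam : R) (x : H) (xi : Xi) : H := x - (gamma * lam) *: G xi x.

Lemma norm_measurable_step lam x : norm_measurable (step lam x).
Proof.
apply: (weak_norm_measurable q_dense ip_norm) => v.
under eq_fun do rewrite /step ipDl ipNl ipZl.
apply: measurable_funB => //; apply: measurable_funM => //.
exact: measurable_grad_ip.
Qed.

Lemma continuous_sqdist (z : H) : continuous (fun x : H => `|x - z| ^+ 2).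
Proof.
move=> x; under eq_fun do rewrite expr2.
suff : `|y - z| @[y --> x] --> `|x - z| by move=> h; exact: cvgM.
by apply: cvg_norm; apply: cvgB; [exact: cvg_id|exact: cvg_cst].
Qed.

Lemma measurable_step_comp (h : H -> R) lam x : continuous h ->
  measurable_fun setT (fun xi => h (step lam x xi)).
Proof. by move=> cg; exact: (norm_measurable_comp q_dense (norm_measurable_step lam x)). Qed.

Hypothesis gamma_gt0 : 0 < gamma.
Hypothesis gamma_lt : gamma < 2 / L.
Variable lbar : R.
Hypothesis lbar_gt0 : 0 < lbar.
Hypothesis lbar_lt1 : lbar < 1.

Lemma step_sqdist_mean x z lam S : minimizer f z -> grad_moment_le z S ->
  0 <= lam <= lbar ->
  (\int[D]_xi (`|step lam x xi - z| ^+ 2)%:E <=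
   (`|x - z| ^+ 2 - decrease L gamma * lam * (f x - f z) + noise gamma lbar * lam ^+ 2 * S)%:E)%E.
Proof.
move=> zmin zS lamb.
have [iz Sz] := ge0_rintegrable (measurable_grad_sq z) (fun=> sqr_ge0 _) zS.
have iJ := integrable_grad_ip z (x - z).
have iF := rintegrableB (F_integrable x) (F_integrable z).
have iB := rintegrableB iF iJ.
have i1 := rintegrableB (rintegrable_cst D (`|x - z| ^+ 2))
  (rintegrableZ (decrease L gamma * lam) iB).
have i2 := rintegrableB i1 (rintegrableZ (2 * gamma * lam) iJ).
have i3 := rintegrableZ (noise gamma lbar * lam ^+ 2) iz.
apply: (le_trans (ge0_integral_le_Rintegral _ _
  (fun xi => bregman_step_sqdist ip_norm L_gt0 gamma_gt0 lbar_gt0 lbar_lt1 x z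
    (F_bregman xi) lamb) _)).
- exact: (measurable_step_comp lam x (@continuous_sqdist z)).
- by move=> xi; exact: sqr_ge0.
- exact: rintegrableD.
rewrite lee_fin (RintegralD measurableT i2 i3).
rewrite (RintegralB measurableT i1 (rintegrableZ _ iJ)).
rewrite (RintegralB measurableT (rintegrable_cst D _) (rintegrableZ _ iB)).
rewrite (RintegralZl _ measurableT iB) (RintegralZl _ measurableT iJ).
rewrite (RintegralZl _ measurableT iz) (RintegralB measurableT iF iJ).
rewrite (RintegralB measurableT (F_integrable x) (F_integrable z)).
rewrite avg_grad_minimizer// -!f_def Rintegral_const mulr0 !subr0 lerD2l ler_wpM2l//.
by rewrite mulr_ge0 ?sqr_ge0// noise_ge0.
Qed.

Lemma step_value_mean x z lam S : minimizer f z -> grad_moment_le z S ->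
  0 <= lam ->
  (\int[D]_xi (f (step lam x xi) - f z)%:E <=
   (f x - f z + lam ^+ 2 * (L * gamma ^+ 2 * (2 * L * (f x - f z) + S)))%:E)%E.
Proof.
move=> zmin zS lam0.
have [iz Sz] := ge0_rintegrable (measurable_grad_sq z) (fun=> sqr_ge0 _) zS.
have iJ := integrable_grad_ip z (x - z).
have iF := rintegrableB (F_integrable x) (F_integrable z).
have iB := rintegrableB iF iJ.
have iI := integrable_grad_ip x (g x).
pose k := L * gamma ^+ 2 * lam ^+ 2.
have k0 : 0 <= k by rewrite !mulr_ge0 ?sqr_ge0// ltW.
have i1 := rintegrableB (rintegrable_cst D (f x - f z)) (rintegrableZ (gamma * lam) iI).
have i2 := rintegrableD i1 (rintegrableZ (k * (2 * L)) iB).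
have i3 := rintegrableZ k iz.
have bnd xi := bregman_step_value ip_norm L_gt0 gamma_gt0 x z f_bregman (F_bregman xi) lam0.
apply: (le_trans (ge0_integral_le_Rintegral _ _ bnd _)).
- apply: measurable_funB => //.
  exact: (measurable_step_comp lam x (bregman_continuous ip_norm L_gt0 f_bregman)).
- by move=> xi; rewrite subr_ge0.
- exact: rintegrableD.
rewrite lee_fin (RintegralD measurableT i2 i3).
rewrite (RintegralD measurableT i1 (rintegrableZ _ iB)).
rewrite (RintegralB measurableT (rintegrable_cst D _) (rintegrableZ _ iI)).
rewrite (RintegralZl _ measurableT iB) (RintegralZl _ measurableT iI).
rewrite (RintegralZl _ measurableT iz) (RintegralB measurableT iF iJ).
rewrite (RintegralB measurableT (F_integrable x) (F_integrable z)).
rewrite (avg_grad_minimizer (x - z) zmin) -!f_def Rintegral_const avg_grad ip_norm subr0.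
have h1 : 0 <= gamma * lam * `|g x| ^+ 2 by rewrite !mulr_ge0 ?sqr_ge0// ltW.
have h2 : k * \int[D]_xi `|G xi z| ^+ 2 <= k * S by rewrite ler_wpM2l.
rewrite /k in h2 *; lra.
Qed.

(** The growth lam^2 (f x - f z) in the value recursion is at most lam (f x - f z), which the
    decrease of M |x - z|^2 compensates. Only a summable lam^2 term remains. *)
Lemma step_potential_mean x z lam S M : minimizer f z -> grad_moment_le z S ->
  0 <= lam <= lbar -> 2 * L ^+ 2 * gamma ^+ 2 <= M * decrease L gamma -> 0 <= M ->
  (\int[D]_xi ((f (step lam x xi) - f z) + M * `|step lam x xi - z| ^+ 2)%:E <=
   ((f x - f z) + M * `|x - z| ^+ 2
    + (L * gamma ^+ 2 * S + M * noise gamma lbar * S) * lam ^+ 2)%:E)%E.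
Proof.
move=> zmin zS /andP[lam0 lamb] hM M0.
have mf : measurable_fun setT (fun xi => f (step lam x xi) - f z).
  apply: measurable_funB => //.
  exact: (measurable_step_comp lam x (bregman_continuous ip_norm L_gt0 f_bregman)).
have md := measurable_step_comp lam x (@continuous_sqdist z).
under eq_integral do rewrite EFinD EFinM.
rewrite ge0_integralD//=; last 4 first.
- by move=> xi _; rewrite lee_fin subr_ge0.
- exact/measurable_EFinP.
- by move=> xi _; rewrite -EFinM lee_fin mulr_ge0// sqr_ge0.
- by apply/measurable_EFinP; exact: measurable_funM.
rewrite ge0_integralZl//; last exact/measurable_EFinP.
apply: le_trans (leeD (step_value_mean x zmin zS lam0)
  (lee_wpmul2l _ (step_sqdist_mean x zmin zS (lam := lam) _))) _.
- by rewrite lee_fin.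
- by rewrite lam0 lamb.
rewrite -EFinM -EFinD lee_fin.
have gap : 0 <= f x - f z by rewrite subr_ge0.
have lam1 : lam <= 1 by apply: le_trans lamb _; exact: ltW.
have h1 : lam ^+ 2 * (2 * L ^+ 2 * gamma ^+ 2) <= lam * (M * decrease L gamma).
  apply: ler_pM => //; first exact: sqr_ge0.
    by apply: mulr_ge0; [apply: mulr_ge0|]; rewrite ?sqr_ge0.
  by rewrite expr2 ler_piMr.
have := ler_wpM2r gap h1.
lra.
Qed.

End one_step.

(** * Independence of the past and the next sample *)

Section independent_pair.
Context {R : realType} d0 (Omega : measurableType d0) (P : probability Omega R).
Context d1 (S : measurableType d1) d2 (Xi : measurableType d2) (D : probability Xi R).

(** Agreement on rectangles identifies the joint law with the product of the law of U and D; Tonelli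
    then integrates V out first. *)
Lemma independent_pair_integral (U : {RV P >-> S}) (V : {RV P >-> Xi}) :
  (forall A B, measurable A -> measurable B ->
    P (U @^-1` A `&` V @^-1` B) = (P (U @^-1` A) * D B)%E) ->
  forall phi : S * Xi -> \bar R, measurable_fun setT phi ->
  (forall z, 0 <= phi z)%E ->
  (\int[P]_w phi (U w, V w) = \int[P]_w \int[D]_y phi (U w, y))%E.
Proof.
move=> UV phi mphi phi0.
have mW : measurable_fun setT (fun w => (U w, V w)) by exact: measurable_fun_pair.
pose W : {RV P >-> (S * Xi)%type} := HB.pack (fun w => (U w, V w))
  (isMeasurableFun.Build _ _ _ _ _ mW).
have E X : measurable X -> (distribution P U \x D)%E X = distribution P W X.
  move=> mX; apply: (product_measure_unique (m1 := distribution P U) (m2 := D)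
    (m' := distribution P W)) => //.

transitivity (\int[distribution P W]_z phi z)%E.
  by rewrite ge0_integral_distribution.
transitivity (\int[distribution P U \x D]_z phi z)%E.
  by apply: eq_measure_integral => A mA _; exact: (esym (E A mA)).
rewrite (fubini_tonelli1 phi mphi phi0).
rewrite ge0_integral_distribution//.
- exact: measurable_fun_fubini_tonelli_F.
- by move=> x; exact: integral_ge0.
Qed.

End independent_pair.

Section past.
Context {R : realType} d0 (Omega : measurableType d0) (P : probability Omega R).
Context d2 (Xi : measurableType d2) (D : probability Xi R).
Variable xi : nat -> {RV P >-> Xi}.
Hypothesis xi_iid : iid D xi.

(* A pi-system generating the information available before step [k]. *)
Definition past (k : nat) : set (set Omega) :=
  [set E | exists2 A : nat -> set Xi, (forall i, measurable (A i)) &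
    E = \bigcap_(i in `I_k) xi i @^-1` A i].

Lemma measurable_preimage_xi i (A : set Xi) : measurable A -> measurable (xi i @^-1` A).
Proof. by move=> mA; rewrite -[X in measurable X]setTI; exact: measurable_funPT. Qed.

Lemma past_measurable k : past k `<=` measurable.
Proof.
move=> E [A mA ->]; apply: bigcap_measurableType => i _.
exact: measurable_preimage_xi.
Qed.

Lemma past_setT k : past k setT.
Proof.
exists (fun=> setT) => //; apply/esym.
by rewrite -subTset => w _ i _.
Qed.

Lemma past_setI k : setI_closed (past k).
Proof.
move=> _ _ [A mA ->] [B mB ->]; exists (fun i => A i `&` B i).
  by move=> i; exact: measurableI.
apply/seteqP; split => w.
  by move=> [h1 h2] i ik; split; [exact: h1|exact: h2].
by move=> h; split => i ik; have [] := h i ik.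
Qed.

Lemma past_le k l : (k <= l)%N -> past k `<=` past l.
Proof.
move=> kl E [A mA ->]; exists (fun i => if (i < k)%N then A i else setT).
  by move=> i; case: ifP.
apply/seteqP; split => w /= h i /= il.
  by case: ifPn => // ik; exact: h.
by have := h i (leq_trans il kl); rewrite il.
Qed.

Lemma sigma_past_measurable k : <<s past k >> `<=` measurable.
Proof. by apply: smallest_sub; [exact: sigma_algebra_measurable|exact: past_measurable]. Qed.

Lemma sigma_past_le k l : (k <= l)%N -> <<s past k >> `<=` <<s past l >>.
Proof. by move=> kl; apply: sub_smallest2r; [exact: smallest_sigma_algebra|exact: past_le]. Qed.

Local Notation T k := (g_sigma_algebraType (past k)).

Lemma measurable_fun_past d (Y : measurableType d) k (h : T k -> Y) :
  measurable_fun setT h -> measurable_fun [set: Omega] (h : Omega -> Y).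
Proof.
by move=> mh _ B mB; apply: sigma_past_measurable; exact: mh.
Qed.

Lemma measurable_fun_past_le d (Y : measurableType d) k l (h : Omega -> Y) :
  (k <= l)%N -> measurable_fun setT (h : T k -> Y) -> measurable_fun setT (h : T l -> Y).
Proof.
by move=> kl mh _ B mB; apply: (sigma_past_le kl); exact: mh.
Qed.

Lemma measurable_xi_past i k : (i < k)%N -> measurable_fun setT (xi i : T k -> Xi).
Proof.
move=> ik _ B mB; rewrite setTI; apply: sub_sigma_algebra.
exists (fun j => if j == i then B else setT); first by move=> j; case: ifP.
apply/seteqP; split => w /=.
  by move=> Bw j _ /=; case: ifPn => // /eqP ->.
by move=> /(_ i ik); rewrite eqxx.
Qed.

Lemma prob_past k (A : nat -> set Xi) : (forall i, measurable (A i)) ->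
  P (\bigcap_(i in `I_k) xi i @^-1` A i) = (\prod_(i < k) D (A i))%E.
Proof.
move=> mA; have [law indep] := xi_iid.
have <- : [set` [fset i in iota 0 k]%fset] = `I_k.
  by apply/seteqP; split => i /=; rewrite !inE mem_iota add0n.
rewrite indep//.
rewrite (perm_big (iota 0 k)); last first.
  by apply: uniq_perm => [||i]; rewrite ?fset_uniq ?iota_uniq// !inE.
rewrite (_ : iota 0 k = index_iota 0 k); last by rewrite /index_iota subn0.
rewrite big_mkord.
by apply: eq_bigr => i _; exact: law.
Qed.

(** For fixed B both sides are finite measures in E; they agree on the pi-system [past k], hence on
    the sigma-algebra it generates. *)
Lemma past_independent k E B : <<s past k >> E -> measurable B ->
  P (E `&` xi k @^-1` B) = (P E * D B)%E.
Proof.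
move=> pE mB.
have mV := measurable_preimage_xi k mB.
have DB0 : (0 <= fine (D B))%R by rewrite fine_ge0.
pose c := NngNum DB0.
have DBE : D B = (fine (D B))%:E by rewrite fineK// fin_num_measure.
have -> : P (E `&` xi k @^-1` B) = mrestr P mV E by [].
have -> : (P E * D B = mscale c P E)%E by rewrite /mscale /= muleC DBE.
apply: (@g_sigma_algebra_measure_unique _ _ _ (past k) _ (fun=> setT)) => //.
- exact: past_measurable.
- by move=> _; exact: past_setT.
- by rewrite -subTset => w _; exists 0%N.
- exact: past_setI.
- move=> _ [A mA ->].
  change (P (\bigcap_(i in `I_k) xi i @^-1` A i `&` xi k @^-1` B) =
    ((fine (D B))%:E * P (\bigcap_(i in `I_k) xi i @^-1` A i))%E).
  (* Inserting B at position k makes the intersection a cylinder of length k+1, to which the product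
     formula applies. *)
  pose A' i := if i == k then B else A i.
  have mA' i : measurable (A' i) by rewrite /A'; case: ifP.
  have -> : \bigcap_(i in `I_k) xi i @^-1` A i `&` xi k @^-1` B =
      \bigcap_(i in `I_k.+1) xi i @^-1` A' i.
    apply/seteqP; split => w /=.
      move=> [h Bw] i /= ik; rewrite /A'; case: ifPn => [/eqP ->//|ki].
      by apply: h => /=; rewrite ltn_neqAle ki.
    move=> h; split; last by have := h k (ltnSn k); rewrite /A' eqxx.
    move=> i /= ik; have := h i (ltnW ik); rewrite /A' ifN//.
    by rewrite ltn_eqF.
  rewrite prob_past// (prob_past _ mA) big_ord_recr /= /A' eqxx -DBE muleC.
  by congr (_ * _)%E; apply: eq_bigr => i _; rewrite ifN// ltn_eqF.
- move=> _; change (P (setT `&` xi k @^-1` B) < +oo)%E.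
  by rewrite setTI ltey_eq fin_num_measure.
Qed.

(** The past is encoded as the identity of [Omega], with the past sigma-algebra on the target; the
    inner integral over D is then the conditional expectation. *)
Lemma past_integral k (phi : T k * Xi -> \bar R) : measurable_fun setT phi ->
  (forall z, 0 <= phi z)%E ->
  (\int[P]_w phi (w, xi k w) = \int[P]_w \int[D]_y phi (w, y))%E.
Proof.
move=> mphi phi0.
have mU : measurable_fun [set: Omega] (id : Omega -> T k).
  by move=> _ B mB; rewrite setTI; exact: (sigma_past_measurable mB).
pose U : {RV P >-> T k} := HB.pack (id : Omega -> T k)
  (isMeasurableFun.Build _ _ _ _ _ mU).
apply: (independent_pair_integral (U := U) (V := xi k)) => // A B mA mB.
exact: past_independent.
Qed.

End past.

(** * Adaptedness and Markov property of the iterates *)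

Section iterates.
Context {R : realType} {H : completeNormedModType R}.
Variable q : nat -> H.
Hypothesis q_dense : forall x e, 0 < e -> exists n, `|x - q n| < e.
Context d0 (Omega : measurableType d0) (P : probability Omega R).
Context d2 (Xi : measurableType d2) (D : probability Xi R).
Variable xi : nat -> {RV P >-> Xi}.
Hypothesis xi_iid : iid D xi.
Variable s : nat -> H -> Xi -> H.
Hypothesis measurable_s : forall k x, norm_measurable (s k x).
Hypothesis continuous_s : forall k y, continuous (fun x => s k x y).
Variables (x0 : H) (X : nat -> Omega -> H).
Hypothesis X0 : forall w, X 0 w = x0.
Hypothesis XS : forall k w, X k.+1 w = s k (X k w) (xi k w).

Local Notation T k := (g_sigma_algebraType (past xi k)).

Lemma continuous_norm_sub (y : H) : continuous (fun x => `|x - y|).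
Proof.
by move=> x; apply: cvg_norm; apply: cvgB; [exact: cvg_id|exact: cvg_cst].
Qed.

Lemma norm_measurable_iterate k : norm_measurable (X k : T k -> H).
Proof.
elim: k => [|k IH] y.
  by rewrite (_ : (fun t => _) = fun=> `|x0 - y|)//; apply/funext => w; rewrite X0.
rewrite (_ : (fun t => _) = fun w => `|s k (X k w) (xi k w) - y|); last first.
  by apply/funext => w; rewrite XS.
apply: (measurable_caratheodory q_dense (X := X k : T k.+1 -> H)
  (phi := fun x w => `|s k x (xi k w) - y|)).
- by move=> z; apply: (measurable_fun_past_le (leqnSn k)); exact: IH.
- move=> x; apply: (measurableT_comp (f := fun e => `|s k x e - y|)).
    exact: measurable_s.
  exact: measurable_xi_past.
- move=> w x; apply: (@continuous_comp _ _ _ (fun x => s k x (xi k w)) (fun v => `|v - y|)).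
    exact: continuous_s.
  exact: continuous_norm_sub.
Qed.

Lemma measurable_iterate_comp k (y : H -> R) : continuous y ->
  measurable_fun setT (fun w : T k => y (X k w)).
Proof. move=> cy.
exact: (norm_measurable_comp q_dense (@norm_measurable_iterate k)).
 Qed.

Lemma measurable_s_comp k x (y : H -> R) : continuous y ->
  measurable_fun setT (fun e => y (s k x e)).
Proof. by move=> cy; exact: (norm_measurable_comp q_dense (@measurable_s k x)). Qed.

Lemma measurable_pair_step k (y : H -> R) : continuous y ->
  measurable_fun setT (fun z : T k * Xi => y (s k (X k z.1) z.2)).
Proof.
move=> cy.
apply: (measurable_caratheodory q_dense (X := fun z : T k * Xi => X k z.1)
  (phi := fun x z => y (s k x z.2))).
- move=> z; apply: (measurableT_comp (f := fun w : T k => `|X k w - z|)).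
    exact: norm_measurable_iterate.
  exact: measurable_fst.
- move=> x; apply: (measurableT_comp (f := fun e => y (s k x e))).
    exact: measurable_s_comp.
  exact: measurable_snd.
- move=> z x; apply: (@continuous_comp _ _ _ (fun x => s k x z.2) y).
    exact: continuous_s.
  exact: cy.
Qed.

(** Testing against nonnegative weights [h] known before step k takes the place of conditioning on
    the past. *)
Lemma markov_integral k (h : T k -> R) (y : H -> R) :
  measurable_fun setT h -> (forall w, 0 <= h w) -> continuous y ->
  (forall x, 0 <= y x) ->
  (\int[P]_w (h w * y (X k.+1 w))%:E =
   \int[P]_w ((h w)%:E * \int[D]_e (y (s k (X k w) e))%:E))%E.
Proof.
move=> mh h0 cy y0.
transitivity (\int[P]_w (h w * y (s k (X k w) (xi k w)))%:E)%E.
  by apply: eq_integral => w _; rewrite XS.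
rewrite (past_integral xi_iid (phi := fun z : T k * Xi =>
  (h z.1 * y (s k (X k z.1) z.2))%:E)); last 2 first.
- apply/measurable_EFinP; apply: measurable_funM; last exact: measurable_pair_step.
  by apply: (measurableT_comp mh); exact: measurable_fst.
- by move=> z; rewrite lee_fin mulr_ge0.
apply: eq_integral => w _ /=; under eq_integral do rewrite EFinM.
rewrite ge0_integralZl//; first by apply/measurable_EFinP; exact: measurable_s_comp.
  by move=> e _; rewrite lee_fin.
by rewrite lee_fin.
Qed.

Lemma measurable_mean_step k (y : H -> R) : continuous y -> (forall x, 0 <= y x) ->
  measurable_fun setT (fun w : T k => (\int[D]_e (y (s k (X k w) e))%:E)%E).
Proof.
move=> cy y0.
apply: (@measurable_fun_fubini_tonelli_F _ _ (T k) Xi R D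
  (fun z => (y (s k (X k z.1) z.2))%:E)).
- by apply/measurable_EFinP; exact: measurable_pair_step.
- by move=> z; rewrite lee_fin.
Qed.

Lemma measurable_past_fun k (h : T k -> R) : measurable_fun setT h ->
  measurable_fun [set: Omega] (h : Omega -> R).
Proof. exact: measurable_fun_past. Qed.

Lemma markov_le k (h : T k -> R) (y y' : H -> R) :
  measurable_fun setT h -> (forall w, 0 <= h w) -> continuous y ->
  (forall x, 0 <= y x) -> continuous y' ->
  (forall x, (\int[D]_e (y (s k x e))%:E <= (y' x)%:E)%E) ->
  (\int[P]_w (h w * y (X k.+1 w))%:E <= \int[P]_w (h w * y' (X k w))%:E)%E.
Proof.
move=> mh h0 cy y0 cy' yy'; rewrite markov_integral//.
apply: ge0_le_integral => //.
- move=> w _; apply: mule_ge0; first by rewrite lee_fin.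
  by apply: integral_ge0 => e _; rewrite lee_fin.
- apply: emeasurable_funM; first by apply/measurable_EFinP; exact: measurable_past_fun.
  apply: measurable_fun_past; exact: measurable_mean_step.
- apply/measurable_EFinP; apply: measurable_past_fun; apply: measurable_funM => //.
  exact: measurable_iterate_comp.
- move=> w _; rewrite EFinM; apply: lee_wpmul2l => //; first by rewrite lee_fin.
Qed.

Lemma markov_ge k (h : T k -> R) (y y' : H -> R) :
  measurable_fun setT h -> (forall w, 0 <= h w) -> continuous y ->
  (forall x, 0 <= y x) -> continuous y' -> (forall x, 0 <= y' x) ->
  (forall x, ((y' x)%:E <= \int[D]_e (y (s k x e))%:E)%E) ->
  (\int[P]_w (h w * y' (X k w))%:E <= \int[P]_w (h w * y (X k.+1 w))%:E)%E.
Proof.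
move=> mh h0 cy y0 cy' y'0 yy'; rewrite markov_integral//.
apply: ge0_le_integral => //.
- by move=> w _; rewrite lee_fin mulr_ge0.
- apply/measurable_EFinP; apply: measurable_past_fun; apply: measurable_funM => //.
  exact: measurable_iterate_comp.
- apply: emeasurable_funM; first by apply/measurable_EFinP; exact: measurable_past_fun.
  apply: measurable_fun_past; exact: measurable_mean_step.
- move=> w _; rewrite EFinM; apply: lee_wpmul2l => //; first by rewrite lee_fin.
Qed.

End iterates.

(** * Almost sure convergence of Lyapunov functions *)

Section bounded_submartingale.
Context {R : realType} d (Omega : measurableType d) (P : probability Omega R).
Variable Fil : nat -> set (set Omega).
Hypothesis Fil_measurable : forall k, <<s Fil k >> `<=` measurable.
Hypothesis Fil_le : forall k l, (k <= l)%N -> <<s Fil k >> `<=` <<s Fil l >>.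
Local Notation T k := (g_sigma_algebraType (Fil k)).
Variable W : nat -> Omega -> R.
Hypothesis W_adapted : forall k, measurable_fun setT (W k : T k -> R).
Hypothesis W01 : forall k w, 0 <= W k w <= 1.
Hypothesis W_sub : forall k (h : T k -> R), measurable_fun setT h ->
  (forall w, 0 <= h w <= 1) ->
  \int[P]_w (h w * W k w) <= \int[P]_w (h w * W k.+1 w).

Lemma bounded_rintegrable (h : Omega -> R) (M : R) : measurable_fun setT h ->
  (forall w, `|h w| <= M) -> rintegrable P h.
Proof.
by move=> mh hM; apply: (le_rintegrable mh hM); exact: rintegrable_cst.
Qed.

Let mFil d' (Y : measurableType d') k (h : T k -> Y) :
  measurable_fun setT h -> measurable_fun [set: Omega] (h : Omega -> Y).
Proof. by move=> mh _ B mB; apply: Fil_measurable; exact: mh. Qed.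

Let mFil_le d' (Y : measurableType d') k l (h : Omega -> Y) :
  (k <= l)%N -> measurable_fun setT (h : T k -> Y) -> measurable_fun setT (h : T l -> Y).
Proof. by move=> kl mh _ B mB; apply: (Fil_le kl); exact: mh. Qed.

Let W0 k w : 0 <= W k w. Proof. by have /andP[] := W01 k w. Qed.
Let W1 k w : W k w <= 1. Proof. by have /andP[] := W01 k w. Qed.

Section maximal_inequality.
Variables (m : nat) (eps : R).
Hypothesis eps_gt0 : 0 < eps.

(* [alive j w] says that the exit time of [(W n - W m)^2 >= eps] is after [m + j];
   [stopped j] is the process stopped at that exit time. *)
Fixpoint alive (j : nat) (w : Omega) : bool :=
  if j is j'.+1 then alive j' w && ((W (m + j'.+1) w - W m w) ^+ 2 < eps) else true.

Fixpoint stopped (j : nat) (w : Omega) : R :=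
  if j is j'.+1 then (if alive j' w then W (m + j'.+1) w else stopped j' w) else W m w.

Lemma stopped_alive j w : alive j w -> stopped j w = W (m + j) w.
Proof. by case: j => [|j] /=; [rewrite addn0|move=> /andP[->]]. Qed.

Lemma stopped_dead j w : ~~ alive j w -> eps <= (stopped j w - W m w) ^+ 2.
Proof.
elim: j => [//|j IH] /=; case: ifPn => [_ /=|/IH//].
by rewrite -leNgt.
Qed.

Lemma stopped01 j w : 0 <= stopped j w <= 1.
Proof. by elim: j => [|j IH] /=; [exact: W01|case: ifP]. Qed.

Lemma measurable_alive j : measurable_fun setT (alive j : T (m + j) -> bool).
Proof.
elim: j => [|j IH] /=; first exact: measurable_cst.
apply: measurable_and.
  by apply: (@mFil_le _ _ (m + j)) => //; rewrite leq_add2l.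
apply: measurable_fun_ltr => //; apply: measurable_funX; apply: measurable_funB.
  exact: W_adapted.
by apply: (@mFil_le _ _ m) => //; rewrite leq_addr.
Qed.

Lemma measurable_stopped j : measurable_fun setT (stopped j : T (m + j) -> R).
Proof.
elim: j => [|j IH] /=.
  by apply: (@mFil_le _ _ m) => //; rewrite leq_addr.
apply: measurable_fun_ifT.
- apply: (@mFil_le _ _ (m + j)); first by rewrite leq_add2l.
  exact: measurable_alive.
- exact: W_adapted.
- by apply: (@mFil_le _ _ (m + j)) => //; rewrite leq_add2l.
Qed.

Let mW k : measurable_fun setT (W k). Proof. by apply: (@mFil _ _ k); exact: W_adapted. Qed.
Let mS j : measurable_fun setT (stopped j).
Proof. by apply: (@mFil _ _ (m + j)); exact: measurable_stopped. Qed.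

Let le1 (x : R) : 0 <= x <= 1 -> `|x| <= 1.
Proof. by move=> /andP[x0 x1]; rewrite ger0_norm. Qed.

Let le1M (x y : R) : 0 <= x <= 1 -> 0 <= y <= 1 -> 0 <= x * y <= 1.
Proof. by move=> /andP[x0 x1] /andP[y0 y1]; rewrite mulr_ge0//= mulr_ile1. Qed.

Let iWX k l : rintegrable P (fun w => W k w * W l w).
Proof.
apply: (@bounded_rintegrable _ 1); first exact: measurable_funM.
by move=> w; apply: le1; apply: le1M.
Qed.

Let iWS j k : rintegrable P (fun w => W k w * stopped j w).
Proof.
apply: (@bounded_rintegrable _ 1); first exact: measurable_funM.
by move=> w; apply: le1; apply: le1M => //; exact: stopped01.
Qed.

Let iSS j : rintegrable P (fun w => stopped j w * stopped j w).
Proof.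
apply: (@bounded_rintegrable _ 1); first exact: measurable_funM.
by move=> w; apply: le1; apply: le1M => //; exact: stopped01.
Qed.

Let b2r (b : bool) : R := if b then 1 else 0.

Lemma W_sub_event k (b : T k -> bool) (h : T k -> R) : measurable_fun setT b ->
  measurable_fun setT h -> (forall w, 0 <= h w <= 1) ->
  0 <= \int[P]_w (b2r (b w) * (h w * W k.+1 w - h w * W k w)).
Proof.
move=> mb mh h01.
have mbh : measurable_fun setT (fun w : T k => b2r (b w) * h w).
  by apply: measurable_funM => //; apply: measurable_fun_ifT.
have bh01 w : 0 <= b2r (b w) * h w <= 1.
  by apply: le1M => //; rewrite /b2r; case: ifP; rewrite lexx ler01.
have i n : rintegrable P (fun w => b2r (b w) * h w * W n w).
  apply: (@bounded_rintegrable _ 1).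
    by apply: measurable_funM => //; exact: (@mFil _ _ k _ mbh).
  by move=> w; apply: le1; apply: le1M.
have := W_sub mbh bh01; rewrite -subr_ge0 -(RintegralB measurableT (i k.+1) (i k)).
by congr (_ <= _); apply: eq_Rintegral => w _; ring.
Qed.

(** The increment of the stopped process is that of W on the event still alive, which is known at
    time m + j, as is the weight W m; hence its mean is nonnegative. *)
Lemma stopped_cross j :
  \int[P]_w (W m w * W m w) <= \int[P]_w (W m w * stopped j w).
Proof.
elim: j => [//|j IH]; apply: (le_trans IH); rewrite -subr_ge0.
rewrite -(RintegralB measurableT (iWS j.+1 m) (iWS j m)).
have mWm : measurable_fun setT (W m : T (m + j) -> R).
  by apply: (@mFil_le _ _ m) => //; rewrite leq_addr.
have := W_sub_event (@measurable_alive j) mWm (W01 m).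
congr (_ <= _); apply: eq_Rintegral => w _ /=; rewrite /b2r addnS.
by case: ifPn => [/stopped_alive ->|_]; ring.
Qed.

(** With W' the next value, W'^2 - W^2 = 2 W (W' - W) + (W' - W)^2, and W >= 0 is an admissible
    weight in the submartingale property. *)
Lemma W_sq_mono k (b : T k -> bool) : measurable_fun setT b ->
  0 <= \int[P]_w (b2r (b w) * (W k.+1 w * W k.+1 w - W k w * W k w)).
Proof.
move=> mb; have := W_sub_event mb (@W_adapted k) (W01 k).
have bb w : 0 <= b2r (b w) <= 1 by rewrite /b2r; case: ifP; rewrite lexx ler01.
have mb2r : measurable_fun setT (fun w : Omega => b2r (b w)).
  by apply: (@mFil _ _ k); apply: measurable_fun_ifT.
have i1 n l : rintegrable P (fun w => b2r (b w) * (W n w * W n w - W l w * W k w)).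
  apply: (@bounded_rintegrable _ 2).
    apply: measurable_funM => //; apply: measurable_funB; exact: measurable_funM.
  move=> w; have /andP[b0 b1] := bb w.
  have := le1M (W01 n w) (W01 n w); have := le1M (W01 l w) (W01 k w).
  rewrite normrM (ger0_norm b0) => /andP[p0 p1] /andP[q0 q1].
  apply: (@le_trans _ _ (1 * 2)); last by rewrite mul1r.
  by apply: ler_pM => //; rewrite ler_norml; apply/andP; split; lra.
have i2 : rintegrable P (fun w => b2r (b w) * (W k w * W k.+1 w - W k w * W k w)).
  apply: (@bounded_rintegrable _ 2).
    apply: measurable_funM => //; apply: measurable_funB; exact: measurable_funM.
  move=> w; have /andP[b0 b1] := bb w.
  have := le1M (W01 k w) (W01 k.+1 w); have := le1M (W01 k w) (W01 k w).
  rewrite normrM (ger0_norm b0) => /andP[p0 p1] /andP[q0 q1].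
  apply: (@le_trans _ _ (1 * 2)); last by rewrite mul1r.
  by apply: ler_pM => //; rewrite ler_norml; apply/andP; split; lra.
move=> h; apply: (@le_trans _ _ (2 * \int[P]_w (b2r (b w) * (W k w * W k.+1 w - W k w * W k w)))).
  by rewrite mulr_ge0.
rewrite -(RintegralZl _ measurableT i2); apply: le_Rintegral => //.
- exact: rintegrableZ.
- exact: i1.
move=> w _; have /andP[b0 _] := bb w.
have := mulr_ge0 b0 (sqr_ge0 (W k.+1 w - W k w)); lra.
Qed.

(** After the exit the stopped square is frozen while the mean square of W on that event keeps
    growing. *)
Lemma stopped_sq j :
  \int[P]_w (stopped j w * stopped j w) <= \int[P]_w (W (m + j) w * W (m + j) w).
Proof.
elim: j => [|j IH]; first by rewrite addn0.
have mD : measurable_fun setT ((fun w => ~~ alive j w) : T (m + j) -> bool).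
  by apply: measurable_neg; exact: measurable_alive.
have := W_sq_mono mD; rewrite -subr_ge0 in IH.
rewrite -(RintegralB measurableT (iWX _ _) (iSS _)) in IH => h.
rewrite -subr_ge0 -(RintegralB measurableT (iWX _ _) (iSS _)).
have i2 : rintegrable P (fun w => b2r (~~ alive j w) *
    (W (m + j).+1 w * W (m + j).+1 w - W (m + j) w * W (m + j) w)).
  apply: (@bounded_rintegrable _ 1).
    apply: measurable_funM; first by apply: (@mFil _ _ (m + j)); apply: measurable_fun_ifT.
    apply: measurable_funB; exact: measurable_funM.
  move=> w; have := le1M (W01 (m + j) w) (W01 (m + j) w).
  have := le1M (W01 (m + j).+1 w) (W01 (m + j).+1 w) => /andP[p0 p1] /andP[q0 q1].
  rewrite /b2r; case: ifP => _; rewrite ?mul1r ?mul0r ?normr0//.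
  by rewrite ler_norml; apply/andP; split; lra.
apply: (le_trans (addr_ge0 IH h)).
rewrite -(RintegralD measurableT (rintegrableB (iWX _ _) (iSS _)) i2).
rewrite le_eqVlt; apply/orP; left; apply/eqP; apply: eq_Rintegral => w _ /=.
by rewrite addnS /b2r; have [/stopped_alive ->|_] /= := boolP (alive j w); ring.
Qed.

(** Chebyshev for the stopped process: after an exit (stopped j - W m)^2 >= eps, and expanding the
    square with the two preceding comparisons bounds its mean. The bound is an increment of the
    bounded monotone sequence of means of W_n^2, hence small for large m uniformly in j. *)
Lemma maximal_inequality j :
  (eps%:E * P [set w | ~~ alive j w] <=
   (\int[P]_w (W (m + j) w * W (m + j) w) - \int[P]_w (W m w * W m w))%:E)%E.
Proof.
have mD : measurable [set w | ~~ alive j w].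
  have mN := mFil (measurable_neg (@measurable_alive j)).
  by rewrite -[X in measurable X]setTI; exact: (mN measurableT [set true]).
have i1 : rintegrable P (fun w => W m w * W m w - 2 * (W m w * stopped j w)).
  by apply: rintegrableB => //; apply: rintegrableZ.
have i2 : rintegrable P (fun w => (stopped j w - W m w) ^+ 2).
  have := rintegrableD (iSS j) i1; congr rintegrable; apply/funext => w; ring.
apply: (@le_trans _ _ (\int[P]_w ((stopped j w - W m w) ^+ 2))%:E); last first.
  rewrite lee_fin.
  have -> : \int[P]_w ((stopped j w - W m w) ^+ 2) = \int[P]_w (stopped j w * stopped j w)
      + (\int[P]_w (W m w * W m w) - 2 * \int[P]_w (W m w * stopped j w)).
    rewrite -(RintegralZl _ measurableT (iWS j m)).
    rewrite -(RintegralB measurableT (iWX m m) (rintegrableZ 2 (iWS j m))).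
    rewrite -(RintegralD measurableT (iSS j) i1).
    by apply: eq_Rintegral => w _; ring.
  have := stopped_sq j; have := stopped_cross j; lra.
rewrite -EFin_Rintegral// -[X in P X]setIT -integral_indic// -ge0_integralZl//; last 2 first.
- by apply/measurable_EFinP; exact: measurable_indic.
- by rewrite lee_fin ltW.
apply: ge0_le_integral => //.
- by move=> w _; rewrite -EFinM lee_fin mulr_ge0// ltW.
- by apply/measurable_EFinP; apply: measurable_funM => //; exact: measurable_indic.
- exact: measurable_int i2.
- move=> w _; rewrite -EFinM lee_fin indicE; have [|] := boolP (w \in _).
    by rewrite inE /= mulr1; exact: stopped_dead.
  by rewrite mulr0 sqr_ge0.
Qed.

End maximal_inequality.

Lemma exit_measurable m eps j : measurable [set w | ~~ alive m eps j w].
Proof.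
have mN := mFil (measurable_neg (@measurable_alive m eps j)).
by rewrite -[X in measurable X]setTI; exact: (mN measurableT [set true]).
Qed.

Lemma integral_sq_nondecreasing :
  nondecreasing_seq (fun n => \int[P]_w (W n w * W n w)).
Proof.
apply/nondecreasing_seqP => n; rewrite -subr_ge0.
have mW k : measurable_fun [set: Omega] (W k).
  by apply: (@mFil _ _ k); exact: W_adapted.
have iW k : rintegrable P (fun w => W k w * W k w).
  apply: (@bounded_rintegrable _ 1); first exact: measurable_funM.
  by move=> w; rewrite ger0_norm ?mulr_ge0// mulr_ile1.
rewrite -(RintegralB measurableT (iW n.+1) (iW n)).
have := @W_sq_mono n (fun=> true) (measurable_cst _).
by congr (_ <= _); apply: eq_Rintegral => w _; rewrite mul1r.
Qed.

Lemma integral_sq_le1 n : \int[P]_w (W n w * W n w) <= 1.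
Proof.
have mW : measurable_fun [set: Omega] (W n).
  by apply: (@mFil _ _ n); exact: W_adapted.
rewrite -[leRHS](Rintegral_const P); apply: le_Rintegral => //.
- apply: (@bounded_rintegrable _ 1); first exact: measurable_funM.
  by move=> w; rewrite ger0_norm ?mulr_ge0// mulr_ile1.
- exact: rintegrable_cst.
- by move=> w _; rewrite mulr_ile1.
Qed.

Lemma exit_ever_small (eps delta : R) : 0 < eps -> 0 < delta ->
  exists m, (P (\bigcup_j [set w | ~~ alive m eps j w]) <= delta%:E)%E.
Proof.
move=> eps0 delta0; pose e n := \int[P]_w (W n w * W n w).
have cvge : cvgn e.
  apply: nondecreasing_is_cvgn; first exact: integral_sq_nondecreasing.
  by exists 1 => _ [n _ <-]; exact: integral_sq_le1.
have ed0 : 0 < eps * delta by rewrite mulr_gt0.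
have /cvgrPdist_lt/(_ _ ed0) [m _ /(_ m (leqnn m)) /= hm] := cvge.
exists m.
have D_nd : nondecreasing_seq (fun j => [set w | ~~ alive m eps j w]).
  apply/nondecreasing_seqP => j; rewrite subsetEset => w /=.
  by apply: contra => /andP[].
pose B j := [set w | ~~ alive m eps j w].
have D_cvg : P \o B @ \oo --> P (\bigcup_j B j).
  apply: nondecreasing_cvg_mu => //; first exact: exit_measurable.
  by apply: bigcupT_measurable => j; exact: exit_measurable.
rewrite -(cvg_lim _ D_cvg)//; apply: lime_le; first by apply/cvg_ex; eexists; exact: D_cvg.
apply: nearW => j /=.
have := maximal_inequality m eps0 j.
rewrite -(@fineK _ (P _)) ?fin_num_measure//; last exact: exit_measurable.
rewrite -EFinM !lee_fin => h.
rewrite -(ler_pM2l eps0); apply: (le_trans h).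
have := nondecreasing_cvgn_le integral_sq_nondecreasing cvge (m + j).
have {}hm := le_trans (ler_norm _) (ltW hm).
by rewrite -/(e m) -/(e (m + j)); lra.
Qed.

Theorem bounded_submartingale_cvg : {ae P, forall w, cvgn (W ^~ w)}.
Proof.
(* Oscillation from every starting time m. Outside all N i, for each i some W m stays within
   (i+1)^(-1/2) of its whole future, so the path is Cauchy. *)
pose N i := \bigcap_m \bigcup_j [set w | ~~ alive m (i.+1%:R^-1) j w].
have N0 i : P.-negligible (N i).
  have mN : measurable (N i).
    apply: bigcapT_measurable => m; apply: bigcupT_measurable => j.
    exact: exit_measurable.
  exists (N i); split => //.
  apply/eqP; rewrite eq_le measure_ge0 andbT; apply/lee_addgt0Pr => e e0.
  have i0 : 0 < i.+1%:R^-1 :> R by rewrite invr_gt0.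
  have [m hm] := exit_ever_small i0 e0.
  rewrite add0e; apply: le_trans hm; apply: le_measure; rewrite ?inE//.
    by apply: bigcupT_measurable => j; exact: exit_measurable.
  by move=> w /(_ m I).
apply: negligibleS (negligible_bigcup N0) => w /=; apply: contra_notP => h.
apply/cauchy_cvgP/cauchy_exP => e e0.
have e20 : 0 < e ^+ 2 by rewrite exprn_gt0.
have /cvgrPdist_lt/(_ _ e20) [i _ /(_ i (leqnn i)) /=] := @cvg_harmonic R.
rewrite sub0r normrN gtr0_norm ?invr_gt0// => ie.
have [m hm] : exists m, forall j, alive m (i.+1%:R^-1) j w.
  apply: contrapT => /forallNP hn; apply: h; exists i => // m _.
  by have /existsNP[j /negP hj] := hn m; exists j.
exists (W m w); exists m => // n /= mn; rewrite -ball_normE /= distrC.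
have [->|nm] := eqVneq n m; first by rewrite subrr normr0.
have {}mn : (m < n)%N by rewrite ltn_neqAle eq_sym nm.
have /= /andP[_] := hm (n - m)%N.-1.+1.
rewrite prednK ?subn_gt0// subnKC 1?ltnW// => hW.
rewrite -(@ltr_pXn2r _ 2) ?nnegrE ?(ltW e0)// real_normK ?num_real//.
exact: lt_trans hW ie.
Qed.

End bounded_submartingale.

Lemma integral_probability_cst (R : realType) d (T : measurableType d)
  (P : probability T R) (r : R) : (\int[P]_t r%:E = r%:E)%E.
Proof.
by rewrite integral_cst//= [X in (_ * X)%E](probability_setT P) mule1.
Qed.

(** * Nonnegative functions that decrease in the mean up to summable errors *)

Section lyapunov.
Context {R : realType} {H : completeNormedModType R}.
Variable q : nat -> H.
Hypothesis q_dense : forall x e, 0 < e -> exists n, `|x - q n| < e.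
Context d0 (Omega : measurableType d0) (P : probability Omega R).
Context d2 (Xi : measurableType d2) (D : probability Xi R).
Variable xi : nat -> {RV P >-> Xi}.
Hypothesis xi_iid : iid D xi.
Variable s : nat -> H -> Xi -> H.
Hypothesis measurable_s : forall k x, norm_measurable (s k x).
Hypothesis continuous_s : forall k y, continuous (fun x => s k x y).
Variables (x0 : H) (X : nat -> Omega -> H).
Hypothesis X0 : forall w, X 0 w = x0.
Hypothesis XS : forall k w, X k.+1 w = s k (X k w) (xi k w).

Lemma measurable_iterate k (y : H -> R) : continuous y ->
  measurable_fun [set: Omega] (fun w => y (X k w)).
Proof.
move=> cy; apply: (@measurable_past_fun _ _ _ _ _ _ xi k).
exact: (measurable_iterate_comp q_dense measurable_s continuous_s X0 XS).
Qed.

Lemma iterate_mean_le k (y y' : H -> R) : continuous y -> (forall x, 0 <= y x) ->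
  continuous y' -> (forall x, (\int[D]_e (y (s k x e))%:E <= (y' x)%:E)%E) ->
  (\int[P]_w (y (X k.+1 w))%:E <= \int[P]_w (y' (X k w))%:E)%E.
Proof.
move=> cy y0 cy' yy'.
have := @markov_le _ _ _ q_dense _ _ _ _ _ _ _ xi_iid _ measurable_s continuous_s
  _ _ X0 XS k (fun=> 1) y y' (measurable_cst _) (fun=> ler01) cy y0 cy' yy'.
by under eq_integral do rewrite mul1r; under [X in (_ <= X)%E]eq_integral do rewrite mul1r.
Qed.

Variables (y : H -> R) (c : nat -> R) (C : R).
Hypothesis continuous_y : continuous y.
Hypothesis y_ge0 : forall x, 0 <= y x.
Hypothesis c_ge0 : forall k, 0 <= c k.
Hypothesis sum_c : forall n, \sum_(i < n) c i <= C.
Hypothesis mean_y : forall k x, (\int[D]_e (y (s k x e))%:E <= (y x + c k)%:E)%E.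

Lemma lyapunov_moment k :
  (\int[P]_w (y (X k w))%:E <= (y x0 + \sum_(i < k) c i)%:E)%E.
Proof.
elim: k => [|k IH].
  under eq_integral do rewrite X0.
  by rewrite integral_probability_cst big_ord0 addr0.
have cyc : continuous (fun x => y x + c k).
  by move=> x; apply: cvgD; [exact: continuous_y|exact: cvg_cst].
apply: (le_trans (iterate_mean_le continuous_y y_ge0 cyc (mean_y k))).
under eq_integral do rewrite EFinD.
rewrite ge0_integralD//; last 3 first.
- by move=> w _; rewrite lee_fin.
- by apply/measurable_EFinP; exact: measurable_iterate.
- by move=> w _; rewrite lee_fin.
rewrite integral_probability_cst big_ord_recr /= addrA EFinD.
exact: leeD.
Qed.

(** The error budget still unspent; adding it to y turns the almost-decrease of the mean into a
    decrease. *)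
Let rest k := C - \sum_(i < k) c i.
Let rest_ge0 k : 0 <= rest k. Proof. by rewrite subr_ge0. Qed.
Let z k x := y x + rest k.
Let z_ge0 k x : 0 <= z k x. Proof. by rewrite addr_ge0. Qed.
Let wt k x := (1 + z k x)^-1.

Let continuous_z k : continuous (z k).
Proof. by move=> x; apply: cvgD; [exact: continuous_y|exact: cvg_cst]. Qed.

Let continuous_wt k : continuous (wt k).
Proof.
move=> x; apply: cvgV; first by rewrite gt_eqF// ltr_wpDr.
by apply: cvgD; [exact: cvg_cst|exact: continuous_z].
Qed.

Let wt01 k x : 0 <= wt k x <= 1.
Proof.
by rewrite invr_ge0 addr_ge0//= invf_le1 ?lerDl// ltr_wpDr.
Qed.

Let mean_z k x : (\int[D]_e (z k.+1 (s k x e))%:E <= (z k x)%:E)%E.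
Proof.
rewrite /z; under eq_integral do rewrite EFinD.
rewrite ge0_integralD//; last 3 first.
- by move=> e _; rewrite lee_fin.
- apply/measurable_EFinP.
  exact: (measurable_s_comp q_dense measurable_s).
- by move=> e _; rewrite lee_fin.
rewrite integral_probability_cst.
apply: (le_trans (leeD (mean_y k x) (lexx _))).
by rewrite -EFinD lee_fin /rest big_ord_recr /=; lra.
Qed.

(* Jensen's inequality for the convex function [t |-> 1 / (1 + t)] through its
   tangent at [z k x]. *)
Let mean_wt k x : ((wt k x)%:E <= \int[D]_e (wt k.+1 (s k x e))%:E)%E.
Proof.
have mz : measurable_fun setT (fun e => z k.+1 (s k x e)).
  by apply: (measurable_s_comp q_dense measurable_s); exact: continuous_z.
have mwt : measurable_fun setT (fun e => wt k.+1 (s k x e)).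
  by apply: (measurable_s_comp q_dense measurable_s); exact: continuous_wt.
have [iz zle] := ge0_rintegrable mz (fun e => z_ge0 k.+1 (s k x e)) (mean_z k x).
have iw : rintegrable D (fun e => wt k.+1 (s k x e)).
  apply: (le_rintegrable (h := fun=> 1) mwt); last exact: rintegrable_cst.
  by move=> e; have /andP[h0 h1] := wt01 k.+1 (s k x e); rewrite ger0_norm.
rewrite EFin_Rintegral// lee_fin.
pose a := wt k x + wt k x ^+ 2 * z k x.
have it : rintegrable D (fun e => a - wt k x ^+ 2 * z k.+1 (s k x e)).
  by apply: rintegrableB; [exact: rintegrable_cst|exact: rintegrableZ].
apply: (@le_trans _ _ (\int[D]_e (a - wt k x ^+ 2 * z k.+1 (s k x e)))).
  rewrite (RintegralB measurableT (rintegrable_cst D _) (rintegrableZ _ iz)).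
  rewrite Rintegral_const (RintegralZl _ measurableT iz) /a.
  have := ler_wpM2l (sqr_ge0 (wt k x)) zle; lra.
apply: le_Rintegral => // e _.
have := z_ge0 k x; have := z_ge0 k.+1 (s k x e); rewrite /a /wt.
move: (z k x) (z k.+1 _) => u t t0 u0.
rewrite -subr_ge0.
have -> : (1 + t)^-1 - ((1 + u)^-1 + (1 + u)^-1 ^+ 2 * u - (1 + u)^-1 ^+ 2 * t) =
   (1 + t)^-1 * (((1 + u)^-1) * (t - u)) ^+ 2.
  by field; rewrite !gt_eqF// ltr_wpDr.
by rewrite mulr_ge0 ?sqr_ge0// invr_ge0 addr_ge0.
Qed.

Let weight_cvg : {ae P, forall w, cvgn (fun k => wt k (X k w))}.
Proof.
apply: (@bounded_submartingale_cvg _ _ _ P (past xi) _ _ (fun k w => wt k (X k w))).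
- by move=> k; exact: sigma_past_measurable.
- by move=> k l; exact: sigma_past_le.
- move=> k.
  by apply: (measurable_iterate_comp q_dense measurable_s continuous_s X0 XS); exact: continuous_wt.
- by move=> k w; exact: wt01.
move=> k h mh h01.
have wt0 j x : 0 <= wt j x by have /andP[] := wt01 j x.
have h0 w : 0 <= h w by have /andP[] := h01 w.
have i j : rintegrable P (fun w => h w * wt j (X j w)).
  apply: (le_rintegrable (h := fun=> 1)); last exact: rintegrable_cst.
    apply: measurable_funM; first exact: measurable_past_fun mh.
    by apply: (measurable_iterate j); exact: continuous_wt.
  move=> w; have /andP[a0 a1] := h01 w; have /andP[b0 b1] := wt01 j (X j w).
  by rewrite ger0_norm ?mulr_ge0// mulr_ile1.
rewrite -lee_fin -!EFin_Rintegral//.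
apply: (markov_ge q_dense xi_iid measurable_s continuous_s X0 XS) => //.
Qed.

(** Convergence of 1/(1+z) leaves open that z tends to infinity. The means of y are bounded by K, so
    Markov's inequality gives probability at most K/(n+1) to y being eventually above n+1. *)
Let not_infinite : {ae P, forall w, ~ (y (X k w) @[k --> \oo] --> +oo)}.
Proof.
pose K := y x0 + C + 1.
have K0 : 0 < K.
  have := sum_c 0; rewrite big_ord0 /K => C0; have := y_ge0 x0; lra.
have momK k : (\int[P]_w (y (X k w))%:E <= K%:E)%E.
  apply: le_trans (lyapunov_moment k) _; rewrite lee_fin /K.
  by have := sum_c k; lra.
pose A n k := [set w | n.+1%:R <= y (X k w)].
have mA n k : measurable (A n k).
  have := measurable_iterate k continuous_y measurableT
    (measurable_itv `[n.+1%:R, +oo[).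
  rewrite setTI; congr measurable; apply/seteqP.
  by split => w /=; rewrite in_itv /= andbT.
have PA n k : (P (A n k) <= (K / n.+1%:R)%:E)%E.
  have n0 : (0 : R) < n.+1%:R by [].
  rewrite -(@fineK _ (P _)) ?fin_num_measure// lee_fin ler_pdivlMr// mulrC.
  rewrite -lee_fin EFinM fineK ?fin_num_measure//.
  apply: le_trans (momK k).
  rewrite -[X in P X]setIT -integral_indic// -ge0_integralZl//; last first.
    by apply/measurable_EFinP; exact: measurable_indic.
  apply: ge0_le_integral => //.
  - by apply/measurable_EFinP; apply: measurable_funM => //; exact: measurable_indic.
  - by apply/measurable_EFinP; exact: measurable_iterate.
  - move=> w _; rewrite -EFinM lee_fin indicE; have [|] := boolP (w \in _).
      by rewrite inE /= mulr1.
    by rewrite mulr0.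
pose N := \bigcap_n \bigcup_m \bigcap_(k in [set k | (m <= k)%N]) A n k.
have mB n m : measurable (\bigcap_(k in [set k | (m <= k)%N]) A n k).
  by apply: bigcap_measurableType => k _.
have mN : measurable N.
  by apply: bigcapT_measurable => n; apply: bigcupT_measurable => m.
exists N; split => //; last first.
  move=> w /= /contrapT h n _.
  have /cvgryPge/(_ n.+1%:R) [m _ hm] := h.
  by exists m => // k /= mk; exact: hm.
apply/eqP; rewrite eq_le measure_ge0 andbT; apply/lee_addgt0Pr => e e0.
rewrite add0e.
have [n hn] : exists n : nat, K / n.+1%:R <= e.
  have := archi_boundP (ltW (divr_gt0 K0 e0)).
  set b := Num.bound _ => hb; exists b.
  rewrite ler_pdivrMr// mulrC -ler_pdivrMr//; apply: (le_trans (ltW hb)).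
  by rewrite ler_nat.
pose B m := \bigcap_(k in [set k | (m <= k)%N]) A n k.
have B_cvg : P \o B @ \oo --> P (\bigcup_m B m).
  apply: nondecreasing_cvg_mu; first exact: mB.
    by apply: bigcupT_measurable => m; exact: mB.
  apply/nondecreasing_seqP => m; rewrite subsetEset => w hw k /= mk.
  by apply: hw => /=; exact: ltnW.
apply: (@le_trans _ _ (P (\bigcup_m B m))).
  apply: le_measure; rewrite ?inE//.
    by apply: bigcupT_measurable => m; exact: mB.
  by move=> w /(_ n I).
rewrite -(cvg_lim _ B_cvg)//; apply: lime_le; first by apply/cvg_ex; eexists; exact: B_cvg.
apply: nearW => m /=; apply: (@le_trans _ _ (P (A n m))).
  apply: le_measure; rewrite ?inE//; first exact: mB.
  by move=> w /(_ m); apply => /=.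
by apply: (le_trans (PA n m)); rewrite lee_fin.
Qed.

Theorem lyapunov_cvg : {ae P, forall w, cvgn (fun k => y (X k w))}.
Proof.
have rest_cvg : cvgn rest.
  apply: is_cvgB; first exact: is_cvg_cst.
  apply: nondecreasing_is_cvgn.
    apply/nondecreasing_seqP => n; rewrite big_ord_recr /=.
    by rewrite lerDl.
  by exists C => _ [n _ <-].
apply: filterS2 weight_cvg not_infinite => w cw ninf.
have wgt0 k : 0 < wt k (X k w) by rewrite invr_gt0 ltr_wpDr.
have yE k : y (X k w) = (wt k (X k w))^-1 - 1 - rest k.
  by rewrite /wt invrK /z; ring.
have l0 : limn (fun k => wt k (X k w)) != 0.
  apply/eqP => l0; apply: ninf.
  apply/cvgryPge => A.
  (* Large enough that 1/wt > M still leaves y >= A after subtracting 1 and rest <= C. *)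
  pose M := `|A| + 1 + C + 1.
  have C0 : 0 <= C by have := sum_c 0; rewrite big_ord0.
  have M0 : 0 < M by rewrite /M; have := normr_ge0 A; lra.
  have Mi0 : 0 < M^-1 by rewrite invr_gt0.
  have /cvgrPdist_lt/(_ _ Mi0) := cw; apply: filterS => k.
  rewrite l0 sub0r normrN gtr0_norm// => hk; rewrite yE.
  have : M < (wt k (X k w))^-1 by rewrite -[ltLHS]invrK ltf_pV2 ?posrE.
  have := ler_norm A; have : rest k <= C.
    by rewrite /rest gerBl sumr_ge0.
  rewrite /M; lra.
rewrite (_ : (fun k => y (X k w)) = (fun k => (wt k (X k w))^-1 - 1 - rest k)).
  apply: is_cvgB => //; apply: is_cvgB; last exact: is_cvg_cst.
  exact: is_cvgV.
by apply/funext.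
Qed.

End lyapunov.

(** * Opial's lemma *)

Section opial.
Context {R : realType} {H : completeNormedModType R}.
Variable ip : {dot H for @idfun R}.
Hypothesis ip_norm : forall x : H, ip x x = `|x| ^+ 2.

Lemma ultra_bounded_cvg (U : set_system nat) (a : nat -> R) (B : R) :
  UltraFilter U -> (forall k, `|a k| <= B) -> exists l : R, a k @[k --> U] --> l.
Proof.
move=> UU aB; have PU : ProperFilter U by exact: ultra_proper.
have aU : (a @ U) [set` `[- B, B]] by apply: nearW => k /=; rewrite in_itv /= -ler_norml.
have [p [_ cp]] := @segment_compact R (- B) B (a @ U) _ aU.
exists p => V Vp.
have [//|nV] := in_ultra_setVsetC (a @^-1` V) UU.
by have [x [/= nVx Vx]] := cp (~` V) V nV Vp.
Qed.

Variable u : nat -> H.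

Definition weak_limit_along (U : set_system nat) (p : H) : Prop :=
  forall v, ip (u k) v @[k --> U] --> ip p v.

(** Along U every <u k, v> converges by compactness of a segment; the limits form a bounded linear
    functional of v, which Riesz represents. *)
Lemma ultra_weak_limit (U : set_system nat) (M : R) : UltraFilter U ->
  (forall k, `|u k| <= M) -> exists p, weak_limit_along U p.
Proof.
move=> UU uM; have PU : ProperFilter U by exact: ultra_proper.
have bnd k v : `|ip (u k) v| <= M * `|v|.
  by apply: (le_trans (norm_ip_le ip_norm _ _)); rewrite ler_wpM2r.
have /choice [l lP] (v : H) := ultra_bounded_cvg UU (bnd^~ v).
have [] := @riesz _ _ _ ip_norm l M.
- move=> a x y.
  have h : ip (u k) (a *: x + y) @[k --> U] --> a * l x + l y.
    under eq_fun do rewrite ipDr ipZr.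
    by apply: cvgD => //; apply: cvgMl_tmp.
  by rewrite -(cvg_lim (@norm_hausdorff _ _) (lP (a *: x + y)));
     apply: (cvg_lim (@norm_hausdorff _ _) h).
- move=> v; rewrite -(cvg_lim (@norm_hausdorff _ _) (cvg_norm (lP v))).
  apply: limr_le; first by apply/cvg_ex; eexists; exact: cvg_norm (lP v).
  exact: nearW.
by move=> p hp; exists p => v; rewrite -hp.
Qed.

Variable S : set H.
Hypothesis dist_cvg : forall z, S z -> cvgn (fun k => `|u k - z| ^+ 2).
Hypothesis weak_limit_S : forall U p, UltraFilter U -> \oo `<=` U ->
  weak_limit_along U p -> S p.
Hypothesis S_neq0 : S !=set0.

(** |u k - p|^2 - |u k - p'|^2 converges along the whole sequence and is affine in u k. Equating its
    limits along U and U' gives <p - p', p - p'> = 0. *)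
Lemma weak_limits_unique U U' p p' : UltraFilter U -> UltraFilter U' ->
  \oo `<=` U -> \oo `<=` U' -> weak_limit_along U p -> weak_limit_along U' p' ->
  p = p'.
Proof.
move=> UU UU' oU oU' Up Up'.
have PU : ProperFilter U by exact: ultra_proper.
have PU' : ProperFilter U' by exact: ultra_proper.
have Sp := weak_limit_S UU oU Up; have Sp' := weak_limit_S UU' oU' Up'.
have cd : cvgn (fun k => `|u k - p| ^+ 2 - `|u k - p'| ^+ 2).
  by apply: is_cvgB; exact: dist_cvg.
have dE k : `|u k - p| ^+ 2 - `|u k - p'| ^+ 2 =
    `|p| ^+ 2 - `|p'| ^+ 2 - 2 * ip (u k) (p - p').
  by rewrite !(normBsq ip_norm) ipDr ipNr; ring.
have lim V x : ProperFilter V -> \oo `<=` V -> weak_limit_along V x ->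
    `|p| ^+ 2 - `|p'| ^+ 2 - 2 * ip x (p - p') =
    limn (fun k => `|u k - p| ^+ 2 - `|u k - p'| ^+ 2).
  move=> PV oV Vx.
  have h1 : `|u k - p| ^+ 2 - `|u k - p'| ^+ 2 @[k --> V] -->
      limn (fun k => `|u k - p| ^+ 2 - `|u k - p'| ^+ 2).
    by move=> A /cd hA; exact: oV.
  have h2 : `|u k - p| ^+ 2 - `|u k - p'| ^+ 2 @[k --> V] -->
      `|p| ^+ 2 - `|p'| ^+ 2 - 2 * ip x (p - p').
    under eq_fun do rewrite dE.
    by apply: cvgB; [exact: cvg_cst|apply: cvgMl_tmp; exact: Vx].
  by rewrite -(cvg_lim (@norm_hausdorff _ _) h1);
     apply/esym/(cvg_lim (@norm_hausdorff _ _) h2).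
have e1 := lim _ _ PU oU Up; have e2 := lim _ _ PU' oU' Up'.
have : ip (p - p') (p - p') = 0.
  by rewrite ipDl ipNl; move: e1; rewrite -e2; lra.
by rewrite ip_norm => /eqP; rewrite sqrf_eq0 normr_eq0 subr_eq0 => /eqP.
Qed.

(* Opial's lemma; the diagonal extraction of weakly convergent subsequences is
   replaced by limits along ultrafilters. *)
Theorem opial : exists2 x, S x & weakly_cvg ip u x.
Proof.
have [z Sz] := S_neq0.
have [M uM] : exists M, forall k, `|u k| <= M.
  have [B [_ hB]] := cvg_seq_bounded (dist_cvg Sz).
  exists (`|B| + 2 + `|z|) => k.
  have B1 : B < `|B| + 1 by rewrite (le_lt_trans (ler_norm _))// ltrDl.
  have hk : `|u k - z| ^+ 2 <= `|B| + 1.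
    by apply: (le_trans (ler_norm _)); exact: (hB _ B1 k I).
  have : `|u k| <= `|u k - z| + `|z| by rewrite -{1}(subrK z (u k)) ler_normD.
  have := sqr_ge0 (`|u k - z| - 1); have := normr_ge0 B; lra.
have [U [UU oU]] := ultraFilterLemma (F := \oo) _.
have [p Up] := ultra_weak_limit UU uM.
exists p; first exact: weak_limit_S Up.
move=> v; apply/cvgrPdist_lt => e e0; apply: contrapT => hn.
(* If weak convergence failed, some ultrafilter would live on these bad indices; its weak limit is
   again p, which contradicts the gap e. *)
pose A := [set k | ~ (`|ip p v - ip (u k) v| < e)].
have PA : ProperFilter (within A \oo).
  apply: Build_ProperFilter_ex => B wB; apply: contrapT => nB; apply: hn.
  have {}wB : \forall k \near \oo, A k -> B k := wB.
  apply: filterS wB => k hk; apply: contrapT => nk; apply: nB.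
  by exists k; exact: hk.
have [V [VU wV]] := ultraFilterLemma PA.
have PV : ProperFilter V by exact: ultra_proper.
have oV : \oo `<=` V.
  move=> B oB; apply: wV.
  suff : \forall k \near \oo, A k -> B k by [].
  by apply: filterS oB.
have [p' Vp'] := ultra_weak_limit VU uM.
have pp' := weak_limits_unique UU VU oU oV Up Vp'.
have VA : V A by apply: wV; exact: withinT.
have /cvgrPdist_lt/(_ _ e0) := Vp' v; rewrite -pp' => h.
by have [k [/= hk]] := filter_ex (filterI h VA); apply.
Qed.

End opial.

(** * Moment bounds and rates *)

Lemma sum_tail_le (R : numDomainType) (g : nat -> R) i j : (i <= j)%N ->
  (forall k, 0 <= g k) -> \sum_(k < j - i) g (i + k)%N <= \sum_(k < j) g k.
Proof.
move=> ij g0; move: (j - i)%N (subnKC ij) => l <-; rewrite big_split_ord /=.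
by rewrite lerDr sumr_ge0.
Qed.

(** * Deterministic recursions for the mean squared distance d and the mean gap a *)

Section gap_recursions.
Context {R : realType}.
Variables (lam d a : nat -> R) (K : nat) (c N S V A B l : R).
Hypothesis c_gt0 : 0 < c.
Hypothesis N_ge0 : 0 <= N.
Hypothesis lam_ge0 : forall k, 0 <= lam k.
Hypothesis d_ge0 : forall k, 0 <= d k.
Hypothesis a_ge0 : forall k, 0 <= a k.
Hypothesis d_step : forall k, d k.+1 + c * lam k * a k <= d k + N * lam k ^+ 2.
Hypothesis sum_lam2 : \sum_(i < K) lam i ^+ 2 <= V.
Hypothesis a_le_d : forall k, a k <= l * d k.
Hypothesis l_ge0 : 0 <= l.
Hypothesis A_ge0 : 0 <= A.
Hypothesis a_step : forall k, a k.+1 <= a k + lam k ^+ 2 * (A * a k + B).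

Let total := d 0 + N * V.

Lemma sum_gap_aux k :
  d k + c * \sum_(i < k) lam i * a i <= d 0 + N * \sum_(i < k) lam i ^+ 2.
Proof.
elim: k => [|k IH]; first by rewrite !big_ord0 !mulr0 !addr0.
rewrite !big_ord_recr /= !mulrDr; have := d_step k; lra.
Qed.

Lemma sum_sq_le k : (k <= K)%N -> \sum_(i < k) lam i ^+ 2 <= V.
Proof.
move=> kK; apply: le_trans sum_lam2.
rewrite -(subnKC kK) big_split_ord /= lerDl.
by apply: sumr_ge0 => i _; exact: sqr_ge0.
Qed.

Lemma sum_gap_le k : (k <= K)%N -> \sum_(i < k) lam i * a i <= total / c.
Proof.
move=> kK; rewrite ler_pdivlMr// mulrC /total.
have := sum_gap_aux k; have := d_ge0 k; have := ler_wpM2l N_ge0 (sum_sq_le kK); lra.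
Qed.

(** This uniform bound freezes the factor A a_k + B of the value recursion at the constant Q, so
    that the gap grows at most additively. *)
Lemma gap_le k : (k <= K)%N -> a k <= l * total.
Proof.
move=> kK; apply: (le_trans (a_le_d k)); rewrite ler_wpM2l// /total.
have := sum_gap_aux k; have := ler_wpM2l N_ge0 (sum_sq_le kK).
have : 0 <= c * \sum_(i < k) lam i * a i.
  by rewrite mulr_ge0 ?(ltW c_gt0)// sumr_ge0// => i _; rewrite mulr_ge0.
lra.
Qed.

Let Q := A * (l * total) + B.

Lemma gap_later m j : (m + j <= K)%N ->
  a (m + j) <= a m + Q * \sum_(i < j) lam (m + i) ^+ 2.
Proof.
elim: j => [|j IH] mjK; first by rewrite addn0 big_ord0 mulr0 addr0.
rewrite addnS big_ord_recr /= mulrDr.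
have mjK' : (m + j <= K)%N by rewrite ltnW// -addnS.
have h := ler_wpM2l A_ge0 (gap_le mjK').
have h2 : lam (m + j) ^+ 2 * (A * a (m + j) + B) <= lam (m + j) ^+ 2 * Q.
  by rewrite ler_wpM2l ?sqr_ge0// /Q lerD2r.
have := a_step (m + j); have := IH mjK'; lra.
Qed.

(* Average [gap_later] over the window [m, K) with weights [lam]. *)
Lemma last_gap_le (m j : nat) (kappa tau r2 : R) : (m + j = K)%N ->
  0 < kappa -> 0 < r2 -> 0 <= Q ->
  kappa <= r2 * \sum_(i < j) lam (m + i) ->
  \sum_(i < j) lam (m + i) ^+ 2 <= tau * r2 ->
  a K <= (total / c / kappa + Q * tau) * r2.
Proof.
move=> mjK kappa0 r20 Q0 hkappa htau.
have each i : (i < j)%N -> a K <= a (m + i) + Q * (tau * r2).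
  move=> ij; have e : (m + i + (j - i) = K)%N by rewrite -addnA subnKC// ltnW.
  have := gap_later (m := m + i) (j := j - i); rewrite e => /(_ (leqnn _)) h.
  apply: (le_trans h); rewrite lerD2l ler_wpM2l//.
  apply: le_trans htau.
  have := sum_tail_le (g := fun k => lam (m + k) ^+ 2) (ltnW ij) (fun=> sqr_ge0 _).
  by under eq_bigr do rewrite addnA.
pose s := \sum_(i < j) lam (m + i).
have s0 : 0 < s by have := lt_le_trans kappa0 hkappa; rewrite pmulr_rgt0.
have hs : s * a K <= total / c + s * (Q * (tau * r2)).
  rewrite /s !mulr_suml; apply: (@le_trans _ _ (\sum_(i < j) (lam (m + i) * a (m + i)
      + lam (m + i) * (Q * (tau * r2))))).
    by apply: ler_sum => i _; rewrite -mulrDr ler_wpM2l// each.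
  rewrite big_split /= lerD2r.
  have mjK' : (m + j <= K)%N by rewrite mjK.
  apply: le_trans (sum_gap_le mjK'); rewrite big_split_ord /=.
  by rewrite lerDr sumr_ge0// => i _; rewrite mulr_ge0.
have tc0 : 0 <= total / c.
  have := sum_gap_le (leq0n K); by rewrite big_ord0.
have : s * (a K - Q * (tau * r2)) <= total / c by rewrite mulrBr; lra.
rewrite -ler_pdivlMl// mulrC => h.
have : total / c / s <= total / c / kappa * r2.
  rewrite -[leRHS]mulrA ler_wpM2l// [leRHS]mulrC ler_pdivlMr// mulrC.
  by rewrite ler_pdivrMr.
lra.
Qed.

End gap_recursions.

(** * Expected gap and gradient norm of the method *)

Section sgd_moments.
Context {R : realType} {H : completeNormedModType R}.
Variable ip : {dot H for @idfun R}.
Hypothesis ip_norm : forall x : H, ip x x = `|x| ^+ 2.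
Variable q : nat -> H.
Hypothesis q_dense : forall x e, 0 < e -> exists n, `|x - q n| < e.
Context d {Xi : measurableType d} (D : probability Xi R).
Variables (F : Xi -> H -> R) (G : Xi -> H -> H) (f : H -> R) (g : H -> H).
Variables (L gamma : R).
Hypothesis L_gt0 : 0 < L.
Hypothesis F_bregman : forall xi, bregman_bounds ip L (F xi) (G xi).
Hypothesis F_measurable : forall x, measurable_fun [set: Xi] (fun xi => F xi x).
Hypothesis F_integrable : forall x, rintegrable D (fun xi => F xi x).
Hypothesis f_def : forall x, f x = \int[D]_xi F xi x.
Hypothesis f_quotient : forall x v,
  n.+1%:R * (f (x + n.+1%:R^-1 *: v) - f x) @[n --> \oo] --> ip (g x) v.
Hypothesis gamma_gt0 : 0 < gamma.
Hypothesis gamma_lt : gamma < 2 / L.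
Variable lbar : R.
Hypothesis lbar_gt0 : 0 < lbar.
Hypothesis lbar_lt1 : lbar < 1.
Variables (z : H) (S : R).
Hypothesis z_min : minimizer f z.
Hypothesis z_moment : grad_moment_le D G z S.
Context d0 (Omega : measurableType d0) (P : probability Omega R).
Variable xi : nat -> {RV P >-> Xi}.
Hypothesis xi_iid : iid D xi.
Variable lam : nat -> R.
Hypothesis lam_bounds : forall k, 0 <= lam k <= lbar.
Variables (x0 : H) (X : nat -> Omega -> H).
Hypothesis X0 : forall w, X 0 w = x0.
Hypothesis XS : forall k w, X k.+1 w = step G gamma (lam k) (X k w) (xi k w).

Local Notation s := (fun k => step G gamma (lam k)).

Lemma continuous_step l e : continuous (fun x => step G gamma l x e).
Proof.
move=> x; rewrite /step; apply: cvgB; first exact: cvg_id.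
suff : G e y @[y --> x] --> G e x by move=> h; by apply: cvgZ => //; exact: cvg_cst.
apply/cvgrPdist_lt => eps eps0.
near=> y.
apply: (le_lt_trans (bregman_grad_lipschitz ip_norm L_gt0 (F_bregman e) y x)).
rewrite -ltr_pdivlMl// mulrC; near: y; apply: cvgr_dist_lt; first exact: cvg_id.
by rewrite divr_gt0.
Unshelve. all: by end_near. Qed.

Lemma measurable_step k x : norm_measurable (s k x).
Proof.
exact: (norm_measurable_step ip_norm q_dense gamma F_bregman F_measurable (lam k) x).
Qed.

Lemma continuous_objective : continuous f.
Proof.
exact: (bregman_continuous ip_norm L_gt0
  (f_bregman L_gt0 F_bregman F_measurable F_integrable f_def f_quotient)).
Qed.

Lemma moment_bound_ge0 : 0 <= S.
Proof.
rewrite -lee_fin; apply: le_trans z_moment; apply: integral_ge0 => e _.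
by rewrite lee_fin sqr_ge0.
Qed.

Lemma gap_ge0 x : 0 <= f x - f z. Proof. by rewrite subr_ge0. Qed.

Lemma measurable_X k (y : H -> R) : continuous y ->
  measurable_fun [set: Omega] (fun w => y (X k w)).
Proof.
exact: (measurable_iterate q_dense measurable_step (fun k => @continuous_step (lam k)) X0 XS k).
Qed.

Let N := noise gamma lbar * S.

Lemma N_ge0 : 0 <= N.
Proof. by rewrite mulr_ge0 ?moment_bound_ge0// noise_ge0. Qed.

Lemma sqdist_lyapunov k x :
  (\int[D]_e (`|s k x e - z| ^+ 2)%:E <= (`|x - z| ^+ 2 + N * lam k ^+ 2)%:E)%E.
Proof.
apply: le_trans (step_sqdist_mean ip_norm q_dense L_gt0 F_bregman F_measurable
  F_integrable f_def f_quotient gamma_gt0 lbar_gt0 lbar_lt1 x z_min z_moment (lam_bounds k)) _.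
rewrite lee_fin /N.
have : 0 <= decrease L gamma * lam k * (f x - f z).
  have /andP[l0 _] := lam_bounds k.
  have dec0 := decrease_gt0 L_gt0 gamma_gt0 gamma_lt.
  by apply: mulr_ge0 (gap_ge0 x); apply: mulr_ge0 l0; exact: ltW.
lra.
Qed.

Lemma sqdist_moment k :
  rintegrable P (fun w => `|X k w - z| ^+ 2) /\
  \int[P]_w (`|X k w - z| ^+ 2) <= `|x0 - z| ^+ 2 + N * \sum_(i < k) lam i ^+ 2.
Proof.
apply: ge0_rintegrable.
- exact: (measurable_X k (@continuous_sqdist _ _ z)).
- by move=> w; exact: sqr_ge0.
rewrite mulr_sumr.
apply: (lyapunov_moment q_dense xi_iid measurable_step (fun k => @continuous_step (lam k))
  X0 XS (@continuous_sqdist _ _ z) _ _ sqdist_lyapunov).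
- by move=> x; exact: sqr_ge0.
- by move=> i; rewrite mulr_ge0 ?N_ge0 ?sqr_ge0.
Qed.

Lemma gap_integrable k : rintegrable P (fun w => f (X k w) - f z).
Proof.
have cg : continuous (fun x => f x - f z).
  by move=> x; apply: cvgB; [exact: continuous_objective|exact: cvg_cst].
apply: (le_rintegrable (h := fun w => L / 2 * `|X k w - z| ^+ 2)).
- exact: (measurable_X k cg).
- move=> w; rewrite ger0_norm ?gap_ge0//.
  exact: (gap_le_dist ip_norm L_gt0 F_bregman F_measurable F_integrable f_def f_quotient).
- apply: rintegrableZ; exact: (sqdist_moment k).1.
Qed.

Definition sqdist_mean k := \int[P]_w (`|X k w - z| ^+ 2).
Definition gap_mean k := \int[P]_w (f (X k w) - f z).

Lemma sqdist_mean_ge0 k : 0 <= sqdist_mean k.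
Proof. by apply: Rintegral_ge0 => w _; exact: sqr_ge0. Qed.

Lemma gap_mean_ge0 k : 0 <= gap_mean k.
Proof. by apply: Rintegral_ge0 => w _; exact: gap_ge0. Qed.

Lemma gap_mean_le k : gap_mean k <= L / 2 * sqdist_mean k.
Proof.
have i1 := (sqdist_moment k).1.
rewrite -(RintegralZl _ measurableT i1); apply: le_Rintegral => //.
- exact: gap_integrable.
- exact: rintegrableZ.
move=> w _.
exact: (gap_le_dist ip_norm L_gt0 F_bregman F_measurable F_integrable f_def f_quotient).
Qed.

Lemma sqdist_mean0 : sqdist_mean 0 = `|x0 - z| ^+ 2.
Proof.
rewrite /sqdist_mean; under eq_Rintegral do rewrite X0.
exact: Rintegral_const.
Qed.

Lemma iterate_Rintegral_le k (y y' : H -> R) : continuous y -> (forall x, 0 <= y x) ->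
  continuous y' -> rintegrable P (fun w => y (X k.+1 w)) ->
  rintegrable P (fun w => y' (X k w)) ->
  (forall x, (\int[D]_e (y (s k x e))%:E <= (y' x)%:E)%E) ->
  \int[P]_w (y (X k.+1 w)) <= \int[P]_w (y' (X k w)).
Proof.
move=> cy y0 cy' iy iy' yy'; rewrite -lee_fin -!EFin_Rintegral//.
exact: (iterate_mean_le q_dense xi_iid measurable_step
  (fun k => @continuous_step (lam k)) X0 XS cy y0 cy' yy').
Qed.

Lemma sqdist_mean_step k : sqdist_mean k.+1 + decrease L gamma * lam k * gap_mean k
  <= sqdist_mean k + N * lam k ^+ 2.
Proof.
pose y' x := `|x - z| ^+ 2 - decrease L gamma * lam k * (f x - f z)
  + noise gamma lbar * lam k ^+ 2 * S.
have cg : continuous (fun x => f x - f z).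
  by move=> x; apply: cvgB; [exact: continuous_objective|exact: cvg_cst].
have cy' : continuous y'.
  move=> x; apply: cvgD; last exact: cvg_cst.
  apply: cvgB; first exact: continuous_sqdist.
  by apply: cvgMl_tmp; exact: cg.
have i1 := (sqdist_moment k).1; have i2 := gap_integrable k.
have i3 := rintegrableB i1 (rintegrableZ (decrease L gamma * lam k) i2).
have iy' : rintegrable P (fun w => y' (X k w)).
  by apply: rintegrableD; [exact: i3|exact: rintegrable_cst].
have := iterate_Rintegral_le (@continuous_sqdist _ _ z) (fun=> sqr_ge0 _) cy'
  (sqdist_moment k.+1).1 iy' (fun x => step_sqdist_mean ip_norm q_dense L_gt0 F_bregman F_measurable
  F_integrable f_def f_quotient gamma_gt0 lbar_gt0 lbar_lt1 x z_min z_moment (lam_bounds k)).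
rewrite (RintegralD measurableT i3 (rintegrable_cst _ _)) Rintegral_const.
rewrite (RintegralB measurableT i1 (rintegrableZ _ i2)) (RintegralZl _ measurableT i2).
rewrite -/(sqdist_mean k) -/(sqdist_mean k.+1) -/(gap_mean k) /N; lra.
Qed.

Lemma gap_mean_step k : gap_mean k.+1 <= gap_mean k
  + lam k ^+ 2 * (2 * L ^+ 2 * gamma ^+ 2 * gap_mean k + L * gamma ^+ 2 * S).
Proof.
pose y' x := f x - f z + lam k ^+ 2 * (L * gamma ^+ 2 * (2 * L * (f x - f z) + S)).
have cg : continuous (fun x => f x - f z).
  by move=> x; apply: cvgB; [exact: continuous_objective|exact: cvg_cst].
have cy' : continuous y'.
  move=> x; apply: cvgD; first exact: cg.
  apply: cvgMl_tmp; apply: cvgMl_tmp; apply: cvgD; last exact: cvg_cst.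
  by apply: cvgMl_tmp; exact: cg.
have i2 := gap_integrable k.
have i4 := rintegrableZ (2 * L) i2.
have i5 := rintegrableD i4 (rintegrable_cst P S).
have i6 := rintegrableZ (L * gamma ^+ 2) i5.
have i7 := rintegrableZ (lam k ^+ 2) i6.
have iy' : rintegrable P (fun w => y' (X k w)) by exact: rintegrableD.
have /andP[l0 _] := lam_bounds k.
have := iterate_Rintegral_le cg gap_ge0 cy'
  (gap_integrable k.+1) iy' (fun x => step_value_mean ip_norm q_dense L_gt0 F_bregman F_measurable
  F_integrable f_def f_quotient gamma_gt0 x z_min z_moment l0).
rewrite (RintegralD measurableT i2 i7) (RintegralZl _ measurableT i6).
rewrite (RintegralZl _ measurableT i5) (RintegralD measurableT i4 (rintegrable_cst P S)).
rewrite (RintegralZl _ measurableT i2) Rintegral_const.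
rewrite -/(gap_mean k) -/(gap_mean k.+1) => h; apply: (le_trans h).
by rewrite lerD2l; apply: ler_wpM2l; [exact: sqr_ge0|lra].
Qed.

(* AM-GM instead of Cauchy-Schwarz: [2 |g x| <= r + |g x|^2 / r]. *)
Lemma grad_norm_le r x : 0 < r -> `|g x| <= r / 2 + L / r * (f x - f z).
Proof.
move=> r0.
have h := grad_le_gap ip_norm L_gt0 F_bregman F_measurable F_integrable f_def f_quotient x z_min.
have e : 0 <= (`|g x| - r) ^+ 2 by exact: sqr_ge0.
have e2 : 2 * r * `|g x| <= r ^+ 2 + 2 * L * (f x - f z) by lra.
have -> : r / 2 + L / r * (f x - f z) = (2 * r)^-1 * (r ^+ 2 + 2 * L * (f x - f z)).
  by field; rewrite gt_eqF.
by rewrite ler_pdivlMl// mulr_gt0.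
Qed.

Lemma continuous_grad_norm : continuous (fun x => `|g x|).
Proof.
move=> x; apply: cvg_norm; apply/cvgrPdist_lt => eps eps0.
near=> y.
apply: (le_lt_trans (bregman_grad_lipschitz ip_norm L_gt0
 (f_bregman L_gt0 F_bregman F_measurable F_integrable f_def f_quotient) y x)).
rewrite -ltr_pdivlMl// mulrC; near: y; apply: cvgr_dist_lt; first exact: cvg_id.
by rewrite divr_gt0.
Unshelve. all: by end_near. Qed.

Lemma grad_norm_mean_le k r : 0 < r ->
  (\int[P]_w (`|g (X k w)|)%:E <= (r / 2 + L / r * gap_mean k)%:E)%E.
Proof.
move=> r0; have i2 := gap_integrable k.
apply: (le_trans (ge0_integral_le_Rintegral (measurable_X k continuous_grad_norm)
  (fun=> normr_ge0 _) (fun w => grad_norm_le (X k w) r0)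
  (rintegrableD (rintegrable_cst P _) (rintegrableZ _ i2)))).
rewrite lee_fin (RintegralD measurableT (rintegrable_cst P _) (rintegrableZ _ i2)).
by rewrite (RintegralZl _ measurableT i2) Rintegral_const.
Qed.

Definition energy (V : R) : R := `|x0 - z| ^+ 2 + N * V.

(** The constant Q of the deterministic recursions, with l = L/2 and total = [energy V]. *)
Definition drift (V : R) : R :=
  2 * L ^+ 2 * gamma ^+ 2 * (L / 2 * energy V) + L * gamma ^+ 2 * S.

Definition last_rate_const (V kappa tau : R) : R :=
  1 / 2 + L * (energy V / decrease L gamma / kappa + drift V * tau).

Definition random_rate_const (V kappa : R) : R :=
  1 / 2 + L * (energy V / decrease L gamma / (expR (- (2 * V)) * (1 - lbar) * kappa)).

Lemma energy_ge0 V : 0 <= V -> 0 <= energy V.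
Proof. by move=> V0; rewrite addr_ge0 ?sqr_ge0// mulr_ge0// N_ge0. Qed.

Lemma drift_ge0 V : 0 <= V -> 0 <= drift V.
Proof.
move=> V0; have := energy_ge0 V0; have := moment_bound_ge0 => S0 e0.
have L0 := ltW L_gt0; have L2 : 0 <= L / 2 by rewrite divr_ge0.
have g0 := ltW gamma_gt0; by rewrite /drift addr_ge0 ?mulr_ge0.
Qed.

(** The window bounds the gap by c r^2; the inequality |g x| <= r/2 + (L/r) (f x - f z) with this
    same r yields (1/2 + L c) r. *)
Lemma last_rate (K m j : nat) (V kappa tau r : R) : (m + j = K)%N ->
  \sum_(i < K) lam i ^+ 2 <= V -> 0 < kappa -> 0 < r ->
  kappa <= r ^+ 2 * \sum_(i < j) lam (m + i) ->
  \sum_(i < j) lam (m + i) ^+ 2 <= tau * r ^+ 2 ->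
  (\int[P]_w (`|g (X K w)|)%:E <= (last_rate_const V kappa tau * r)%:E)%E.
Proof.
move=> mjK hV kappa0 r0 hkappa htau.
have V0 : 0 <= V by apply: le_trans hV; apply: sumr_ge0 => i _; exact: sqr_ge0.
have lam0 k : 0 <= lam k by have /andP[] := lam_bounds k.
have L2 : 0 <= L / 2 by rewrite divr_ge0// ltW.
have A0 : 0 <= 2 * L ^+ 2 * gamma ^+ 2.
  by have g0 := ltW gamma_gt0; have L0 := ltW L_gt0; rewrite !mulr_ge0.
have := last_gap_le (decrease_gt0 L_gt0 gamma_gt0 gamma_lt) N_ge0 lam0 sqdist_mean_ge0
  gap_mean_ge0 sqdist_mean_step hV gap_mean_le L2 A0 gap_mean_step
  mjK kappa0 (exprn_gt0 2 r0).
rewrite sqdist_mean0 -/(energy V) -/(drift V) => /(_ tau (drift_ge0 V0) hkappa htau) h.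
apply: (le_trans (grad_norm_mean_le K r0)); rewrite lee_fin /last_rate_const.
have r1 : r != 0 by rewrite gt_eqF.
have Lr : 0 <= L / r by rewrite divr_ge0// ltW.
have := ler_wpM2l Lr h.
set c := energy V / decrease L gamma / kappa + drift V * tau.
have -> : L / r * (c * r ^+ 2) = L * c * r by field.
lra.
Qed.

Lemma past_sub_sequence k : <<s past xi k >> `<=`
  <<s \bigcup_i preimage_set_system setT (xi i) measurable >>.
Proof.
pose TS := g_sigma_algebraType (\bigcup_i preimage_set_system setT (xi i) measurable).
apply: smallest_sub; first exact: smallest_sigma_algebra.
move=> E [A mA ->].
apply: (@bigcap_measurableType _ TS) => i _.
apply: sub_sigma_algebra; exists i => //; exists (A i) => //.
by rewrite setTI.
Qed.

(** The event I = k factors out because [h] depends only on samples before k, all of which are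
    independent of the index. *)
Lemma index_independent (I : {RV P >-> nat}) k
    (h : g_sigma_algebraType (past xi k) -> R) :
  independent_of_sequence I xi -> measurable_fun setT h -> (forall w, 0 <= h w) ->
  (\int[P]_w ((I w == k)%:R * h w)%:E = P (I @^-1` [set k]) * \int[P]_w (h w)%:E)%E.
Proof.
move=> indI mh h0.
pose T := g_sigma_algebraType (past xi k).
have mU : measurable_fun [set: Omega] (id : Omega -> T).
  by move=> _ B mB; rewrite setTI; exact: (sigma_past_measurable mB).
pose U : {RV P >-> T} := HB.pack (id : Omega -> T)
  (isMeasurableFun.Build _ _ _ _ _ mU).
have mdelta : measurable_fun [set: nat] (fun n : nat => (n == k)%:R : R) by [].
have mphi : measurable_fun setT (fun p : T * nat => ((p.2 == k)%:R * h p.1)%:E).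
  apply/measurable_EFinP; apply: measurable_funM.
    by apply: (measurableT_comp mdelta); exact: measurable_snd.
  by apply: (measurableT_comp mh); exact: measurable_fst.
have UI (A : set T) (B : set nat) : measurable A -> measurable B ->
    (P (U @^-1` A `&` I @^-1` B) = P (U @^-1` A) * distribution P I B)%E.
  move=> mA mB; rewrite setIC muleC; apply: indI; exact: (past_sub_sequence mA).
rewrite (independent_pair_integral UI mphi); last first.
  by move=> p; rewrite lee_fin mulr_ge0.
have -> : (P (I @^-1` [set k]) = \int[distribution P I]_n ((n == k)%:R)%:E)%E.
  rewrite -[LHS]/(distribution P I [set k]) -[X in distribution P I X]setIT -integral_indic//.
  apply: eq_integral => n _; rewrite indicE.
  rewrite (_ : (n \in [set k]) = (n == k))//.
  by apply/idP/eqP; rewrite inE.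
rewrite muleC -ge0_integralZr//; last 3 first.
- apply/measurable_EFinP; exact: measurable_past_fun mh.
- by move=> w _; rewrite lee_fin.
- by apply: integral_ge0 => n _; rewrite lee_fin.
apply: eq_integral => w _ /=; under eq_integral do rewrite EFinM.
by rewrite ge0_integralZr//; [rewrite muleC|rewrite lee_fin].
Qed.

Lemma index_weight_ge0 k : 0 <= index_weight lam k.
Proof.
have /andP[l0 l1] := lam_bounds k.
rewrite /index_weight mulr_ge0//; last by rewrite subr_ge0 (le_trans l1)// ltW.
rewrite mulr_ge0// /Lambda prodr_ge0// => i _.
by rewrite invr_ge0 addr_ge0// mulr_ge0// sqr_ge0.
Qed.

Lemma index_weight_le k : index_weight lam k <= lam k.
Proof.
have /andP[l0 l1] := lam_bounds k.
have lb : lam k <= 1 by apply: (le_trans l1); exact: ltW.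
have Lam01 : 0 <= Lambda lam k.+1 <= 1.
  rewrite /Lambda; apply/andP; split.
    by apply: prodr_ge0 => i _; rewrite invr_ge0 addr_ge0// mulr_ge0// sqr_ge0.
  apply: (@le_trans _ _ (\prod_(i < k.+1) (1 : R))); last by rewrite big1.
  apply: ler_prod => i _.
  have i1 : 1 <= 1 + 2 * lam i ^+ 2 by rewrite lerDl mulr_ge0// sqr_ge0.
  by rewrite invr_ge0 (le_trans ler01 i1)/= invf_le1// (lt_le_trans ltr01 i1).
rewrite /index_weight; have /andP[a0 a1] := Lam01.
apply: (@le_trans _ _ (Lambda lam k.+1 * lam k)).
  by rewrite ler_piMr ?mulr_ge0// gerBl.
by rewrite ler_piMl.
Qed.

(** From 1 + x <= exp x, the product [Lambda] is at least exp(-2 sum lam^2); with [index_weight_le],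
    the weights are thus comparable to lam. *)
Lemma index_weight_lower K V k : \sum_(i < K) lam i ^+ 2 <= V -> (k < K)%N ->
  expR (- (2 * V)) * (1 - lbar) * lam k <= index_weight lam k.
Proof.
move=> hV kK; have /andP[l0 l1] := lam_bounds k.
have LamV : expR (- (2 * V)) <= Lambda lam k.+1.
  apply: (@le_trans _ _ (expR (- (2 * \sum_(i < k.+1) lam i ^+ 2)))).
    rewrite ler_expR lerN2 ler_pM2l//; apply: le_trans hV.
    rewrite -(subnKC kK) big_split_ord /= lerDl.
    by apply: sumr_ge0 => i _; exact: sqr_ge0.
  rewrite mulr_sumr -sumrN expR_sum /Lambda; apply: ler_prod => i _.
  rewrite expR_ge0 /= expRN lef_pV2 ?posrE ?expR_gt0//.
    by rewrite expR_ge1Dx.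
  by rewrite ltr_wpDr// mulr_ge0// sqr_ge0.
rewrite /index_weight.
have lb1 : 0 <= 1 - lbar by rewrite subr_ge0 ltW.
have e1 : (1 - lbar) <= 1 - lam k by rewrite lerD2l lerN2.
rewrite -mulrA [X in _ <= X]mulrAC -[X in _ <= X]mulrA mulrA.
rewrite [leRHS]mulrA; apply: ler_wpM2r => //.
by apply: ler_pM => //; exact: expR_ge0.
Qed.

Lemma random_rate (K : nat) (V kappa r : R) (I : {RV P >-> nat}) :
  random_index lam K xi I ->
  \sum_(i < K) lam i ^+ 2 <= V -> 0 < kappa -> 0 < r ->
  kappa <= r ^+ 2 * \sum_(i < K) lam i ->
  (\int[P]_w (`|g (X (I w) w)|)%:E <= (random_rate_const V kappa * r)%:E)%E.
Proof.
move=> [IK PI indI] hV kappa0 r0 hkappa.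
have lam0 k : 0 <= lam k by have /andP[] := lam_bounds k.
pose W := \sum_(k < K) index_weight lam k.
pose c := expR (- (2 * V)) * (1 - lbar).
have c0 : 0 < c by rewrite mulr_gt0 ?expR_gt0// subr_gt0.
have Wge : c * \sum_(k < K) lam k <= W.
  by rewrite mulr_sumr; apply: ler_sum => i _; exact: (index_weight_lower hV (ltn_ord i)).
have sl0 : 0 < \sum_(k < K) lam k.
  by have := lt_le_trans kappa0 hkappa; rewrite pmulr_rgt0// exprn_gt0.
have W0 : 0 < W by apply: lt_le_trans Wge; rewrite mulr_gt0.
pose h k (w : Omega) := `|g (X k w)|.
have mh k : measurable_fun setT (h k : g_sigma_algebraType (past xi k) -> R).
  exact: (measurable_iterate_comp q_dense measurable_step
    (fun k => @continuous_step (lam k)) X0 XS continuous_grad_norm).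
(* Splitting over the values of the index reduces the randomly indexed iterate to deterministic
   indices. *)
have -> : (\int[P]_w (`|g (X (I w) w)|)%:E =
    \int[P]_w \sum_(k < K) ((I w == k)%:R * h k w)%:E)%E.
  apply: eq_integral => w _; rewrite sumEFin; congr (_%:E).
  rewrite (bigD1 (Ordinal (IK w)))//= eqxx mul1r big1 ?addr0// => i iI.
  rewrite (_ : (I w == i) = false) ?mul0r//.
  by apply: contraNF iI => /eqP e; apply/eqP/val_inj.
rewrite ge0_integral_sum//; last 2 first.
- move=> k; apply/measurable_EFinP; apply: measurable_funM.
    by apply: (measurableT_comp (f := fun n : nat => (n == k)%:R : R)).
  by apply: measurable_past_fun (mh k).
- by move=> k w _; rewrite lee_fin mulr_ge0// normr_ge0.
apply: (@le_trans _ _ (\sum_(k < K) (index_weight lam k / W * (r / 2 + L / r * gap_mean k))%:E)%E).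
  apply: lee_sum => k _; rewrite index_independent// ?PI// ?EFinM;
    last by move=> w; exact: normr_ge0.
  apply: lee_wpmul2l; first by rewrite lee_fin divr_ge0 ?index_weight_ge0// ltW.
  exact: grad_norm_mean_le.
rewrite sumEFin lee_fin.
have -> : \sum_(k < K) index_weight lam k / W * (r / 2 + L / r * gap_mean k) =
    r / 2 + L / r * (W^-1 * \sum_(k < K) index_weight lam k * gap_mean k).
  under eq_bigr do rewrite mulrDr.
  rewrite big_split /= -mulr_suml -mulr_suml -/W divff ?gt_eqF// mul1r.
  congr (_ + _); rewrite !mulr_sumr; apply: eq_bigr => i _; ring.
have sg : \sum_(k < K) index_weight lam k * gap_mean k <= energy V / decrease L gamma.
  have := sum_gap_le (decrease_gt0 L_gt0 gamma_gt0 gamma_lt) N_ge0 sqdist_mean_ge0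
    sqdist_mean_step hV (leqnn K).
  rewrite sqdist_mean0; apply: le_trans; apply: ler_sum => i _.
  by rewrite ler_wpM2r ?gap_mean_ge0// index_weight_le.
have sg0 : 0 <= \sum_(k < K) index_weight lam k * gap_mean k.
  by apply: sumr_ge0 => i _; rewrite mulr_ge0 ?gap_mean_ge0// index_weight_ge0.
have Winv : W^-1 <= r ^+ 2 / (c * kappa).
  have ck0 : 0 < c * kappa by exact: mulr_gt0.
  rewrite (ler_pdivlMr _ _ ck0) mulrC (ler_pdivrMr _ _ W0).
  apply: (@le_trans _ _ (r ^+ 2 * (c * \sum_(k < K) lam k))).
    by rewrite mulrCA ler_pM2l.
  by rewrite ler_wpM2l// sqr_ge0.
have hfin : W^-1 * \sum_(k < K) index_weight lam k * gap_mean k <=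
    r ^+ 2 / (c * kappa) * (energy V / decrease L gamma).
  by apply: ler_pM => //; rewrite invr_ge0 ltW.
have Lr : 0 <= L / r by rewrite divr_ge0// ltW.
have := ler_wpM2l Lr hfin; rewrite /random_rate_const -/c.
have -> : L / r * (r ^+ 2 / (c * kappa) * (energy V / decrease L gamma)) =
   L * (energy V / decrease L gamma / (c * kappa)) * r.
  have dec0 := decrease_gt0 L_gt0 gamma_gt0 gamma_lt.
  by field; rewrite !gt_eqF.
lra.
Qed.

(** * Almost sure limits relative to one minimizer *)

Section almost_sure.
Variable V : R.
Hypothesis sum_lam2 : forall n, \sum_(i < n) lam i ^+ 2 <= V.
Hypothesis sum_lam_unbounded : forall M, exists n, M <= \sum_(i < n) lam i.

Lemma ae_sqdist_cvg : {ae P, forall w, cvgn (fun k => `|X k w - z| ^+ 2)}.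
Proof.
apply: (@lyapunov_cvg _ _ _ q_dense _ _ _ _ _ _ _ xi_iid _ measurable_step
  (fun k => @continuous_step (lam k)) _ _ X0 XS (fun x => `|x - z| ^+ 2)
  (fun k => N * lam k ^+ 2) (N * V)).
- exact: continuous_sqdist.
- by move=> x; exact: sqr_ge0.
- by move=> i; rewrite mulr_ge0 ?N_ge0 ?sqr_ge0.
- by move=> n; rewrite -mulr_sumr ler_wpM2l ?N_ge0.
- exact: sqdist_lyapunov.
Qed.

Lemma ae_value_is_cvg : {ae P, forall w, cvgn (fun k => f (X k w) - f z)}.
Proof.
(* The smallest multiple allowed by [step_potential_mean]. The potential and the squared distance
   both converge, hence so does their combination f x_k - f z. *)
pose M := 2 * L ^+ 2 * gamma ^+ 2 / decrease L gamma.
have dec0 := decrease_gt0 L_gt0 gamma_gt0 gamma_lt.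
have L0 := ltW L_gt0; have g0 := ltW gamma_gt0.
have M0 : 0 <= M by rewrite divr_ge0 ?(ltW dec0)// !mulr_ge0.
have Mdec : 2 * L ^+ 2 * gamma ^+ 2 <= M * decrease L gamma.
  by rewrite /M mulfVK// gt_eqF.
pose c := L * gamma ^+ 2 * S + M * noise gamma lbar * S.
have c0 : 0 <= c.
  have n0 := noise_ge0 gamma lbar_lt1; have S0 := moment_bound_ge0.
  by apply: addr_ge0; apply: mulr_ge0 => //; apply: mulr_ge0 => //; exact: sqr_ge0.
have cy : continuous (fun x => (f x - f z) + M * `|x - z| ^+ 2).
  move=> x; apply: cvgD; last by apply: cvgMl_tmp; exact: continuous_sqdist.
  by apply: cvgB; [exact: continuous_objective|exact: cvg_cst].
have pot : {ae P, forall w, cvgn (fun k => (f (X k w) - f z) + M * `|X k w - z| ^+ 2)}.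
  apply: (@lyapunov_cvg _ _ _ q_dense _ _ _ _ _ _ _ xi_iid _ measurable_step
    (fun k => @continuous_step (lam k)) _ _ X0 XS
    (fun x => (f x - f z) + M * `|x - z| ^+ 2)
    (fun k => c * lam k ^+ 2) (c * V)) => //.
  - by move=> x; rewrite addr_ge0 ?gap_ge0// mulr_ge0// sqr_ge0.
  - by move=> i; rewrite mulr_ge0 ?sqr_ge0.
  - by move=> n; rewrite -mulr_sumr ler_wpM2l.
  - move=> k x.
    exact: (step_potential_mean ip_norm q_dense L_gt0 F_bregman F_measurable F_integrable
      f_def f_quotient gamma_gt0 lbar_gt0 lbar_lt1 x z_min z_moment (lam_bounds k) Mdec M0).
apply: filterS2 pot ae_sqdist_cvg => w h1 h2.
rewrite (_ : (fun k => f (X k w) - f z) = (fun k => ((f (X k w) - f z) +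
   M * `|X k w - z| ^+ 2) - M * `|X k w - z| ^+ 2)).
  by apply: is_cvgB => //; apply: is_cvgMl_tmp.
by apply/funext => k; ring.
Qed.

(** The partial sums have uniformly bounded means, so by monotone convergence the series is
    integrable and therefore almost surely finite. *)
Lemma ae_gap_series : {ae P, forall w, exists B, forall n,
  \sum_(k < n) lam k * (f (X k w) - f z) <= B}.
Proof.
have lam0 k : 0 <= lam k by have /andP[] := lam_bounds k.
pose u k w := (lam k * (f (X k w) - f z))%:E.
have u0 k w : (0 <= u k w)%E by rewrite lee_fin mulr_ge0// gap_ge0.
have iu k : rintegrable P (fun w => lam k * (f (X k w) - f z)).
  by apply: rintegrableZ; exact: gap_integrable.
have mu k : measurable_fun setT (u k) by exact: measurable_int (iu k).
pose T w := (\sum_(0 <= k <oo) u k w)%E.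
have T0 w : (0 <= T w)%E by apply: nneseries_ge0 => k _ _.
have mT : measurable_fun setT T by apply: ge0_emeasurable_sum.
have iT : (\int[P]_w T w <= (energy V / decrease L gamma)%:E)%E.
  rewrite integral_nneseries//.
  apply: lime_le; first by apply: is_cvg_nneseries => k _ _; exact: integral_ge0.
  apply: nearW => n; rewrite big_mkord.
  under eq_bigr do rewrite EFin_Rintegral//.
  rewrite sumEFin lee_fin.
  have := sum_gap_le (decrease_gt0 L_gt0 gamma_gt0 gamma_lt) N_ge0 sqdist_mean_ge0
    sqdist_mean_step (sum_lam2 n) (leqnn n).
  rewrite sqdist_mean0; apply: le_trans; apply: ler_sum => i _.
  by rewrite (RintegralZl _ measurableT (gap_integrable i)).
have inT : P.-integrable setT T.
  apply/integrableP; split => //; apply: le_lt_trans (ltry (energy V / decrease L gamma)).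
  by apply: le_trans iT; under eq_integral do rewrite gee0_abs//.
apply: filterS (integrable_ae measurableT inT) => w /(_ I) fT.
exists (fine (T w)) => n; rewrite -lee_fin fineK// -sumEFin -(big_mkord xpredT (u^~ w)).
by apply: nneseries_lim_ge => k _ _.
Qed.

Lemma ae_value_cvg : {ae P, forall w, f (X k w) @[k --> \oo] --> f z}.
Proof.
have lam0 k : 0 <= lam k by have /andP[] := lam_bounds k.
apply: filterS2 ae_value_is_cvg ae_gap_series => w ca [B hB].
suff l0 : limn (fun k => f (X k w) - f z) = 0.
  have h : f (X k w) - f z @[k --> \oo] --> 0 by rewrite -l0.
  rewrite (_ : (fun k => f (X k w)) = (fun k => (f (X k w) - f z) + f z)); last first.
    by apply/funext => k; rewrite subrK.
  by rewrite -[X in _ --> X]add0r; apply: cvgD => //; exact: cvg_cst.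
set l := limn _.
have lge0 : 0 <= l by apply: limr_ge => //; apply: nearW => k; exact: gap_ge0.
apply/eqP; rewrite eq_le lge0 andbT leNgt; apply/negP => lpos.
have l2 : 0 < l / 2 by rewrite divr_gt0.
have /cvgrPdist_lt/(_ _ l2) [m _ hm] := ca.
(* From m on the gap exceeds l/2, so a further step-size mass 2 (B + 1)/l pushes the weighted sum to
   B + 1, beyond its bound B. *)
have [n hn] := sum_lam_unbounded (\sum_(i < m) lam i + 2 * (B + 1) / l).
have mn : (m <= n)%N.
  rewrite leqNgt; apply/negP => /ltnW nm.
  have B0 : 0 <= B by have := hB 0%N; rewrite big_ord0.
  have : \sum_(i < n) lam i <= \sum_(i < m) lam i.
    rewrite -(subnKC nm) big_split_ord /= lerDl; exact: sumr_ge0.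
  have : 0 < 2 * (B + 1) / l by rewrite divr_gt0// mulr_gt0// ltr_wpDl.
  lra.
have := hB n; move: hn; rewrite -(subnKC mn) !big_split_ord /= => hn h.
have h1 : 0 <= \sum_(i < m) lam i * (f (X i w) - f z).
  by apply: sumr_ge0 => i _; rewrite mulr_ge0// gap_ge0.
have h2 : l / 2 * \sum_(i < n - m) lam (m + i)%N <=
    \sum_(i < n - m) lam (m + i)%N * (f (X (m + i)%N w) - f z).
  rewrite mulr_sumr; apply: ler_sum => i _; rewrite mulrC ler_wpM2l//.
  have := hm (m + i)%N (leq_addr _ _); rewrite -/l => /(le_lt_trans (ler_norm _)).
  lra.
have h3 : 2 * (B + 1) / l <= \sum_(i < n - m) lam (m + i)%N by lra.
have : l / 2 * (2 * (B + 1) / l) <= l / 2 * \sum_(i < n - m) lam (m + i)%N.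
  by rewrite ler_pM2l.
have -> : l / 2 * (2 * (B + 1) / l) = B + 1 by field; rewrite gt_eqF.
lra.
Qed.

End almost_sure.

End sgd_moments.

(** * Step-size schedules *)

Section schedules.
Context {R : realType}.

Lemma powR_exprn (a x : R) n : 0 <= a -> (a `^ x) ^+ n = a `^ (x * n%:R).
Proof. by move=> a0; rewrite powRrM powR_mulrn// powR_ge0. Qed.

Lemma powRN_le1 (a x : R) : 1 <= a -> 0 <= x -> a `^ (- x) <= 1.
Proof. by move=> a1 x0; rewrite -[leRHS](powRr0 a) ler_powR// oppr_le0. Qed.

Lemma powRN_anti (a b x : R) : 0 < a -> a <= b -> 0 <= x -> b `^ (- x) <= a `^ (- x).
Proof.
move=> a0 ab x0; have b0 := lt_le_trans a0 ab.
rewrite !powRN lef_pV2 ?posrE ?powR_gt0//.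
by apply: ge0_ler_powR; rewrite ?nnegrE ?(ltW a0) ?(ltW b0).
Qed.

Lemma sum_ge_const (h : nat -> R) j c : (forall i, (i < j)%N -> c <= h i) ->
  j%:R * c <= \sum_(i < j) h i.
Proof.
move=> hc; rewrite mulr_natl -[X in _ *+ X]card_ord -sumr_const.
by apply: ler_sum => i _; exact: hc.
Qed.

Lemma sum_le_const (h : nat -> R) j c : (forall i, (i < j)%N -> h i <= c) ->
  \sum_(i < j) h i <= j%:R * c.
Proof.
move=> hc; rewrite mulr_natl -[X in _ *+ X]card_ord -sumr_const.
by apply: ler_sum => i _; exact: hc.
Qed.

Lemma sum_const (j : nat) (c : R) : \sum_(i < j) c = j%:R * c.
Proof. by rewrite sumr_const card_ord mulr_natl. Qed.

Variable lbar : R.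
Hypothesis lbar_gt0 : 0 < lbar.
Hypothesis lbar_lt1 : lbar < 1.

Let lbar2 : lbar ^+ 2 <= 1.
Proof. by rewrite expr_le1 ?ltW. Qed.

Section constant_horizon.
Variables (K : nat) (p : nat).
Hypothesis K_gt0 : (0 < K)%N.
Hypothesis p_gt0 : (0 < p)%N.

Let t : R := K%:R `^ (- (1 / p%:R)).

Lemma root_gt0 : 0 < t. Proof. by rewrite powR_gt0// ltr0n. Qed.

Lemma root_le1 : t <= 1.
Proof. by rewrite powRN_le1 ?divr_ge0// ler1n. Qed.

(** Expresses fractional powers of K through an integer power of one root, so that the later rate
    computations become polynomial identities. *)
Lemma root_exprp : K%:R * t ^+ p = 1.
Proof.
rewrite /t powR_exprn// mulNr divfK ?pnatr_eq0 -?lt0n//.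
by rewrite powR_inv1// divff// pnatr_eq0 -lt0n.
Qed.

End constant_horizon.

Definition sched_sqrt (K k : nat) : R := lbar * K%:R `^ (- (1 / 2)).

Definition sched_sqrt_log (k : nat) : R :=
  lbar * k.+1%:R `^ (- (1 / 2)) * (ln (k%:R + expR 1))^-1.

Definition sched_twothirds (K k : nat) : R := lbar * K%:R `^ (- (2 / 3)).

Definition sched_twothirds_inc (k : nat) : R := lbar * k.+1%:R `^ (- (2 / 3)).

Lemma mul_le_lbar x : 0 <= x <= 1 -> 0 <= lbar * x <= lbar.
Proof. by move=> /andP[x0 x1]; rewrite mulr_ge0 ?(ltW lbar_gt0)//= ler_piMr// ltW. Qed.

Lemma sched_sqrt_bounds K k : (0 < K)%N -> 0 <= sched_sqrt K k <= lbar.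
Proof.
by move=> K0; apply: mul_le_lbar; rewrite powR_ge0 powRN_le1 ?ler1n// divr_ge0.
Qed.

Lemma sched_twothirds_bounds K k : (0 < K)%N -> 0 <= sched_twothirds K k <= lbar.
Proof.
by move=> K0; apply: mul_le_lbar; rewrite powR_ge0 powRN_le1 ?ler1n// divr_ge0.
Qed.

Lemma sched_twothirds_inc_bounds k : 0 <= sched_twothirds_inc k <= lbar.
Proof. by apply: mul_le_lbar; rewrite powR_ge0 powRN_le1 ?ler1n// divr_ge0. Qed.

Let expR1_gt1 : (1 : R) < expR 1. Proof. by rewrite expR_gt1. Qed.

Lemma log_ge1 (k : nat) : (1 : R) <= ln (k%:R + expR 1).
Proof.
by rewrite -[leLHS](expRK 1) ler_ln ?posrE ?expR_gt0 ?lerDr ?ltr_wpDl ?expR_gt0.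
Qed.

Lemma log_mono (i j : nat) : (i <= j)%N ->
  ln (i%:R + expR 1) <= ln (j%:R + expR 1) :> R.
Proof.
move=> ij; rewrite ler_ln ?posrE ?ltr_wpDl ?expR_gt0//.
by rewrite lerD2r ler_nat.
Qed.

Lemma sched_sqrt_log_bounds k : 0 <= sched_sqrt_log k <= lbar.
Proof.
rewrite /sched_sqrt_log -mulrA; apply: mul_le_lbar.
have l1 := log_ge1 k; have l0 : (0 : R) < ln (k%:R + expR 1) by rewrite (lt_le_trans ltr01).
rewrite mulr_ge0 ?powR_ge0 ?invr_ge0 ?(ltW l0)//=.
by rewrite mulr_ile1 ?powR_ge0 ?invr_ge0 ?(ltW l0)// ?invf_le1// powRN_le1 ?ler1n// divr_ge0.
Qed.

Lemma sched_sqrt_window K : (0 < K)%N -> let r := K%:R `^ (- (1 / 4)) in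
  [/\ \sum_(i < K) sched_sqrt K i ^+ 2 <= 1, 0 < r &
      lbar <= r ^+ 2 * \sum_(i < K) sched_sqrt K i].
Proof.
move=> K0 r; have r0 : 0 < r by exact: root_gt0.
have r4 : K%:R * r ^+ 4 = 1 by exact: root_exprp.
have r2 : K%:R `^ (- (1 / 2)) = r ^+ 2.
  by rewrite /r powR_exprn//; congr (_ `^ _); field.
rewrite /sched_sqrt r2 !sum_const; split => //.
  have -> : K%:R * (lbar * r ^+ 2) ^+ 2 = lbar ^+ 2 * (K%:R * r ^+ 4) by ring.
  by rewrite r4 mulr1.
have -> : r ^+ 2 * (K%:R * (lbar * r ^+ 2)) = lbar * (K%:R * r ^+ 4) by ring.
by rewrite r4 mulr1.
Qed.

(** Here lam = lbar r^4 and K r^6 = 1, so both r^2 sum lam and r^(-2) sum lam^2 are of order 1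
    already over the full horizon. *)
Lemma sched_twothirds_window K : (0 < K)%N -> let r := K%:R `^ (- (1 / 6)) in
  [/\ \sum_(i < K) sched_twothirds K i ^+ 2 <= 1, 0 < r,
      lbar <= r ^+ 2 * \sum_(i < K) sched_twothirds K i &
      \sum_(i < K) sched_twothirds K i ^+ 2 <= 1 * r ^+ 2].
Proof.
move=> K0 r; have r0 : 0 < r by exact: root_gt0.
have r1 : r <= 1 by exact: root_le1.
have r6 : K%:R * r ^+ 6 = 1 by exact: root_exprp.
have r4 : K%:R `^ (- (2 / 3)) = r ^+ 4.
  by rewrite /r powR_exprn//; congr (_ `^ _); field.
have rr1 : r ^+ 2 <= 1 by rewrite expr_le1// ltW.
have E : K%:R * (lbar * r ^+ 4) ^+ 2 <= 1 * r ^+ 2.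
  have -> : K%:R * (lbar * r ^+ 4) ^+ 2 = lbar ^+ 2 * r ^+ 2 * (K%:R * r ^+ 6) by ring.
  by rewrite r6 mulr1 ler_wpM2r// sqr_ge0.
rewrite /sched_twothirds r4 !sum_const; split => //.
  by apply: (le_trans E); rewrite mul1r.
have -> : r ^+ 2 * (K%:R * (lbar * r ^+ 4)) = lbar * (K%:R * r ^+ 6) by ring.
by rewrite r6 mulr1.
Qed.

Let u (k : nat) : R := k.+1%:R `^ (- (1 / 3)).

Let u_gt0 k : 0 < u k. Proof. exact: (root_gt0 (K := k.+1)). Qed.
Let u3 k : k.+1%:R * u k ^+ 3 = 1. Proof. exact: (root_exprp (K := k.+1)). Qed.
Let u_anti i j : (i <= j)%N -> u j <= u i.
Proof. by move=> ij; rewrite powRN_anti ?ltr0n// ?ler_nat ?divr_ge0. Qed.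
Let inc_uE k : sched_twothirds_inc k = lbar * u k ^+ 2.
Proof. by rewrite /u powR_exprn//; congr (_ * _ `^ _); field. Qed.

(** With u_k = (k+1)^(-1/3), telescoping u_{k+1}^4 <= 3 (u_k - u_{k+1}) contributes 3 and the first
    term 1. *)
Lemma sched_twothirds_inc_sum2 n : \sum_(i < n) sched_twothirds_inc i ^+ 2 <= 4.
Proof.
case: n => [|n]; first by rewrite big_ord0.
suff : \sum_(i < n.+1) sched_twothirds_inc i ^+ 2 <= 4 - 3 * u n.
  by have := u_gt0 n; lra.
have sq k : sched_twothirds_inc k ^+ 2 <= u k ^+ 4.
  rewrite inc_uE exprMn -exprM ler_piMl// exprn_ge0// ltW//.
elim: n => [|n IH].
  rewrite big_ord1; apply: (le_trans (sq _)).
  by rewrite /u powR1 expr1n; lra.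
rewrite big_ord_recr /=; have := sq n.+1; suff : u n.+1 ^+ 4 <= 3 * (u n - u n.+1) by lra.
have := u3 n; have := u3 n.+1; have := u_anti (leqnSn n).
have := u_gt0 n; have := u_gt0 n.+1; rewrite -[n.+2%:R]natr1.
move: (u n) (u n.+1) (n.+1%:R : R) => x y a y0 x0 yx hy hx.
(* The reciprocals of x^3 and y^3 are the consecutive integers a and a + 1. *)
have hxy : x ^+ 3 - y ^+ 3 = x ^+ 3 * y ^+ 3.
  have -> : x ^+ 3 - y ^+ 3 = x ^+ 3 * ((a + 1) * y ^+ 3) - y ^+ 3 * (a * x ^+ 3).
    by rewrite hy hx; ring.
  ring.
have h1 : x ^+ 3 * y ^+ 3 <= 3 * x ^+ 2 * (x - y).
  rewrite -hxy; have -> : x ^+ 3 - y ^+ 3 = (x - y) * (x ^+ 2 + x * y + y ^+ 2) by ring.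
  rewrite [leRHS]mulrC ler_wpM2l ?subr_ge0//.
  have : x * y <= x ^+ 2 by rewrite expr2 ler_pM2l.
  have : y ^+ 2 <= x ^+ 2 by rewrite ler_pXn2r ?nnegrE ?(ltW x0) ?(ltW y0).
  lra.
have h2 : x * y ^+ 3 <= 3 * (x - y).
  rewrite -(ler_pM2l (exprn_gt0 2 x0)); apply: le_trans (_ : _ <= 3 * x ^+ 2 * (x - y)) _.
    by have -> : x ^+ 2 * (x * y ^+ 3) = x ^+ 3 * y ^+ 3 by ring.
  by rewrite le_eqVlt; apply/orP; left; apply/eqP; ring.
apply: le_trans h2; have -> : y ^+ 4 = y * y ^+ 3 by ring.
by rewrite ler_wpM2r// exprn_ge0// ltW.
Qed.

(** Over the full horizon sum lam^2 is only of order 1. The second half discards the large early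
    steps: there lam is of order K^(-2/3), so sum lam^2 is of order K^(-1/3) = r^2 while sum lam
    keeps its order K^(1/3). *)
Lemma sched_twothirds_inc_window K : (0 < K)%N ->
  let r := K%:R `^ (- (1 / 6)) in let m := (K./2)%N in let j := (K - m)%N in
  [/\ 0 < r, lbar / 2 <= r ^+ 2 * \sum_(i < j) sched_twothirds_inc (m + i) &
      \sum_(i < j) sched_twothirds_inc (m + i) ^+ 2 <= 4 * r ^+ 2].
Proof.
move=> K0 r m j; have r0 : 0 < r by exact: root_gt0.
have r6 : K%:R * r ^+ 6 = 1 by exact: root_exprp.
have uK : u K.-1 = r ^+ 2.
  by rewrite /u prednK// /r powR_exprn//; congr (_ `^ _); field.
have mK : (m <= K)%N by rewrite /m -divn2 leq_div.
have mj : (m + j = K)%N by rewrite subnKC.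
have m2 : (m.*2 <= K)%N by rewrite -[leqRHS]odd_double_half leq_addl.
have j2 : (K <= j.*2)%N.
  by rewrite /j doubleB leq_subRL; [rewrite -[K.*2]addnn leq_add2r|rewrite leq_double].
have hj : K%:R / 2 <= j%:R :> R.
  by rewrite ler_pdivrMr// -natrM ler_nat muln2.
have hm : K%:R / 2 <= m.+1%:R :> R.
  rewrite ler_pdivrMr// -natrM ler_nat muln2 -[X in (X <= _)%N]odd_double_half doubleS.
  by case: odd => /=; rewrite ?add0n ?add1n ltnW.
split => //.
- apply: (@le_trans _ _ (r ^+ 2 * (j%:R * (lbar * (r ^+ 2) ^+ 2)))).
    have -> : r ^+ 2 * (j%:R * (lbar * (r ^+ 2) ^+ 2)) = lbar * r ^+ 6 * j%:R by ring.
    apply: (@le_trans _ _ (lbar * r ^+ 6 * (K%:R / 2))).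
      have -> : lbar * r ^+ 6 * (K%:R / 2) = lbar / 2 * (K%:R * r ^+ 6) by ring.
      by rewrite r6 mulr1.
    by rewrite ler_wpM2l// mulr_ge0 ?exprn_ge0// ltW.
  rewrite ler_wpM2l ?sqr_ge0//; apply: (sum_ge_const (h := fun i => sched_twothirds_inc (m + i))).
  move=> i ij; rewrite inc_uE ler_wpM2l ?(ltW lbar_gt0)// -uK ler_pXn2r ?nnegrE ?(ltW (u_gt0 _))//.
  by apply: u_anti; rewrite -ltnS prednK// -mj ltn_add2l.
- apply: (@le_trans _ _ (j%:R * (u m ^+ 4))).
    apply: (sum_le_const (h := fun i => sched_twothirds_inc (m + i) ^+ 2)) => i ij.
    rewrite inc_uE exprMn -exprM; apply: (@le_trans _ _ (u (m + i) ^+ 4)).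
      by rewrite ler_piMl// exprn_ge0// ltW.
    by rewrite ler_pXn2r ?nnegrE ?(ltW (u_gt0 _))// u_anti// leq_addr.
  have um3 : u m ^+ 3 <= 2 * r ^+ 6.
    rewrite -(@ler_pM2l _ m.+1%:R)// u3.
    have := ler_wpM2r (_ : 0 <= 2 * r ^+ 6) hm; rewrite mulr_ge0 ?exprn_ge0 ?(ltW r0)//.
    move=> /(_ isT); apply: le_trans.
    have -> : K%:R / 2 * (2 * r ^+ 6) = K%:R * r ^+ 6 by field.
    by rewrite r6.
  (* Cube root of the preceding bound, with 2 enlarged to 8 to stay among integer powers. *)
  have um1 : u m <= 2 * r ^+ 2.
    have r20 : 0 <= 2 * r ^+ 2 by rewrite mulr_ge0// sqr_ge0.
    rewrite -(@ler_pXn2r _ 3) ?nnegrE ?(ltW (u_gt0 _))//; apply: (le_trans um3).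
     have -> : (2 * r ^+ 2) ^+ 3 = 8 * r ^+ 6 by ring.
    by rewrite ler_wpM2r ?exprn_ge0 ?(ltW r0)// ler_nat.
  have um4 : u m ^+ 4 <= (2 * r ^+ 6) * (2 * r ^+ 2).
    have -> : u m ^+ 4 = u m ^+ 3 * u m by ring.
    by apply: (ler_pM _ _ um3 um1); [rewrite exprn_ge0// ltW|rewrite ltW].
  apply: (@le_trans _ _ (K%:R * ((2 * r ^+ 6) * (2 * r ^+ 2)))).
    apply: (ler_pM _ _ _ um4); rewrite ?ler0n//; first by rewrite exprn_ge0// ltW.
    by rewrite ler_nat leq_subr.
  have -> : K%:R * (2 * r ^+ 6 * (2 * r ^+ 2)) = 4 * r ^+ 2 * (K%:R * r ^+ 6) by ring.
  by rewrite r6 mulr1.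
Qed.

(** For n = (m+1)^3 each of the n terms is at least the last one, lbar/(m+1)^2, and the sum is at
    least lbar (m+1). *)
Lemma sched_twothirds_inc_diverges M : exists n, M <= \sum_(i < n) sched_twothirds_inc i.
Proof.
pose m := Num.bound (M / lbar); exists (m.+1 ^ 3)%N.
have mM : M <= lbar * m.+1%:R.
  rewrite -ler_pdivrMl// mulrC.
  have [M0|M0] := lerP 0 (M / lbar).
    by apply: (le_trans (ltW (archi_boundP M0))); rewrite ler_nat.
  by rewrite (le_trans (ltW M0)).
apply: (le_trans mM).
set n := (m.+1 ^ 3)%N.
have n0 : (0 < n)%N by rewrite expn_gt0.
have un : u n.-1 = m.+1%:R^-1.
  have h := u3 n.-1; rewrite prednK// natrX in h.
  have mn0 : m.+1%:R != 0 :> R by rewrite pnatr_eq0.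
  have : (m.+1%:R * u n.-1) ^+ 3 = 1 by rewrite exprMn.
  move/eqP; rewrite pexpr_eq1 ?mulr_ge0 ?(ltW (u_gt0 _))// => /eqP e.
  by apply: (mulfI mn0); rewrite e divff.
apply: (@le_trans _ _ (n%:R * (lbar * u n.-1 ^+ 2))).
  have : m.+1%:R != 0 :> R by rewrite pnatr_eq0.
  rewrite un natrX; move: (m.+1%:R : R) => a a0.
  by rewrite le_eqVlt; apply/orP; left; apply/eqP; field.
apply: sum_ge_const => i ik.
rewrite inc_uE ler_wpM2l ?(ltW lbar_gt0)// ler_pXn2r ?nnegrE ?(ltW (u_gt0 _))//.
by apply: u_anti; rewrite -ltnS prednK.
Qed.

Let v (k : nat) : R := k.+1%:R `^ (- (1 / 2)).
Let v_gt0 k : 0 < v k. Proof. exact: (root_gt0 (K := k.+1)). Qed.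
Let v2 k : k.+1%:R * v k ^+ 2 = 1. Proof. exact: (root_exprp (K := k.+1)). Qed.
Let v_anti i j : (i <= j)%N -> v j <= v i.
Proof. by move=> ij; rewrite powRN_anti ?ltr0n// ?ler_nat ?divr_ge0. Qed.
Let l (k : nat) : R := ln (k%:R + expR 1).
Let l_ge1 k : 1 <= l k. Proof. exact: log_ge1. Qed.
Let l_gt0 k : 0 < l k. Proof. exact: lt_le_trans ltr01 (l_ge1 k). Qed.

(* [1 / ((k+1) (ln (k+e))^2)] is dominated by the telescoping difference of
   [e / ln (k+e)], since [ln (k+e) - ln (k-1+e) >= 1 / (k+e)]. *)
Lemma sched_sqrt_log_sum2 n : \sum_(i < n) sched_sqrt_log i ^+ 2 <= 1 + expR 1.
Proof.
case: n => [|n]; first by rewrite big_ord0 addr_ge0// expR_ge0.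
suff : \sum_(i < n.+1) sched_sqrt_log i ^+ 2 <= 1 + expR 1 - expR 1 * (l n)^-1.
  have : 0 <= expR 1 * (l n)^-1 by rewrite mulr_ge0 ?expR_ge0// invr_ge0 ltW.
  lra.
have e0 : (0 : R) < expR 1 by exact: expR_gt0.
have sq k : sched_sqrt_log k ^+ 2 <= v k ^+ 2 * (l k)^-1 ^+ 2.
  rewrite /sched_sqrt_log -/(v k) -/(l k) !exprMn -mulrA ler_piMl//.
  by rewrite mulr_ge0 ?sqr_ge0.
elim: n => [|n IH].
  rewrite big_ord1; apply: (le_trans (sq _)).
  by rewrite /v /l powR1 expr1n mul1r add0r expRK invr1 expr1n; lra.
rewrite big_ord_recr /=; have := sq n.+1.
suff : v n.+1 ^+ 2 * (l n.+1)^-1 ^+ 2 <= expR 1 * ((l n)^-1 - (l n.+1)^-1) by lra.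
have ne0 : 0 < n.+1%:R + expR 1 :> R by rewrite ltr_wpDl.
have ne1 : 0 < n%:R + expR 1 :> R by rewrite ltr_wpDl.
have incr : (n.+1%:R + expR 1)^-1 <= l n.+1 - l n.
  have h : n%:R + expR 1 = (n.+1%:R + expR 1) * (1 + - (n.+1%:R + expR 1)^-1) :> R.
    by rewrite mulrDr mulr1 mulrN divff ?gt_eqF// -natr1; ring.
  have h1 : 0 < 1 + - (n.+1%:R + expR 1)^-1 :> R.
    by rewrite -(pmulr_rgt0 _ ne0) -h.
  rewrite /l [in ln (n%:R + _)]h lnM ?posrE//.
  have h2 : -1 < - (n.+1%:R + expR 1)^-1 :> R by move: h1; lra.
  by have := le_ln1Dx h2; lra.
have vv : v n.+1 ^+ 2 <= expR 1 * (n.+1%:R + expR 1)^-1.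
  have := v2 n.+1; move: (v n.+1 ^+ 2) => y hy.
  have n2 : (0 : R) < n.+2%:R by [].
  rewrite ler_pdivlMr// -(ler_pM2l n2) mulrA hy mul1r.
  rewrite -[n.+2%:R]natr1 mulrDl mul1r lerD2r.
  by rewrite ler_peMr// ltW.
have l1 := l_gt0 n; have l2 := l_gt0 n.+1.
have lmono : l n <= l n.+1 by exact: log_mono.
have -> : (l n)^-1 - (l n.+1)^-1 = (l n.+1 - l n) * ((l n)^-1 * (l n.+1)^-1).
  by field; rewrite !gt_eqF.
rewrite mulrA; apply: ler_pM; rewrite ?sqr_ge0//.
  by apply: (le_trans vv); rewrite ler_pM2l.
by rewrite expr2 ler_wpM2r ?invr_ge0 ?(ltW l2)// lef_pV2 ?posrE.
Qed.

Lemma sched_sqrt_log_anti n i : (i < n)%N ->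
  lbar * v n.-1 * (l n.-1)^-1 <= sched_sqrt_log i.
Proof.
move=> i_n; have n0 : (0 < n)%N by apply: leq_trans i_n.
have ip : (i <= n.-1)%N by rewrite -ltnS prednK.
apply: ler_pM.
- by rewrite mulr_ge0 ?(ltW (v_gt0 _))// ltW.
- by rewrite invr_ge0 ltW.
- by rewrite ler_wpM2l ?(ltW lbar_gt0)// v_anti.
- by rewrite lef_pV2 ?posrE ?l_gt0//; exact: log_mono.
Qed.

(** K times the smallest term is of order K^(1/2)/ln K, which r^2 = ln K K^(-1/2) balances. The
    factor 1/2 comes from ln(K - 1 + e) <= ln(2K) <= 2 ln K. *)
Lemma sched_sqrt_log_window K : expR 1 <= K%:R :> R ->
  let r : R := (ln K%:R) `^ (1 / 2) * K%:R `^ (- (1 / 4)) in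
  0 < r /\ lbar / 2 <= r ^+ 2 * \sum_(i < K) sched_sqrt_log i.
Proof.
move=> Ke; have K1 : 1 < K%:R :> R by exact: lt_le_trans expR1_gt1 Ke.
have K0 : (0 < K)%N by rewrite -(ltr_nat R) (lt_trans ltr01).
have K0R : (0 : R) < K%:R by rewrite ltr0n.
set t := K%:R `^ (- (1 / 4)).
have t0 : 0 < t by exact: root_gt0.
have t4 : K%:R * t ^+ 4 = 1 by exact: root_exprp.
have vt : v K.-1 = t ^+ 2.
  by rewrite /v prednK// /t powR_exprn//; congr (_ `^ _); field.
have lnK0 : 0 < ln K%:R :> R by rewrite ln_gt0.
set h := (ln K%:R) `^ (1 / 2).
have h2 : h ^+ 2 = ln K%:R by rewrite /h powR_exprn ?(ltW lnK0)// divfK// powRr1// ltW.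
have h0 : 0 < h by exact: powR_gt0.
move=> r; split; first by rewrite mulr_gt0.
have lK : l K.-1 <= 2 * ln K%:R.
  rewrite (_ : 2 * ln K%:R = ln (K%:R * K%:R)); last by rewrite lnM ?posrE//; ring.
  rewrite /l ler_ln ?posrE ?mulr_gt0 ?ltr_wpDl ?expR_gt0//.
  have K2 : (2 <= K)%N by rewrite -(ltr_nat R) in K0 *; rewrite -(ltr_nat R) in K1 *.
  have K2R : 2 <= K%:R :> R by rewrite ler_nat.
  apply: (@le_trans _ _ (K%:R + K%:R)); first by rewrite lerD// ler_nat leq_pred.
  by move: (K%:R : R) K2R => a; nra.
apply: (@le_trans _ _ (r ^+ 2 * (K%:R * (lbar * v K.-1 * (l K.-1)^-1)))); last first.
  rewrite ler_wpM2l ?sqr_ge0//; apply: sum_ge_const => i; exact: sched_sqrt_log_anti.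
have -> : r ^+ 2 * (K%:R * (lbar * v K.-1 * (l K.-1)^-1)) =
    lbar * (K%:R * t ^+ 4) * (ln K%:R / l K.-1).
  by rewrite vt -h2 /r -/h -/t; ring.
rewrite t4 mulr1 ler_wpM2l ?(ltW lbar_gt0)// ler_pdivlMr//.
by move: lK; lra.
Qed.

(** For n = (m+1)^4 the power part contributes n (m+1)^(-2) = (m+1)^2, while the logarithm is at
    most 4 ln(m+1) + 1 <= 5 (m+1). *)
Lemma sched_sqrt_log_diverges M : exists n, M <= \sum_(i < n) sched_sqrt_log i.
Proof.
pose m := Num.bound (5 * M / lbar); exists (m.+1 ^ 4)%N.
have mM : M <= lbar / 5 * m.+1%:R.
  have h : 5 * M / lbar <= m.+1%:R.
    have [M0|M0] := lerP 0 (5 * M / lbar).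
      by apply: (le_trans (ltW (archi_boundP M0))); rewrite ler_nat.
    by rewrite (le_trans (ltW M0)).
  move: h; rewrite ler_pdivrMr//; lra.
apply: (le_trans mM).
set n := (m.+1 ^ 4)%N.
have n0 : (0 < n)%N by rewrite expn_gt0.
have m0 : 0 < m.+1%:R :> R by rewrite ltr0n.
have vn : v n.-1 = m.+1%:R^-1 ^+ 2.
  have h := v2 n.-1; rewrite prednK// natrX in h.
  have : (m.+1%:R ^+ 2 * v n.-1) ^+ 2 = 1 by rewrite exprMn -exprM.
  move/eqP; rewrite pexpr_eq1 ?mulr_ge0 ?sqr_ge0 ?(ltW (v_gt0 _))// => /eqP e.
  have mm0 : m.+1%:R ^+ 2 != 0 :> R by rewrite expf_neq0// gt_eqF.
  by apply: (mulfI mm0); rewrite e exprVn divff.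
have ln_m : l n.-1 <= 5 * m.+1%:R.
  apply: (@le_trans _ _ (ln (m.+1%:R ^+ 4 * expR 1))).
    rewrite /l ler_ln ?posrE ?mulr_gt0 ?exprn_gt0 ?ltr_wpDl ?expR_gt0//.
    have : n%:R = m.+1%:R ^+ 4 :> R by rewrite natrX.
    have nn : n%:R = n.-1%:R + 1 :> R by rewrite natr1 prednK.
    move=> <-; rewrite nn mulrDl mul1r lerD2r ler_peMr// ltW//.
  rewrite lnM ?posrE ?exprn_gt0 ?expR_gt0// expRK lnXn//.
  have lm : ln m.+1%:R <= m.+1%:R - 1 :> R.
    have -> : m.+1%:R = 1 + m%:R :> R by rewrite addrC natr1.
    rewrite [leRHS]addrAC subrr add0r; apply: le_ln1Dx.
    by rewrite (lt_le_trans _ (ler0n _ _))// oppr_lt0.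
  have aux (a b : R) : a <= b - 1 -> 0 < b -> a *+ 4 + 1 <= 5 * b by lra.
  exact: aux.
apply: (@le_trans _ _ (n%:R * (lbar * v n.-1 * (l n.-1)^-1))); last first.
  by apply: sum_ge_const => i; exact: sched_sqrt_log_anti.
have -> : n%:R * (lbar * v n.-1 * (l n.-1)^-1) = lbar * m.+1%:R ^+ 2 / l n.-1.
  rewrite vn natrX; field; rewrite !gt_eqF//.
rewrite ler_pdivlMr//.
apply: (@le_trans _ _ (lbar / 5 * m.+1%:R * (5 * m.+1%:R))).
  by rewrite ler_wpM2l// mulr_ge0// divr_ge0// ltW.
by rewrite le_eqVlt; apply/orP; left; apply/eqP; field.
Qed.

End schedules.

(** * Convergence of the method *)

Section sgd_convergence.
Context {R : realType} {H : completeNormedModType R}.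
Variable ip : {dot H for @idfun R}.
Hypothesis ip_norm : forall x : H, ip x x = `|x| ^+ 2.
Variable q : nat -> H.
Hypothesis q_dense : forall x e, 0 < e -> exists n, `|x - q n| < e.
Context d {Xi : measurableType d} (D : probability Xi R).
Variables (F : Xi -> H -> R) (f : H -> R) (L gamma : R) (x0 : H).
Hypothesis L_gt0 : 0 < L.
Hypothesis F_bregman : forall xi, bregman_bounds ip L (F xi) (grad ip (F xi)).
Hypothesis F_measurable : forall x, measurable_fun [set: Xi] (fun xi => F xi x).
Hypothesis F_integrable : forall x, rintegrable D (fun xi => F xi x).
Hypothesis f_def : forall x, f x = \int[D]_xi F xi x.
Hypothesis f_quotient : forall x v,
  n.+1%:R * (f (x + n.+1%:R^-1 *: v) - f x) @[n --> \oo] --> ip (grad ip f x) v.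
Hypothesis gamma_gt0 : 0 < gamma.
Hypothesis gamma_lt : gamma < 2 / L.
Variable lbar : R.
Hypothesis lbar_gt0 : 0 < lbar.
Hypothesis lbar_lt1 : lbar < 1.
Variables (z : H) (S : R).
Hypothesis z_min : minimizer f z.
Hypothesis z_moment : grad_moment_le D (fun xi => grad ip (F xi)) z S.

Local Notation G := (fun xi => grad ip (F xi)).

Lemma random_iterate_rate_window (lam : nat -> nat -> R) (rate : nat -> R) V kappa :
  0 < kappa ->
  (\forall K \near \oo, (forall k, 0 <= lam K k <= lbar) /\
     [/\ \sum_(i < K) lam K i ^+ 2 <= V, 0 < rate K &
         kappa <= rate K ^+ 2 * \sum_(i < K) lam K i]) ->
  random_iterate_rate ip D F f gamma x0 lam rate.
Proof.
move=> kappa0 near_lam; exists (random_rate_const L gamma lbar z S x0 V kappa).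
apply: filterS near_lam => K [lamb [hV r0 hk]] d' Omega P xi N xi_iid NK.
rewrite unlock.
exact: (random_rate ip_norm q_dense L_gt0 F_bregman F_measurable F_integrable f_def
  f_quotient gamma_gt0 gamma_lt lbar_gt0 lbar_lt1 z_min z_moment xi_iid lamb
  (X := fun k w => sgd ip F gamma x0 (lam K) (fun k => xi k w) k) (fun=> erefl) (fun _ _ => erefl)
  NK hV kappa0 r0 hk).
Qed.

(** [r] is the scale at which the window is balanced; the announced [rate] may be larger, for
    instance by a logarithmic factor. *)
Lemma last_iterate_rate_window (lam : nat -> nat -> R) (rate r : nat -> R)
    (m : nat -> nat) V kappa tau :
  0 <= V -> 0 < kappa -> 0 <= tau ->
  (\forall K \near \oo, (forall k, 0 <= lam K k <= lbar) /\
     [/\ (m K <= K)%N, \sum_(i < K) lam K i ^+ 2 <= V, 0 < r K <= rate K,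
         kappa <= r K ^+ 2 * \sum_(i < K - m K) lam K (m K + i)%N &
         \sum_(i < K - m K) lam K (m K + i)%N ^+ 2 <= tau * r K ^+ 2]) ->
  last_iterate_rate ip D F f gamma x0 lam rate.
Proof.
move=> V0 kappa0 tau0 near_lam.
exists (last_rate_const L gamma lbar z S x0 V kappa tau).
apply: filterS near_lam => K [lamb [mK hV /andP[r0 rr] hk ht]] d' Omega P xi xi_iid.
rewrite unlock.
apply: (le_trans (last_rate ip_norm q_dense L_gt0 F_bregman F_measurable F_integrable f_def
  f_quotient gamma_gt0 gamma_lt lbar_gt0 lbar_lt1 z_min z_moment xi_iid lamb
  (X := fun k w => sgd ip F gamma x0 (lam K) (fun k => xi k w) k) (fun=> erefl) (fun _ _ => erefl)
  (subnKC mK) hV kappa0 r0 hk ht)).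
rewrite lee_fin ler_wpM2l// /last_rate_const.
have e0 := energy_ge0 gamma lbar_lt1 z_moment x0 V0.
have d0 := drift_ge0 L_gt0 gamma_gt0 lbar_lt1 z_moment x0 V0.
have dec0 := ltW (decrease_gt0 L_gt0 gamma_gt0 gamma_lt).
rewrite addr_ge0 ?divr_ge0// mulr_ge0 ?(ltW L_gt0)//.
by rewrite addr_ge0 ?(mulr_ge0 d0)// divr_ge0 ?(ltW kappa0)// divr_ge0.
Qed.

Section trajectory.
Variables (lam : nat -> R) (V : R).
Hypothesis lam_bounds : forall k, 0 <= lam k <= lbar.
Hypothesis sum_lam2 : forall n, \sum_(i < n) lam i ^+ 2 <= V.
Hypothesis sum_lam_unbounded : forall M, exists n, M <= \sum_(i < n) lam i.
Context d0 (Omega : measurableType d0) (P : probability Omega R).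
Variable xi : nat -> {RV P >-> Xi}.
Hypothesis xi_iid : iid D xi.

Local Notation X := (fun w => sgd ip F gamma x0 lam (fun k => xi k w)).

(* The null set excluded in the convergence of [`|x_k - z'|] depends on the
   minimizer [z'], so the latter is restricted to a countable dense family. *)
Lemma ae_sqdist_cvg_minimizers :
  {ae P, forall w, forall z', minimizer f z' -> cvgn (fun k => `|X w k - z'| ^+ 2)}.
Proof.
(* One minimizer is picked near each [q n] when there is one, and z otherwise. A minimizer y near
   [q n] is then within 2/(m+1) of the pick. *)
pose A n (m : nat) := [set y | minimizer f y /\ `|y - q n| < m.+1%:R^-1].
pose Z n m := xget z (A n m).
have Zmin n m : minimizer f (Z n m) by rewrite /Z; case: xgetP => // y _ [].
have Zdense y e : minimizer f y -> 0 < e -> exists n m, `|y - Z n m| < e.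
  move=> ymin e0; pose m := Num.bound (2 / e).
  have me : 2 * m.+1%:R^-1 < e.
    rewrite ltr_pdivrMr// mulrC -ltr_pdivrMr//.
    apply: lt_le_trans (_ : m%:R <= _); last by rewrite ler_nat.
    by apply: archi_boundP; rewrite divr_ge0// ltW.
  have m0 : 0 < m.+1%:R^-1 :> R by rewrite invr_gt0.
  have [n yn] := q_dense y m0.
  exists n, m; apply: (le_lt_trans (ler_distD (q n) _ _)); apply: lt_trans me.
  rewrite mulr_natl mulr2n ltrD//.
  by rewrite distrC /Z; case: xgetP => [? _ []//|/(_ y) []].
have : {ae P, forall w, forall n m, cvgn (fun k => `|X w k - Z n m| ^+ 2)}.
  apply: ae_foralln => n; apply: ae_foralln => m.
  exact: (ae_sqdist_cvg ip_norm q_dense L_gt0 F_bregman F_measurable F_integrable f_def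
    f_quotient gamma_gt0 gamma_lt lbar_gt0 lbar_lt1 (Zmin n m)
    (grad_moment_shift ip_norm q_dense L_gt0 F_bregman F_measurable (Z n m) z_moment)
    xi_iid lam_bounds (X := fun k w => X w k) (fun=> erefl) (fun _ _ => erefl) sum_lam2).
apply: filterS => w Zcvg z' z'min.
have normcvg n m : cvgn (fun k => `|X w k - Z n m|).
  rewrite (_ : (fun k => _) = (fun k => Num.sqrt (`|X w k - Z n m| ^+ 2))).
    apply/cvg_ex; exists (Num.sqrt (limn (fun k => `|X w k - Z n m| ^+ 2))).
    by apply: continuous_cvg; [exact: sqrt_continuous|exact: Zcvg].
  by apply/funext => k; rewrite sqrtr_sqr normr_id.
(* Unsquared distances are 1-Lipschitz in z', uniformly in k, so convergence passes from the dense
   family to every minimizer. *)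
apply/cvg_ex; suff /cvg_ex[l hl] : cvgn (fun k => `|X w k - z'|).
  by exists (l ^+ 2); rewrite expr2; under eq_fun do rewrite expr2; exact: cvgM.
apply/cauchy_cvgP/cauchy_exP => eps eps0.
have [n [m znm]] := Zdense z' (eps / 2) z'min (divr_gt0 eps0 (ltr0Sn R 1)).
have /cvg_ex[l hl] := normcvg n m; exists l.
move/cvgrPdist_lt : hl => /(_ (eps / 2) (divr_gt0 eps0 (ltr0Sn R 1))); apply: filterS => k /= hk.
rewrite -ball_normE /= (splitr eps).
apply: (le_lt_trans (ler_distD `|X w k - Z n m| _ _)); apply: ltrD => //.
apply: le_lt_trans znm; apply: (le_trans (ler_dist_dist _ _)).
by rewrite opprB addrC addrA subrK.
Qed.

Lemma ae_trajectory :
  {ae P, forall w, (exists2 x, minimizer f x & weakly_cvg ip (X w) x) /\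
    `|grad ip f (X w k)| @[k --> \oo] --> 0}.
Proof.
have fB := f_bregman L_gt0 F_bregman F_measurable F_integrable f_def f_quotient.
have := ae_value_cvg ip_norm q_dense L_gt0 F_bregman F_measurable F_integrable f_def
  f_quotient gamma_gt0 gamma_lt lbar_gt0 lbar_lt1 z_min z_moment xi_iid lam_bounds
  (X := fun k w => X w k) (fun=> erefl) (fun _ _ => erefl) sum_lam2 sum_lam_unbounded.
apply: filterS2 ae_sqdist_cvg_minimizers => w dcvg fcvg; split.
  apply: (opial ip_norm dcvg) => [U p UU oU Up|]; last by exists z.
  have PU : ProperFilter U by exact: ultra_proper.
  suff fp : f p <= f z by move=> y; apply: (le_trans fp); exact: z_min.
  have fU : f (X w k) @[k --> U] --> f z by apply: cvg_trans fcvg; exact: cvg_app.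
  (* Weak lower semicontinuity: the affine minorant of f at p tends to f p along U and stays below f
     x_k, which tends to f z. *)
  have gU : f p + (ip (grad ip f p) (X w k) - ip (grad ip f p) p) @[k --> U] --> f p.
    rewrite -[X in _ --> X]addr0 -[X in _ + X](subrr (ip (grad ip f p) p)).
    apply: cvgD; first exact: cvg_cst.
    apply: cvgB; last exact: cvg_cst.
    under eq_fun do rewrite ipC.
    by rewrite ipC; exact: Up.
  apply: (ler_cvg_to gU fU); apply: nearW => k.
  have /andP[h _] := fB p (X w k).
  by move: h; rewrite ipDr ipNr; lra.
apply/cvgrPdist_lt => eps eps0.
(* The threshold matches |grad f x|^2 <= 2 L (f x - f z). *)
move/cvgrPdist_lt : fcvg => /(_ (eps ^+ 2 / (2 * L))).
have L2 : 0 < 2 * L by rewrite mulr_gt0.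
rewrite divr_gt0 ?exprn_gt0// => /(_ isT); apply: filterS => k /=.
rewrite sub0r normrN normr_id distrC ger0_norm ?subr_ge0// ltr_pdivlMr// mulrC => h.
rewrite -(@ltr_pXn2r _ 2) ?nnegrE ?(ltW eps0)//; apply: le_lt_trans h.
exact: (grad_le_gap ip_norm L_gt0 F_bregman F_measurable F_integrable f_def f_quotient _ z_min).
Qed.

End trajectory.

Lemma almost_sure_convergence_schedule (lam : nat -> R) V :
  (forall k, 0 <= lam k <= lbar) -> (forall n, \sum_(i < n) lam i ^+ 2 <= V) ->
  (forall M, exists n, M <= \sum_(i < n) lam i) ->
  almost_sure_convergence ip D F f gamma x0 lam.
Proof.
move=> lamb lam2 lamM d' Omega P xi xi_iid.
by split; have := ae_trajectory lamb lam2 lamM xi_iid; apply: filterS => w [].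
Qed.

End sgd_convergence.

Theorem mainTheorem7 (R : realType) (H : completeNormedModType R)
  (ip : {dot H for @idfun R})
  (ip_norm : forall x : H, ip x x = `|x| ^+ 2)
  (H_separable : separable H)
  (d : measure_display) (Xi : measurableType d) (D : probability Xi R)
  (F : Xi -> H -> R) (f : H -> R) (L sigma gamma : R) (x0 : H)
  (L_gt0 : 0 < L)
  (F_convex : forall xi, convex_function [set: convex_lmodType H] (F xi))
  (F_smooth : forall xi, smooth ip L (F xi))
  (F_measurable : forall x, measurable_fun [set: Xi] (fun xi => F xi x))
  (F_integrable : forall x, D.-integrable [set: Xi] (fun xi => (F xi x)%:E))
  (f_def : forall x, (f x)%:E = ('E_D[fun xi => F xi x])%E)
  (F_differentiable : {ae D, forall xi, forall x, differentiable (F xi) x})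
  (f_differentiable : forall x, differentiable f x)
  (f_grad : forall x,
    is_bochner_integral D (fun xi => grad ip (F xi) x) (grad ip f x))
  (f_min : exists x, minimizer f x)
  (f_min_var : exists2 xs, minimizer f xs &
    ('E_D[fun xi => (`|grad ip (F xi) xs| ^+ 2)%R] <= (sigma ^+ 2)%R%:E)%E)
  (gamma_gt0 : 0 < gamma) (gamma_lt : gamma < 2 / L)
  (lbar : R) (lbar_gt0 : 0 < lbar) (lbar_lt1 : lbar < 1) :
  [/\ random_iterate_rate ip D F f gamma x0
        (fun K _ => lbar * K%:R `^ (- (1 / 2)))
        (fun K => K%:R `^ (- (1 / 4))),
      random_iterate_rate ip D F f gamma x0
        (fun _ k => lbar * k.+1%:R `^ (- (1 / 2)) * (ln (k%:R + expR 1))^-1)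
        (fun K => (ln K%:R) `^ (1 / 2) * K%:R `^ (- (1 / 4))),
      last_iterate_rate ip D F f gamma x0
        (fun K _ => lbar * K%:R `^ (- (2 / 3)))
        (fun K => K%:R `^ (- (1 / 6))),
      last_iterate_rate ip D F f gamma x0
        (fun _ k => lbar * k.+1%:R `^ (- (2 / 3)))
        (fun K => (ln K%:R) `^ (1 / 2) * K%:R `^ (- (1 / 6))) &
      almost_sure_convergence ip D F f gamma x0
        (fun k => lbar * k.+1%:R `^ (- (1 / 2)) * (ln (k%:R + expR 1))^-1) /\
      almost_sure_convergence ip D F f gamma x0
        (fun k => lbar * k.+1%:R `^ (- (2 / 3)))].

Proof.
have [q q_dense] := separable_dense_seq H_separable.
have F_bregman xi := convex_smooth_bregman ip_norm L_gt0 (F_smooth xi) (F_convex xi).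
have f_Rint x : f x = \int[D]_xi F xi x
  by rewrite /Rintegral; have := f_def x; rewrite unlock => <-.
have f_quot x v := cvg_grad_quotient ip_norm (v := v) (f_differentiable x).
have [z z_min z_var] := f_min_var.
have z_moment : grad_moment_le D (fun xi => grad ip (F xi)) z (sigma ^+ 2).
  by move: z_var; rewrite unlock.
have near_gt0 : \forall K \near \oo, (0 < K)%N by exists 1%N.
have near_ge_e : \forall K \near \oo, expR 1 <= K%:R :> R.
  exact: nbhs_infty_ger.
have ln_ge1 K : expR 1 <= K%:R :> R -> 1 <= ln K%:R :> R.
  move=> Ke; rewrite -[leLHS]expRK ler_ln ?posrE ?expR_gt0//.
  exact: lt_le_trans (expR_gt0 1) Ke.
split.
- apply: (random_iterate_rate_window ip_norm q_dense x0 L_gt0 F_bregman F_measurable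
    F_integrable f_Rint f_quot gamma_gt0 gamma_lt lbar_gt0 lbar_lt1 z_min z_moment
    (V := 1) lbar_gt0).
  apply: filterS near_gt0 => K K0; split; first by move=> k; exact: (sched_sqrt_bounds lbar_gt0).
  exact: (sched_sqrt_window lbar_gt0 lbar_lt1 K0).
- apply: (random_iterate_rate_window ip_norm q_dense x0 L_gt0 F_bregman F_measurable
    F_integrable f_Rint f_quot gamma_gt0 gamma_lt lbar_gt0 lbar_lt1 z_min z_moment
    (V := 1 + expR 1) (kappa := lbar / 2) (divr_gt0 lbar_gt0 (ltr0Sn R 1))).
  apply: filterS near_ge_e => K Ke;
  split; first by move=> k; exact: (sched_sqrt_log_bounds lbar_gt0).
  have [r0 hk] := sched_sqrt_log_window lbar_gt0 Ke.
  by split => //; exact: (sched_sqrt_log_sum2 lbar_gt0 lbar_lt1).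
- apply: (last_iterate_rate_window ip_norm q_dense x0 L_gt0 F_bregman F_measurable
    F_integrable f_Rint f_quot gamma_gt0 gamma_lt lbar_gt0 lbar_lt1 z_min z_moment
    (V := 1) (kappa := lbar) (tau := 1) (m := fun=> 0%N) (r := fun K => K%:R `^ (- (1 / 6)))) => //.
  apply: filterS near_gt0 => K K0.
  split; first by move=> k; exact: (sched_twothirds_bounds lbar_gt0).
  have [V1 r0 hk ht] := sched_twothirds_window lbar_gt0 lbar_lt1 K0.
  by rewrite subn0; split => //; rewrite r0 lexx.
- apply: (last_iterate_rate_window ip_norm q_dense x0 L_gt0 F_bregman F_measurable
    F_integrable f_Rint f_quot gamma_gt0 gamma_lt lbar_gt0 lbar_lt1 z_min z_moment
    (V := 4) (kappa := lbar / 2) (tau := 4) (m := fun K => K./2)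
    (r := fun K => K%:R `^ (- (1 / 6)))) => //; first exact: divr_gt0.
  apply: filterS2 near_gt0 near_ge_e => K K0 Ke.
  split; first by move=> k; exact: (sched_twothirds_inc_bounds lbar_gt0).
  have [r0 hk ht] := sched_twothirds_inc_window lbar_gt0 lbar_lt1 K0.
  split => //; first by rewrite -divn2 leq_div.
    exact: (sched_twothirds_inc_sum2 lbar_gt0 lbar_lt1).
  (* The window balances at r = K^(-1/6); for K >= e the factor ln(K)^(1/2) is at least 1, so r is
     below the announced rate. *)
  rewrite r0 /= ler_peMl ?(ltW r0)//.
  have lnK := ln_ge1 _ Ke; apply: (@le_trans _ _ (1 `^ (1 / 2))); first by rewrite powR1.
  by apply: ge0_ler_powR; rewrite ?nnegrE ?divr_ge0// (le_trans ler01).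
- split.
    exact: (almost_sure_convergence_schedule ip_norm q_dense x0 L_gt0 F_bregman F_measurable
      F_integrable f_Rint f_quot gamma_gt0 gamma_lt lbar_gt0 lbar_lt1 z_min z_moment
      (sched_sqrt_log_bounds lbar_gt0) (sched_sqrt_log_sum2 lbar_gt0 lbar_lt1)
      (sched_sqrt_log_diverges lbar_gt0)).
  exact: (almost_sure_convergence_schedule ip_norm q_dense x0 L_gt0 F_bregman F_measurable
    F_integrable f_Rint f_quot gamma_gt0 gamma_lt lbar_gt0 lbar_lt1 z_min z_moment
    (sched_twothirds_inc_bounds lbar_gt0) (sched_twothirds_inc_sum2 lbar_gt0 lbar_lt1)
    (sched_twothirds_inc_diverges lbar_gt0)).
Qed.
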